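(* Let $0\le m<1$, and let $f:\mathbb{R}_+\to\mathbb{R}_+$ be continuous, with $f(\|x-y\|)$ the spatial covariance of the Gaussian noise $F$ described in the context. Assume that there is $0<\alpha<1$ such that $$\int_{0^+}f(r)\,r^{1-\alpha}\,dr<\infty.$$ Then the process $$X(t,x)=\int_{(0,t]\times\mathbb{R}^2}G(t-s,x-y,m)\,dF(s,y),\qquad t>0,\ x\in\mathbb{R}^2,$$ is Hölder continuous in $(t,x)$ with exponent $b$ for every $b\in(0,\frac{\alpha}{4})$; that is, $X$ has a modification whose sample paths are almost surely Hölder continuous with exponent $b$ on bounded subsets of $(0,\infty)\times\mathbb{R}^2$.
   Context: $\|\cdot\|$ is the Euclidean norm on $\mathbb{R}^2$; $\int_{0^+}(\cdots)\,dr<\infty$ means that the integral over $(0,\delta)$ is finite for some (small) $\delta>0$. The noise: $F=(F(\phi),\ \phi\in C_0^\infty(\mathbb{R}^3))$ is an $L^2$-valued mean-zero Gaussian process with covariance $$E[F(\phi_1)F(\phi_2)]=\int_{\mathbb{R}_+}\int_{\mathbb{R}^2}\int_{\mathbb{R}^2}\phi_1(t,x)\,f(\|x-y\|)\,\phi_2(t,y)\,dx\,dy\,dt.$$ It extends to a worthy martingale measure (in the sense of Walsh) $F((0,t]\times A):=F(1_{(0,t]\times A})$, $A$ a Borel set of $\mathbb{R}^2$, and integrals $\int\cdots dF(s,y)$ are Walsh stochastic integrals with respect to it. The function $G$ is the Green function of the operator $(\frac{\partial}{\partial t}+m\frac{\partial}{\partial x_1})^2-\Delta$ on $\mathbb{R}_+\times\mathbb{R}^2$: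 $$G(t,x,m)=\frac{1_{\{t-(\rho(x)-\frac{m x_1}{1-m^2})\ge0\}}}{2\pi\sqrt{1-m^2}\,\sqrt{\big(t+\frac{m x_1}{1-m^2}\big)^2-\rho^2(x)}},\qquad \rho(x)=\sqrt{\frac{x_1^2}{(1-m^2)^2}+\frac{x_2^2}{1-m^2}},\quad x=(x_1,x_2).$$ *)

(* Defs.v *)
From HB Require Import structures.
From mathcomp Require Import all_boot all_order all_algebra.
From mathcomp Require Import all_classical all_reals all_analysis.
From mathcomp Require Import measurable_realfun.

Set Implicit Arguments.
Unset Strict Implicit.
Unset Printing Implicit Defensive.

Import Order.TTheory GRing.Theory Num.Theory.
Import numFieldNormedType.Exports.

Local Open Scope classical_set_scope.
Local Open Scope ring_scope.

Notation plane R := (R * R)%type.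
Notation spacetime R := (R * (R * R))%type.

(* The library norm on a product is the maximum norm. *)
Definition enorm (R : realType) (x : plane R) : R :=
  Num.sqrt (x.1 ^+ 2 + x.2 ^+ 2).

Notation plane_measure R :=
  (product_measure1 (@lebesgue_measure R) (@lebesgue_measure R)).

Section test_functions.
Context (R : realType).
Implicit Types phi : spacetime R -> R.

Fixpoint Ck (k : nat) phi : Prop :=
  if k is k'.+1 then
    [/\ continuous phi,
        (forall z v, derivable phi z v) &
        (forall v, Ck k' (fun z => 'D_v phi z))]
  else continuous phi.

Definition test_function phi : Prop :=
  (forall k, Ck k phi) /\ compact (closure [set z | phi z != 0]).

End test_functions.

Section covariance.
Context (R : realType).
Local Open Scope ereal_scope.

Definition cov (f : R -> R) (phi psi : spacetime R -> R) : \bar R :=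
  \int[lebesgue_measure]_(t in `[0%R, +oo[)
    \int[plane_measure R]_x \int[plane_measure R]_y
      (phi (t, x) * f (enorm (x - y)) * psi (t, y))%:E.

(* Squared norm defined by the dominating measure of the worthy martingale
   measure.  As f >= 0, the covariance measure dominates itself, so this is the
   covariance form applied to the absolute value. *)
Definition dom_norm2 (f : R -> R) (phi : spacetime R -> R) : \bar R :=
  cov f (fun z => `|phi z|%R) (fun z => `|phi z|%R).

End covariance.

Section noise.
Context (d : measure_display) (Omega : measurableType d) (R : realType).
Context (P : probability Omega R).

(* [normal_prob m 0] is not the Dirac mass at [m] in the library. *)
Definition gaussian_rv (Z : Omega -> R) : Prop :=
  exists m s : R, forall V : set R, measurable V ->
    P (Z @^-1` V) = if s == 0 then \d_m V else normal_prob m s V.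

Definition gaussian_process (I : Type) (D : set I) (Z : I -> {RV P >-> R}) :
    Prop :=
  forall (n : nat) (c : 'I_n -> R) (i : 'I_n -> I), (forall k, D (i k)) ->
    gaussian_rv (fun w => \sum_(k < n) c k * Z (i k) w).

Definition gaussian_noise (f : R -> R)
    (F : (spacetime R -> R) -> {RV P >-> R}) : Prop :=
  [/\ gaussian_process (@test_function R) F,
      (forall phi, test_function phi ->
         (F phi : Omega -> R) \in Lfun P 2%:E),
      (forall phi, test_function phi -> ('E_P[F phi] = 0)%E) &
      (forall phi psi, test_function phi -> test_function psi ->
         'E_P[fun w => (F phi w * F psi w)%R]%E = cov f phi psi)].

Definition cvg_L2 (Z : nat -> Omega -> R) (Y : Omega -> R) : Prop :=
  'E_P[fun w => ((Z n w - Y w) ^+ 2)%R]%E @[n --> \oo] --> 0%E.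

(* Y is a version of F(g), the extension of F to g by completion. *)
Definition noise_extension (f : R -> R)
    (F : (spacetime R -> R) -> {RV P >-> R}) (g : spacetime R -> R)
    (Y : Omega -> R) : Prop :=
  exists phi : nat -> spacetime R -> R,
    [/\ (forall n, test_function (phi n)),
        dom_norm2 f (fun z => phi n z - g z) @[n --> \oo] --> 0%E &
        cvg_L2 (fun n => F (phi n)) Y].

(* [M t A] is F((0, t] x A). *)
Definition martingale_measure_of (f : R -> R)
    (F : (spacetime R -> R) -> {RV P >-> R})
    (M : R -> set (plane R) -> {RV P >-> R}) : Prop :=
  forall (t : R) (A : set (plane R)), 0 <= t ->
    measurable A -> bounded_set A ->
    noise_extension f F (\1_(`]0, t] `*` A)) (M t A).

(* The function c 1_(a, b](s) 1_A(y). In Walsh's construction c is a bounded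
   random variable, measurable with respect to the past of time a; for the
   integral of a deterministic function constants c suffice, since taking the
   expectation of a random simple function does not increase its distance to a
   deterministic function. *)
Record elementary := Elementary {
  el_coef : R;
  el_left : R;
  el_right : R;
  el_base : set (plane R);
  el_left_ge0 : 0 <= el_left;
  el_left_le_right : el_left <= el_right;
  el_base_measurable : measurable el_base;
  el_base_bounded : bounded_set el_base }.

Definition simple_fun (h : seq elementary) (z : spacetime R) : R :=
  \sum_(e <- h)
    el_coef e * \1_(`]el_left e, el_right e] `*` el_base e) z.

Definition simple_integral (M : R -> set (plane R) -> {RV P >-> R})
    (h : seq elementary) (w : Omega) : R :=
  \sum_(e <- h)
    el_coef e * (M (el_right e) (el_base e) w - M (el_left e) (el_base e) w).

(* Y is a version of the Walsh integral of g with respect to M. *)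
Definition walsh_integral (f : R -> R)
    (M : R -> set (plane R) -> {RV P >-> R}) (g : spacetime R -> R)
    (Y : Omega -> R) : Prop :=
  exists h : nat -> seq elementary,
    dom_norm2 f (fun z => simple_fun (h n) z - g z) @[n --> \oo] --> 0%E /\
    cvg_L2 (fun n => simple_integral M (h n)) Y.

End noise.

Section green_function.
Context (R : realType).
Implicit Types (t m : R) (x : plane R).

Definition rho m x : R :=
  Num.sqrt (x.1 ^+ 2 / (1 - m ^+ 2) ^+ 2 + x.2 ^+ 2 / (1 - m ^+ 2)).

(* Where the denominator vanishes, which is a Lebesgue-null set of (t, x), the
   value is 0. *)
Definition green t x m : R :=
  if 0 <= t - (rho m x - m * x.1 / (1 - m ^+ 2)) then
    (2 * pi * Num.sqrt (1 - m ^+ 2)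
     * Num.sqrt ((t + m * x.1 / (1 - m ^+ 2)) ^+ 2 - rho m x ^+ 2))^-1
  else 0.

End green_function.

Definition hoelder_on (R : realType) (B : set (spacetime R)) (b : R)
    (u : spacetime R -> R) : Prop :=
  exists C : R, forall z z' : spacetime R, B z -> B z' ->
    `|u z - u z'| <= C * (`|z.1 - z'.1| + enorm (z.2 - z'.2)) `^ b.

(* Main.v *)
From HB Require Import structures.
Require Import Defs.
From mathcomp Require Import all_boot all_order all_algebra.
From mathcomp Require Import all_classical all_reals all_analysis.
From mathcomp Require Import measurable_realfun.
From mathcomp Require Import ring lra.

(** After the drift x1 -> x1 - m t, the Green function becomes the kernel
    (2 pi)^-1 (t^2 - |x|^2)^(-1/2) of the forward cone (lemma [green_wprof]).
    The theorem then rests on three facts.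

    - The increments of the kernel are small in the norm that dominates the
      covariance.  The quadratic form q = t^2 - |x|^2 is locally Lipschitz in the
      space-time point, and differences of q^(-1/2) interpolate: a perturbation of
      q by at most h changes q^(-1/2) by at most h^k q^(-1/2-k), for 0 <= k <= 1
      ([wave_diff]).  For k = alpha/4 the kernel q^(-b), b = 1/2 + alpha/4, still
      has finite norm ([wave_cov_bound]).  Its covariance integrates
      f(|z|) v^(-b) (v+D)^(-b), where v and v+D are the values of q at two points
      x and x+z of the plane, and D = |2 z.x + |z|^2|.  This is at most
      f(|z|) v^(-(1-alpha/4)) D^(-3alpha/4); integrating in t and in the two
      coordinates of x removes v and leaves f(|z|) |z1|^(-3alpha/4), whose integral
      in polar coordinates is a multiple of that of f(r) r^(1-3alpha/4).  Hence the
      squared norm of an increment is at most C dist^(alpha/2)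
      ([kernel_increment]).

    - The increments of X have Gaussian tails.  They are L^2 limits of linear
      combinations of the variables F(phi), which are Gaussian with second moment
      at most the squared norm of the integrand ([combination_second_moment],
      [represents_tail]).  Passing to limits needs the norm to satisfy
      a triangle inequality up to a constant, that is, the covariance form to be
      positive definite.  The noise itself gives this: the second moments of its
      combinations are nonnegative, so the form satisfies a Cauchy-Schwarz
      inequality on combinations of translated bumps ([noise_positive_on_bumps]),
      and every bounded nonnegative function of bounded support is close to such
      combinations, for f is a continuous function plus one of small mass near 0
      ([pform_cs_boxed], [pform_cauchy_schwarz]).

    - Chaining.  Since 2b < alpha/2, the probability that X varies by more than
      2^(-bn) between two points at distance of order 2^-n decays faster
      than any power of 2^-n ([pair_tail_rate]), so it stays summable when added
      over the O(2^(6n)) pairs of points of a bounded dyadic grid.  By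
      Borel-Cantelli almost every path is regular on fine grids, and its limit
      along dyadic projections is a Hoelder modification
      ([grid_limit_hoelder], [continuous_modification]). *)

Set Implicit Arguments.
Unset Strict Implicit.
Unset Printing Implicit Defensive.

Import Order.TTheory GRing.Theory Num.Theory.
Import numFieldNormedType.Exports.

Local Open Scope classical_set_scope.
Local Open Scope ring_scope.

(** * Measurability of explicit functions *)

Section measurability.
Context d (T : measurableType d) (R : realType).
Implicit Types (f g : T -> R) (D : set T).

Lemma mf_fst d1 d2 (T1 : measurableType d1) (T2 : measurableType d2) D
  (h : T -> T1 * T2) : measurable_fun D h -> measurable_fun D (fun x => (h x).1).
Proof. by move=> mh; apply: measurableT_comp. Qed.

Lemma mf_snd d1 d2 (T1 : measurableType d1) (T2 : measurableType d2) D
  (h : T -> T1 * T2) : measurable_fun D h -> measurable_fun D (fun x => (h x).2).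
Proof. by move=> mh; apply: measurableT_comp. Qed.

Lemma mf_pair d1 d2 (T1 : measurableType d1) (T2 : measurableType d2)
  (h1 : T -> T1) (h2 : T -> T2) : measurable_fun setT h1 -> measurable_fun setT h2 ->
  measurable_fun setT (fun x => (h1 x, h2 x)).
Proof. by move=> m1 m2; exact: measurable_fun_pair. Qed.

Lemma mf_add D f g : measurable_fun D f -> measurable_fun D g ->
  measurable_fun D (fun x => f x + g x).
Proof. exact: measurable_funD. Qed.

Lemma mf_mul D f g : measurable_fun D f -> measurable_fun D g ->
  measurable_fun D (fun x => f x * g x).
Proof. exact: measurable_funM. Qed.

Lemma mf_opp D f : measurable_fun D f -> measurable_fun D (fun x => - f x).
Proof. exact: measurable_funN. Qed.

Lemma mf_norm D f : measurable_fun D f -> measurable_fun D (fun x => `|f x|).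
Proof. by move=> mf; apply: measurableT_comp. Qed.

Lemma mf_exp D f n : measurable_fun D f -> measurable_fun D (fun x => f x ^+ n).
Proof. exact: measurable_funX. Qed.

Lemma mf_powR D f p : measurable_fun D f -> measurable_fun D (fun x => f x `^ p).
Proof. by move=> mf; exact: (measurableT_comp (measurable_powR p)). Qed.

Lemma mf_inv D f : measurable_fun D f -> measurable_fun D (fun x => (f x)^-1).
Proof.
move=> mf; have minv : measurable_fun [set: R] (@GRing.inv R).
  rewrite (_ : [set: R] = [set x | x != 0] `|` [set 0]); last first.
    by apply/seteqP; split => x //= _; have [->|] := eqVneq x 0; [right|left].
  have m0 : measurable [set x : R | x != 0].
    by apply: open_measurable; exact: open_neq.
  apply/measurable_funU => //; split; last exact: measurable_fun_set1.
  apply: open_continuous_measurable_fun; first exact: open_neq.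
  by move=> x; rewrite inE/= => x0; exact: inv_continuous.
exact: (measurableT_comp minv).
Qed.

Lemma mf_sqrt D f : measurable_fun D f ->
  measurable_fun D (fun x => Num.sqrt (f x)).
Proof.
move=> mf; apply: measurableT_comp => //.
by apply: continuous_measurable_fun; exact: sqrt_continuous.
Qed.

Lemma mf_ltr D f g : measurable_fun D f -> measurable_fun D g ->
  measurable_fun D (fun x => f x < g x).
Proof. exact: measurable_fun_ltr. Qed.

Lemma mf_ler D f g : measurable_fun D f -> measurable_fun D g ->
  measurable_fun D (fun x => f x <= g x).
Proof. exact: measurable_fun_ler. Qed.

Lemma mf_eqr D f g : measurable_fun D f -> measurable_fun D g ->
  measurable_fun D (fun x => f x == g x).
Proof. exact: measurable_fun_eqr. Qed.

Lemma mf_if d' (T' : measurableType d') (b : T -> bool) (h k : T -> T') :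
  measurable_fun setT b -> measurable_fun setT h -> measurable_fun setT k ->
  measurable_fun setT (fun x => if b x then h x else k x).
Proof. by move=> mb mh mk; exact: measurable_fun_ifT. Qed.

Lemma mf_and D (b c : T -> bool) : measurable_fun D b -> measurable_fun D c ->
  measurable_fun D (fun x => b x && c x).
Proof. exact: measurable_and. Qed.

Lemma mf_min D f g : measurable_fun D f -> measurable_fun D g ->
  measurable_fun D (fun x => Num.min (f x) (g x)).
Proof. exact: measurable_minr. Qed.

Lemma mf_max D f g : measurable_fun D f -> measurable_fun D g ->
  measurable_fun D (fun x => Num.max (f x) (g x)).
Proof. exact: measurable_maxr. Qed.

Lemma mf_EFin D f : measurable_fun D f -> measurable_fun D (fun x => (f x)%:E).
Proof. by move=> mf; apply/measurable_EFinP. Qed.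

Lemma mf_emul D (f g : T -> \bar R) : measurable_fun D f -> measurable_fun D g ->
  measurable_fun D (fun x => f x * g x)%E.
Proof. exact: emeasurable_funM. Qed.

Lemma mf_eadd D (f g : T -> \bar R) : measurable_fun D f -> measurable_fun D g ->
  measurable_fun D (fun x => f x + g x)%E.
Proof. exact: emeasurable_funD. Qed.

Lemma mf_enorm (h : T -> plane R) : measurable_fun setT h ->
  measurable_fun setT (fun x => enorm (h x)).
Proof.
move=> mh; rewrite /enorm; apply: mf_sqrt.
by apply: mf_add; apply: mf_exp; [apply: mf_fst|apply: mf_snd].
Qed.

Lemma mf_padd (h k : T -> plane R) : measurable_fun setT h ->
  measurable_fun setT k -> measurable_fun setT (fun x => h x + k x).
Proof.
move=> mh mk; apply: (@mf_pair _ _ _ _ (fun x => (h x).1 + (k x).1)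
  (fun x => (h x).2 + (k x).2)).
  by apply: mf_add; apply: mf_fst.
by apply: mf_add; apply: mf_snd.
Qed.

Lemma mf_popp (h : T -> plane R) : measurable_fun setT h ->
  measurable_fun setT (fun x => - h x).
Proof.
move=> mh; apply: (@mf_pair _ _ _ _ (fun x => - (h x).1) (fun x => - (h x).2)).
  by apply: mf_opp; apply: mf_fst.
by apply: mf_opp; apply: mf_snd.
Qed.

End measurability.

(** [mfun] reads the syntax of the function, so that measurability of explicit
    formulas needs no manual decomposition.  The eta-expansion lets its patterns
    bind the subterms. *)
Ltac eta_measurable :=
  lazymatch goal with
  | |- @measurable_fun ?d1 ?d2 ?T1 ?T2 ?D ?f =>
      change (@measurable_fun d1 d2 T1 T2 D (fun x => f x)); cbv beta
  end.

Ltac mfun_step :=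
  eta_measurable;
  lazymatch goal with
  | |- measurable_fun _ (fun _ => ?c) => exact: measurable_cst
  | |- measurable_fun _ (fun x => x) => exact: measurable_id
  | |- measurable_fun _ fst => exact: measurable_fst
  | |- measurable_fun _ snd => exact: measurable_snd
  | |- measurable_fun _ (fun x => EFin (@?f x)) => apply: mf_EFin
  | |- measurable_fun _ (fun x => @GRing.add _ (@?f x) (@?g x)) =>
      first [apply: mf_add | apply: mf_eadd | apply: mf_padd]
  | |- measurable_fun _ (fun x => adde (@?f x) (@?g x)) => apply: mf_eadd
  | |- measurable_fun _ (fun x => @GRing.mul _ (@?f x) (@?g x)) => apply: mf_mul
  | |- measurable_fun _ (fun x => mule (@?f x) (@?g x)) => apply: mf_emul
  | |- measurable_fun _ (fun x => @GRing.opp _ (@?f x)) => first [apply: mf_opp | apply: mf_popp]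
  | |- measurable_fun _ (fun x => @GRing.inv _ (@?f x)) => apply: mf_inv
  | |- measurable_fun _ (fun x => @GRing.exp _ (@?f x) _) => apply: mf_exp
  | |- measurable_fun _ (fun x => @Num.norm _ _ (@?f x)) => apply: mf_norm
  | |- measurable_fun _ (fun x => @powR _ (@?f x) _) => apply: mf_powR
  | |- measurable_fun _ (fun x => Num.Def.sqrtr (@?f x)) => apply: mf_sqrt
  | |- measurable_fun _ (fun x => @Order.lt _ _ (@?f x) (@?g x)) => apply: mf_ltr
  | |- measurable_fun _ (fun x => @Order.le _ _ (@?f x) (@?g x)) => apply: mf_ler
  | |- measurable_fun _ (fun x => @eq_op _ (@?f x) (@?g x)) => apply: mf_eqr
  | |- measurable_fun _ (fun x => @Order.min _ _ (@?f x) (@?g x)) => apply: mf_min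
  | |- measurable_fun _ (fun x => @Order.max _ _ (@?f x) (@?g x)) => apply: mf_max
  | |- measurable_fun _ (fun x => andb (@?f x) (@?g x)) => apply: mf_and
  | |- measurable_fun _ (fun x => (@?f x, @?g x)) => apply: mf_pair
  | |- measurable_fun _ (fun x => fst (@?f x)) => apply: mf_fst
  | |- measurable_fun _ (fun x => snd (@?f x)) => apply: mf_snd
  | |- measurable_fun _ (fun x => @enorm _ (@?f x)) => apply: mf_enorm
  | |- _ => apply: mf_if
  end.

Ltac mfun := repeat first [assumption | mfun_step].

(** * Lebesgue measure under affine maps *)

Section affine.
Context (R : realType).
Local Notation L := (@lebesgue_measure R).
Local Open Scope ereal_scope.

(** The image of Lebesgue measure under [x => k * x + c], scaled by [k], packaged
    as a measure so that the uniqueness of Lebesgue measure applies to it. *)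
Lemma affine_measure (k c : R) : exists nu : {measure set (measurableTypeR R) -> \bar R},
  (forall A, nu A = `|k|%:E * L [set x | A (k * x + c)%R]) /\
  (forall h : R -> \bar R, measurable_fun setT h -> (forall x, 0 <= h x) ->
    \int[nu]_x h x = `|k|%:E * \int[L]_x h (k * x + c)%R).
Proof.
have maff : measurable_fun [set: measurableTypeR R]
    (fun x : measurableTypeR R => (k * x + c)%R : measurableTypeR R).
  by apply: mf_add => //; apply: mf_mul.
unshelve (eexists (mscale (NngNum (normr_ge0 k)) (pushforward L
  (fun x : measurableTypeR R => (k * x + c)%R : measurableTypeR R)))).
  exact: maff.
split=> // h mh h0; rewrite ge0_integral_mscale//=.
by rewrite ge0_integral_pushforward.
Qed.

(** Both sides are measures that agree on half-open intervals. *)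
Lemma lebesgue_affine (k c : R) (A : set R) : k != 0%R -> measurable A ->
  L A = `|k|%:E * L [set x | A (k * x + c)%R].
Proof.
move=> k0 mA; have [nu [nuE _]] := affine_measure k c; rewrite -nuE.
apply: lebesgue_measure_unique => //= X [[a b]] _ <-; rewrite nuE.
have [kp|kn|/eqP] := ltgtP k 0%R; last by rewrite (negbTE k0).
- rewrite ltr0_norm//.
  rewrite (_ : [set x | `](a, b).1, (a, b).2]%classic (k * x + c)%R] = `[((b - c) / k)%R, ((a - c) / k)%R[%classic); last first.
    apply/seteqP; split => x /=; rewrite !in_itv/= => /andP[h1 h2]; apply/andP; split.
    + by rewrite ler_ndivrMr//; lra.
    + by rewrite ltr_ndivlMr//; lra.
    + by move: h2; rewrite ltr_ndivlMr// => h2; lra.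
    + by move: h1; rewrite ler_ndivrMr// => h1; lra.
  rewrite !lebesgue_measure_itv/= !lte_fin ltr_nM2r ?invr_lt0// ltrD2r.
  case: ifPn => _; rewrite ?mule0// -!EFinD -EFinM; congr EFin; field; exact: k0.
- rewrite gtr0_norm//.
  rewrite (_ : [set x | `](a, b).1, (a, b).2]%classic (k * x + c)%R] = `]((a - c) / k)%R, ((b - c) / k)%R]%classic); last first.
    apply/seteqP; split => x /=; rewrite !in_itv/= => /andP[h1 h2]; apply/andP; split.
    + by rewrite ltr_pdivrMr//; lra.
    + by rewrite ler_pdivlMr//; lra.
    + by move: h1; rewrite ltr_pdivrMr// => h1; lra.
    + by move: h2; rewrite ler_pdivlMr// => h2; lra.
  rewrite !lebesgue_measure_itv/= !lte_fin ltr_pM2r ?invr_gt0// ltrD2r.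
  case: ifPn => _; rewrite ?mule0// -!EFinD -EFinM; congr EFin; field; exact: k0.
Qed.

Lemma ge0_integral_affine (k c : R) (h : R -> \bar R) : k != 0%R ->
  measurable_fun setT h -> (forall x, 0 <= h x) ->
  \int[L]_x h x = `|k|%:E * \int[L]_x h (k * x + c)%R.
Proof.
move=> k0 mh h0.
have [nu [nuE nuI]] := affine_measure k c; rewrite -nuI//.
by apply: eq_measure_integral => //= A mA _; rewrite nuE; exact: lebesgue_affine.
Qed.

Lemma ge0_integral_reflect (c : R) (h : R -> \bar R) :
  measurable_fun setT h -> (forall x, 0 <= h x) ->
  \int[L]_x h (c - x)%R = \int[L]_x h x.
Proof.
move=> mh h0; rewrite [RHS](@ge0_integral_affine (-1)%R c)// ?lt0r_neq0//.
  by rewrite normrN normr1 mul1e; apply: eq_integral => x _; rewrite mulN1r addrC.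
Qed.

Lemma ge0_integral_shift (c : R) (h : R -> \bar R) :
  measurable_fun setT h -> (forall x, 0 <= h x) ->
  \int[L]_x h (x + c)%R = \int[L]_x h x.
Proof.
move=> mh h0; rewrite [RHS](@ge0_integral_affine 1%R c)// ?oner_eq0//.
by rewrite normr1 mul1e; apply: eq_integral => x _; rewrite mul1r.
Qed.

Lemma measurable_integral2 d (T : measurableType d) (h : T * R -> \bar R) :
  measurable_fun setT h -> (forall x, 0 <= h x) ->
  measurable_fun setT (fun x => \int[L]_y h (x, y)).
Proof. by move=> mh h0; exact: (@measurable_fun_fubini_tonelli_F _ _ T (measurableTypeR R) R L h mh h0). Qed.

Lemma plane_integral (h : plane R -> \bar R) :
  measurable_fun setT h -> (forall x, 0 <= h x) ->
  \int[plane_measure R]_x h x = \int[L]_x \int[L]_y h (x, y).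
Proof. by move=> mh h0; exact: (@fubini_tonelli1 _ _ (measurableTypeR R) (measurableTypeR R) R L L h mh h0). Qed.

Lemma plane_swap (h : plane R -> \bar R) :
  measurable_fun setT h -> (forall x, 0 <= h x) ->
  \int[L]_x \int[L]_y h (x, y) = \int[L]_y \int[L]_x h (x, y).
Proof. by move=> mh h0; exact: (@fubini_tonelli _ _ (measurableTypeR R) (measurableTypeR R) R L L h mh h0). Qed.

Lemma plane_reflect (c : plane R) (h : plane R -> \bar R) :
  measurable_fun setT h -> (forall x, 0 <= h x) ->
  \int[plane_measure R]_x h (c - x)%R = \int[plane_measure R]_x h x.
Proof.
move=> mh h0.
have mcx : measurable_fun setT (fun x : plane R => h (c - x)%R).
  apply: (measurableT_comp mh).
  rewrite (_ : (fun x : plane R => _) = (fun x => (c.1 - x.1, c.2 - x.2)%R)); last first.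
    by apply/funext => -[].
  mfun.
rewrite (plane_integral mcx (fun x => h0 _)) (plane_integral mh h0).
rewrite -[RHS](@ge0_integral_reflect c.1); last 2 first.
- exact: measurable_integral2.
- by move=> x; exact: integral_ge0.
apply: eq_integral => x _ /=.
by rewrite -[RHS](@ge0_integral_reflect c.2)//; apply: (measurableT_comp mh); mfun.
Qed.

Lemma plane_shift (c : plane R) (h : plane R -> \bar R) :
  measurable_fun setT h -> (forall x, 0 <= h x) ->
  \int[plane_measure R]_x h (x + c)%R = \int[plane_measure R]_x h x.
Proof.
move=> mh h0.
have mcx : measurable_fun setT (fun x : plane R => h (c - x)%R).
  apply: (measurableT_comp mh).
  rewrite (_ : (fun x : plane R => _) = (fun x => (c.1 - x.1, c.2 - x.2)%R)); last first.
    by apply/funext => -[].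
  mfun.
transitivity (\int[plane_measure R]_x h (c - x)%R); last exact: plane_reflect.
rewrite -(@plane_reflect 0%R _ mcx (fun=> h0 _)).
by apply: eq_integral => x _; rewrite sub0r opprK addrC.
Qed.

End affine.

Section kernel.
Context (R : realType) (f : R -> R).
Hypothesis f_cont : forall r : R, 0 < r -> {for r, continuous f}.

Lemma enorm_ge0 (x : plane R) : 0 <= enorm x.
Proof. exact: sqrtr_ge0. Qed.

(** Only [r > 0] is a continuity point of [f]; the origin of the plane is a
    measurable point, and is treated apart. *)
Lemma measurable_kernel : measurable_fun setT (fun x : plane R => f (enorm x)).
Proof.
have mg : measurable_fun (`[0, +oo[%classic : set R) f.
  rewrite (_ : (`[0, +oo[%classic : set R) = `]0, +oo[ `|` [set 0]); last first.
    apply/seteqP; split => x /=; rewrite !in_itv/= !andbT.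
      by rewrite le_eqVlt => /orP[/eqP <-|]; [right|left].
    by case=> [/ltW//|->].
  apply/measurable_funU => //; split; last exact: measurable_fun_set1.
  apply: open_continuous_measurable_fun => // x; rewrite inE/= in_itv/= andbT.
  exact: f_cont.
rewrite (_ : (fun _ => _) = (f \_ (`[0, +oo[%classic : set R)) \o @enorm R); last first.
  by apply/funext => x /=; rewrite patchE ifT// inE/= in_itv/= enorm_ge0.
apply: measurableT_comp; last by rewrite /enorm; mfun.
apply: (measurable_restrictT f _).1 => //.
Qed.

Lemma mf_kernel d (T : measurableType d) (h : T -> plane R) : measurable_fun setT h ->
  measurable_fun setT (fun x => f (enorm (h x))).
Proof. exact: (measurableT_comp measurable_kernel). Qed.

End kernel.

Section continuous_measurable.
Context (R : realType).

Definition dyadic (n : nat) (x : R) : R := (Num.floor (x * 2 ^+ n))%:~R / 2 ^+ n.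

Lemma dyadic_le n x : dyadic n x <= x.
Proof. by rewrite /dyadic ler_pdivrMr ?exprn_gt0// floor_le. Qed.

Lemma dyadic_gt n x : x < dyadic n x + 2 ^- n.
Proof.
rewrite /dyadic -[X in _ + X]mul1r -mulrDl ltr_pdivlMr ?exprn_gt0//.
by rewrite -[X in _ + X]/(1%:~R) -intrD floorD1_gt.
Qed.

Lemma dyadic_cvg x : dyadic n x @[n --> \oo] --> x.
Proof.
have half0 : (2^-1 : R) ^+ n @[n --> \oo] --> 0.
  by apply: cvg_expr; rewrite gtr0_norm//; lra.
apply: (@squeeze_cvgr _ _ _ _ (fun n => x - 2^-1 ^+ n) (cst x)).
- near=> n; rewrite dyadic_le andbT lerBlDr.
  by rewrite exprVn ltW// dyadic_gt.
- by rewrite -[X in _ --> X]subr0; apply: cvgB => //; exact: cvg_cst.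
- exact: cvg_cst.
Unshelve. all: by end_near. Qed.

Lemma measurable_dyadic n : measurable_fun setT (dyadic n).
Proof.
apply: nondecreasing_measurable => // x y xy.
rewrite /dyadic ler_pM2r ?invr_gt0 ?exprn_gt0// ler_int le_floor//.
by rewrite ler_pM2r// exprn_gt0.
Qed.

(** The Borel sets of the product measurable structure are not those of the
    product topology by definition.  A continuous function is the limit of its
    compositions with dyadic rounding, which are measurable because rounding takes
    countably many values, with measurable fibres. *)
Lemma continuous_spacetime_measurable (h : spacetime R -> R) :
  continuous h -> measurable_fun setT h.
Proof.
move=> ch.
pose dz n (z : spacetime R) := (dyadic n z.1, (dyadic n z.2.1, dyadic n z.2.2)).
pose e n (k : int * (int * int)) : spacetime R :=
  (k.1%:~R / 2 ^+ n, (k.2.1%:~R / 2 ^+ n, k.2.2%:~R / 2 ^+ n)).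
have mdz n : measurable_fun setT (dz n).
  by apply: mf_pair; [|apply: mf_pair];
    apply: (measurableT_comp (measurable_dyadic n)); mfun.
apply: (@measurable_fun_cvg _ _ _ _ (fun n z => h (dz n z))) => //.
  move=> n _ B mB; rewrite setTI.
  have -> : (fun z => h (dz n z)) @^-1` B =
      \bigcup_k ((dz n) @^-1` [set z | z = e n k /\ B (h (e n k))]).
    apply/seteqP; split => z /=.
      move=> Bz; exists (Num.floor (z.1 * 2 ^+ n),
        (Num.floor (z.2.1 * 2 ^+ n), Num.floor (z.2.2 * 2 ^+ n))) => //.
    by case=> k _ [-> ].
  apply: countable_bigcupT_measurable; first exact: countableP.
  move=> k.
  rewrite -[X in measurable X]setTI; apply: mdz => //.
  have [Bk|nBk] := pselect (B (h (e n k))); last first.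
    by rewrite (_ : [set _ | _] = set0)//; apply/seteqP; split => z // [].
  rewrite (_ : [set _ | _] = [set (e n k).1] `*` ([set (e n k).2.1] `*` [set (e n k).2.2])).
    by apply: measurableX => //; apply: measurableX.
  apply/seteqP; split => [z [-> _]//|[t [x y]] /= [-> [-> ->]]].
  by split.
move=> z _; apply: cvg_comp; last exact: ch.
case: z => t [x y]; rewrite /dz /=.
have h2 : (dyadic n x, dyadic n y) @[n --> \oo] --> ((x, y) : plane R).
  by apply: (@cvg_pair _ _ _ _ (nbhs x) (nbhs y)); exact: dyadic_cvg.
have h3 : (dyadic n t, (dyadic n x, dyadic n y)) @[n --> \oo] --> ((t, (x, y)) : spacetime R).
  by apply: (@cvg_pair _ _ _ _ (nbhs t) (nbhs ((x, y) : plane R))) => //; exact: dyadic_cvg.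
exact: h3.
Qed.

End continuous_measurable.

(** * One-dimensional power integrals *)

Section limits.
Context d (T : measurableType d) (R : realType) (mu : {measure set T -> \bar R}).
Local Open Scope ereal_scope.

Lemma ge0_leT_integral (f g : T -> \bar R) : (forall x, 0 <= f x) ->
  measurable_fun setT f -> measurable_fun setT g -> (forall x, f x <= g x) ->
  \int[mu]_x f x <= \int[mu]_x g x.
Proof. by move=> f0 mf mg fg; apply: ge0_le_integral. Qed.

(** Monotone convergence, for bounds proved on an exhaustion of the domain. *)
Lemma integral_le_exhaust (h : nat -> T -> \bar R) (H : T -> \bar R) (B : \bar R) :
  (forall n, measurable_fun setT (h n)) -> measurable_fun setT H ->
  (forall n x, 0 <= h n x) -> (forall x, 0 <= H x) ->
  (forall n x, h n x <= h n.+1 x) -> (forall x, exists n, H x <= h n x) ->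
  (forall n, \int[mu]_x h n x <= B) -> \int[mu]_x H x <= B.
Proof.
move=> mh mH h0 H0 hS Hh hB.
have ndh x : {homo h^~ x : n m / (n <= m)%N >-> n <= m}.
  by apply/nondecreasing_seqP => n; exact: hS.
apply: (@le_trans _ _ (\int[mu]_x limn (h ^~ x))).
  apply: ge0_leT_integral => //.
    by apply: emeasurable_fun_cvg => // x _; exact: ereal_nondecreasing_is_cvgn.
  move=> x; have [n Hn] := Hh x; apply: (le_trans Hn).
  apply: lime_ge; first exact: ereal_nondecreasing_is_cvgn.
  by near=> k; apply: ndh; near: k; exists n.
rewrite monotone_convergence//; apply: lime_le.
  apply: ereal_nondecreasing_is_cvgn => n m nm.
  by apply: ge0_leT_integral => // x; exact: ndh.
exact: nearW.
Unshelve. all: by end_near. Qed.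

End limits.

Section powers.
Context (R : realType).
Local Notation L := (@lebesgue_measure R).
Local Open Scope ereal_scope.

Lemma leb_le (f g : R -> \bar R) : (forall x, 0 <= f x) ->
  measurable_fun setT f -> measurable_fun setT g -> (forall x, f x <= g x) ->
  \int[L]_x f x <= \int[L]_x g x.
Proof. by move=> f0 mf mg fg; apply: (@ge0_leT_integral _ (measurableTypeR R) R L). Qed.

Lemma leb_add (f g : R -> \bar R) : (forall x, 0 <= f x) -> (forall x, 0 <= g x) ->
  measurable_fun setT f -> measurable_fun setT g ->
  \int[L]_x (f x + g x) = \int[L]_x f x + \int[L]_x g x.
Proof. by move=> f0 g0 mf mg; apply: ge0_integralD. Qed.

Lemma leb_mull (k : R) (f : R -> \bar R) : (0 <= k)%R -> (forall x, 0 <= f x) ->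
  measurable_fun setT f -> \int[L]_x (k%:E * f x) = k%:E * \int[L]_x f x.
Proof. by move=> k0 f0 mf; apply: ge0_integralZl. Qed.

Lemma powR2_lt1 (r : R) : (0 < r)%R -> (2 `^ (- r) < 1)%R.
Proof.
move=> r0; rewrite powRN invf_lt1 ?powR_gt0//.
have {1}-> : 1%R = (1 `^ r)%R :> R by rewrite powR1.
by rewrite gt0_ltr_powR// ?nnegrE; lra.
Qed.

Lemma integral_ocitv_cst (a b k : R) : (a <= b)%R -> (0 <= k)%R ->
  \int[L]_x (if (a < x) && (x <= b) then k else 0%R)%:E = (k * (b - a))%:E.
Proof.
move=> ab k0.
transitivity (\int[L]_(x in `]a, b]) k%:E).
  rewrite [RHS]integral_mkcond; apply: eq_integral => x _.
  by rewrite patchE mem_setE in_itv/=; case: ifP.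
rewrite integral_cst//= lebesgue_measure_itv/= lte_fin.
have [ablt|ba] := ltP a b; first by rewrite -EFinD -EFinM.
by rewrite (@le_anti _ _ a b) ?ab// mule0 subrr mulr0.
Qed.

(** The power is self-similar: doubling the variable maps the integral over
    ]2^-(n+1), 1/2] to [a = 2^(w-1) < 1] times that over ]2^-n, 1].  The integrals
    [I n] over ]2^-n, 1] thus satisfy [I n.+1 <= a * I n + a], which keeps them below
    [a / (1 - a)]. *)
Lemma power_zero_bound (w : R) : (0 <= w < 1)%R -> exists2 B : R, (0 <= B)%R &
  \int[L]_x (if (0 < x) && (x <= 1) then x `^ (- w) else 0%R)%:E <= B%:E.
Proof.
move=> /andP[w0 w1].
pose a := ((2 : R) `^ (w - 1))%R.
have a0 : (0 < a)%R by rewrite powR_gt0.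
have a1 : (a < 1)%R by rewrite /a -[X in (_ `^ X)%R]opprK powR2_lt1//; lra.
have aE : ((2 : R) `^ w = a * 2)%R.
  rewrite /a powRD; last by apply/implyP.
  by rewrite powR_inv1// mulfVK.
pose B := (a / (1 - a))%R.
have B0 : (0 <= B)%R by rewrite divr_ge0//; lra.
have BE : (a * B + a = B)%R by rewrite /B; field; lra.
exists B => //.
pose h n x := (if (2 ^- n < x) && (x <= 1) then x `^ (- w) else 0%R : R)%:E.
have mh n : measurable_fun setT (h n) by rewrite /h; mfun.
have mh2 n : measurable_fun setT (fun x : R => h n (2 * x + 0)%R) by rewrite /h; mfun.
have h0 n x : 0 <= h n x by rewrite /h lee_fin; case: ifP => // _; exact: powR_ge0.
apply: (@integral_le_exhaust _ _ _ L h) => //.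
- by mfun.
- by move=> x; rewrite lee_fin; case: ifP => // _; exact: powR_ge0.
- move=> n x; rewrite /h lee_fin; case: ifPn => [/andP[nx x1]|_].
    rewrite ifT// x1 andbT (le_lt_trans _ nx)// lef_pV2 ?posrE ?exprn_gt0//.
    by rewrite exprS ler_peMl ?exprn_ge0//; lra.
  by case: ifP => // _; exact: powR_ge0.
- move=> x; rewrite /h; case: ifPn => [/andP[x0 x1]|_]; last first.
    by exists 0%N; rewrite lee_fin; case: ifP => // _; exact: powR_ge0.
  exists (Num.bound x^-1); rewrite x1 andbT ifT//.
  rewrite invf_plt ?posrE ?exprn_gt0//.
  apply: (@lt_trans _ _ (Num.bound x^-1)%:R).
    by rewrite archi_boundP// invr_ge0 ltW.
  by rewrite -natrX ltr_nat ltn_expl.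
elim=> [|n IH].
  rewrite integral0_eq ?lee_fin// => x _; rewrite /h expr0 invr1.
  by case: ifPn => // /andP[h1 h2]; have := lt_le_trans h1 h2; rewrite ltxx.
apply: (@le_trans _ _ (\int[L]_x ((2 `^ w)%:E * h n (2 * x + 0)%R +
   (if (2^-1 < x) && (x <= 1) then 2 `^ w else 0%R)%:E))).
  apply: leb_le => //.
  - by mfun; exact: mh2.
  - move=> x; rewrite /h -EFinM -EFinD lee_fin addr0.
    case: (ifPn ((2 ^- n.+1 < x) && _)%R) => [/andP[nx x1]|_]; last first.
      by rewrite addr_ge0 ?mulr_ge0 ?powR_ge0//; case: ifP => // _; exact: powR_ge0.
    have x0 : (0 < x)%R by apply: lt_trans nx; rewrite invr_gt0 exprn_gt0.
    have [xh|xh] := leP x (2^-1)%R.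
      rewrite addr0 ifT; last first.
        apply/andP; split; last by lra.
        by move: nx; rewrite exprS invfM; lra.
      rewrite powRM ?(ltW x0)// mulrA -powRD; last by apply/implyP.
      by rewrite subrr powRr0 mul1r.
    rewrite x1/=; apply: ler_wpDl.
      by rewrite mulr_ge0 ?powR_ge0//; case: ifP => // _; exact: powR_ge0.
    rewrite powRN -[leRHS]invrK lef_pV2 ?posrE ?invr_gt0 ?powR_gt0//.
    rewrite -powRN -mulN1r powRrM powR_inv1//.
    by rewrite ge0_ler_powR// ?nnegrE ?(ltW x0) ?(ltW xh)// invr_ge0.
rewrite leb_add; last 4 first.
- by move=> x; rewrite mule_ge0// lee_fin powR_ge0.
- by move=> x; rewrite lee_fin; case: ifP => // _; exact: powR_ge0.
- by mfun; exact: mh2.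
- by mfun.
rewrite integral_ocitv_cst ?powR_ge0//; last by lra.
rewrite leb_mull ?powR_ge0//.
have := IH; rewrite (@ge0_integral_affine _ 2 0 (h n))//.
rewrite ger0_norm// => IH'.
have -> : (2 `^ w)%:E = a%:E * 2%:E by rewrite aE EFinM.
rewrite -muleA aE.
apply: (@le_trans _ _ (a%:E * B%:E + (a * 2 * (1 - 2^-1))%:E)).
  by rewrite leeD2r// lee_wpmul2l// lee_fin ltW.
by rewrite -EFinM -EFinD lee_fin; lra.
Qed.

(** As for [power_zero_bound], halving the variable: the integrals over ]1, 2^n]
    satisfy [I n.+1 <= a * I n + 1] with [a = 2^(1-p) < 1]. *)
Lemma power_infty_bound (p : R) : (1 < p)%R -> exists2 B : R, (0 <= B)%R &
  \int[L]_x (if (1 < x)%R then x `^ (- p) else 0%R)%:E <= B%:E.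
Proof.
move=> p1.
pose a := ((2 : R) `^ (1 - p))%R.
have a0 : (0 < a)%R by rewrite powR_gt0.
have a1 : (a < 1)%R.
  by rewrite /a -opprB powR2_lt1// subr_gt0.
have aE : ((2 : R) `^ (- p) * 2 = a)%R.
  rewrite /a addrC powRD; last by apply/implyP.
  by rewrite powRr1.
pose B := ((1 - a)^-1)%R.
have B0 : (0 <= B)%R by rewrite invr_ge0; lra.
have BE : (a * B + 1 = B)%R by rewrite /B; field; lra.
exists B => //.
pose h n x := (if (1 < x)%R && (x <= 2 ^+ n)%R then x `^ (- p) else 0%R : R)%:E.
have mh n : measurable_fun setT (h n) by rewrite /h; mfun.
have mh2 n : measurable_fun setT (fun x : R => h n (2^-1 * x + 0)%R).
  by rewrite /h; mfun.
have h0 n x : 0 <= h n x by rewrite /h lee_fin; case: ifP => // _; exact: powR_ge0.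
apply: (@integral_le_exhaust _ _ _ L h) => //.
- by mfun.
- by move=> x; rewrite lee_fin; case: ifP => // _; exact: powR_ge0.
- move=> n x; rewrite /h lee_fin; case: ifPn => [/andP[nx x1]|_].
    rewrite ifT// nx (le_trans x1)//= exprS ler_peMl ?exprn_ge0//; lra.
  by case: ifP => // _; exact: powR_ge0.
- move=> x; rewrite /h; case: ifPn => [x1|_]; last first.
    by exists 0%N.
  exists (Num.bound x); rewrite ifT//=.
  apply: ltW; apply: (@lt_trans _ _ (Num.bound x)%:R).
    by rewrite archi_boundP// ltW// (lt_trans _ x1).
  by rewrite -natrX ltr_nat ltn_expl.
elim=> [|n IH].
  rewrite integral0_eq ?lee_fin// => x _; rewrite /h expr0.
  by case: ifPn => // /andP[h1 h2]; have := lt_le_trans h1 h2; rewrite ltxx.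
apply: (@le_trans _ _ (\int[L]_x ((2 `^ (- p))%:E * h n (2^-1 * x + 0)%R +
   (if (1 < x)%R && (x <= 2)%R then 1%R else 0%R : R)%:E))).
  apply: leb_le => //.
  - by mfun.
  - move=> x; rewrite /h -EFinM -EFinD lee_fin addr0.
    case: (ifPn ((1 < x)%R && _)%R) => [/andP[x1 nx]|_]; last first.
      by rewrite addr_ge0 ?mulr_ge0 ?powR_ge0//; case: ifP => // _; exact: powR_ge0.
    have [xh|xh] := leP x 2%R.
      rewrite x1/= ler_wpDl ?mulr_ge0 ?powR_ge0//.
        by case: ifP => // _; exact: powR_ge0.
      rewrite powRN invf_le1 ?powR_gt0//; last by lra.
      have {1}-> : 1%R = (1 `^ p)%R :> R by rewrite powR1.
      by rewrite ge0_ler_powR ?nnegrE//; lra.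
    rewrite andbF addr0 ifT; last first.
      apply/andP; split; first by lra.
      by move: nx; rewrite exprS; lra.
    by rewrite -powRM//; [rewrite mulVKf|lra].
rewrite leb_add; last 4 first.
- by move=> x; rewrite mule_ge0// lee_fin powR_ge0.
- by move=> x; rewrite lee_fin; case: ifP.
- by mfun.
- by mfun.
rewrite integral_ocitv_cst//; last by lra.
rewrite leb_mull ?powR_ge0//.
have := IH; rewrite (@ge0_integral_affine _ 2^-1 0 (h n))//.
rewrite ger0_norm//; set J := (X in _ * X <= _) => IH'.
have IH2 : J <= (2 * B)%:E.
  have -> : J = 2%:E * ((2^-1)%:E * J) by rewrite muleA -EFinM mulfV// mul1e.
  by rewrite EFinM; apply: lee_wpmul2l.
apply: (@le_trans _ _ ((2 `^ (- p))%:E * (2 * B)%:E + (1 * (2 - 1))%:E)).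
  by rewrite leeD2r// lee_wpmul2l// lee_fin powR_ge0.
by rewrite -EFinM -EFinD lee_fin mulrA aE; lra.
Qed.

(** The value at 0 is [+oo] rather than 0, so that a pointwise bound by a singular
    power needs no exception at the singularity. *)
Definition sing (w x : R) : \bar R := if x == 0%R then +oo else (`|x| `^ (- w))%:E.

Lemma sing_ge0 w x : 0 <= sing w x.
Proof. by rewrite /sing; case: ifP => // _; rewrite lee_fin powR_ge0. Qed.

Lemma measurable_sing w : measurable_fun setT (sing w).
Proof. by rewrite /sing; mfun. Qed.

Lemma mf_sing d (T : measurableType d) w (h : T -> R) : measurable_fun setT h ->
  measurable_fun setT (fun x => sing w (h x)).
Proof. exact: (measurableT_comp (measurable_sing w)). Qed.

Lemma leb_setD1 (f : R -> \bar R) (r : R) : measurable_fun setT f ->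
  (forall x, 0 <= f x) ->
  \int[L]_x f x = \int[L]_x (if x == r then 0 else f x).
Proof.
move=> mf f0; rewrite -(@integral_setD1 _ _ r)//; last 2 first.
- exact: measurableD.
- exact: measurable_funTS.
rewrite integral_mkcond; apply: eq_integral => x _.
rewrite patchE; case: ifPn => [|].
  by rewrite inE/= => -[_ /eqP/negbTE ->].
by rewrite notin_setE/=; case: eqVneq => // /eqP xr; case; split.
Qed.

End powers.

Section sing_bound.
Context (R : realType).
Local Notation L := (@lebesgue_measure R).
Local Open Scope ereal_scope.

Lemma integral_box (r : R) : (0 <= r)%R ->
  \int[L]_x (if (`|x| <= r)%R then 1%R else 0%R : R)%:E = (2 * r)%:E.
Proof.
move=> r0; transitivity (\int[L]_(x in `[(- r)%R, r]) 1%:E).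
  rewrite [RHS]integral_mkcond; apply: eq_integral => x _.
  by rewrite patchE mem_setE in_itv/= ler_norml; case: ifP.
rewrite integral_cst//= lebesgue_measure_itv/= lte_fin mul1e.
have [_|rr] := ltP (- r)%R r; first by rewrite -EFinD opprK mulr_natl.
by congr EFin; lra.
Qed.

(** The bound does not depend on the position [- c] of the singularity: within
    distance 1 of it the power is integrable, and it is at most 1 farther away. *)
Lemma sing_bound (w : R) : (0 <= w < 1)%R -> exists2 B : R, (0 <= B)%R &
  forall r c : R, (0 <= r)%R ->
  \int[L]_x (if (`|x| <= r)%R then sing w (x + c) else 0) <= (B + 2 * r)%:E.
Proof.
move=> w01; have [B0 B00 hB] := power_zero_bound w01.
exists (2 * B0)%R; first by rewrite mulr_ge0.
move=> r c r0.
pose q (y : R) := (if (0 < y)%R && (y <= 1)%R then y `^ (- w) else 0%R : R)%:E.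
have mq : measurable_fun setT q by rewrite /q; mfun.
have q0 y : 0 <= q y by rewrite /q lee_fin; case: ifP => // _; exact: powR_ge0.
pose i (x : R) := (if (`|x| <= r)%R then 1%R else 0%R : R)%:E.
have mi : measurable_fun setT i by rewrite /i; mfun.
have i0 y : 0 <= i y by rewrite /i lee_fin; case: ifP.
have mq1 : measurable_fun setT (fun x : R => q (x + c)%R) by apply: (measurableT_comp mq); mfun.
have mq2 : measurable_fun setT (fun x : R => q (- c - x)%R) by apply: (measurableT_comp mq); mfun.
have ms : measurable_fun setT (fun x : R => if (`|x| <= r)%R then sing w (x + c) else 0).
  by mfun; apply: mf_sing; mfun.
rewrite (@leb_setD1 _ _ (- c)%R)//; last by move=> x; case: ifP => // _; exact: sing_ge0.
apply: (@le_trans _ _ (\int[L]_x (q (x + c)%R + q (- c - x)%R + i x))).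
  apply: leb_le.
  - by move=> x; do 2 case: ifP => //; move=> *; exact: sing_ge0.
  - by mfun.
  - by mfun.
  - move=> x; case: eqVneq => [_|xc]; first by rewrite !adde_ge0.
    case: (ifPn (`|x| <= r)%R) => xr; last by rewrite !adde_ge0.
    have xc0 : (x + c)%R != 0%R by rewrite addr_eq0.
    rewrite /sing (negbTE xc0).
    have [xc1|xc1] := leP `|x + c|%R 1%R; last first.
      apply: lee_paddl; first by rewrite adde_ge0.
      rewrite /i xr lee_fin powRN invf_le1 ?powR_gt0 ?normr_gt0//.
      have {1}-> : 1%R = (1 `^ w)%R :> R by rewrite powR1.
      by rewrite ge0_ler_powR ?nnegrE//; [case/andP: w01|exact: ltW].
    apply: lee_paddr => //.
    have [xp|xn] := ltP 0%R (x + c)%R.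
      apply: lee_paddr => //; rewrite /q xp/= ger0_norm ?(ltW xp)//.
      by rewrite ger0_norm ?(ltW xp)// in xc1; rewrite xc1.
    apply: lee_paddl => //; rewrite ler0_norm// in xc1 *.
    have -> : (- (x + c) = - c - x)%R by ring.
    have e : (- (x + c) = - c - x)%R by ring.
    rewrite /q ifT//; rewrite -e xc1 andbT oppr_gt0 lt_neqAle xc0//.
rewrite leb_add//; last 2 first.
- by move=> x; exact: adde_ge0.
- by mfun.
rewrite leb_add// (@ge0_integral_shift _ c q)// (@ge0_integral_reflect _ (- c)%R q)//.
rewrite integral_box//.
rewrite EFinD leeD2r// mulr_natl mulr2n EFinD.
exact: leeD.
Qed.

End sing_bound.

(** * Polar coordinates *)

Section polar.
Context (R : realType) (f : R -> R).
Hypothesis f_ge0 : forall r : R, 0 <= r -> 0 <= f r.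
Hypothesis f_cont : forall r : R, 0 < r -> {for r, continuous f}.
Local Notation L := (@lebesgue_measure R).
Local Open Scope ereal_scope.

Lemma mf_absf d (T : measurableType d) (h : T -> R) : measurable_fun setT h ->
  measurable_fun setT (fun x => f `|h x|%R).
Proof.
move=> mh; rewrite (_ : (fun x => _) = (fun x => f (enorm (h x, 0%R)))).
  by apply: (mf_kernel f_cont); mfun.
by apply/funext => x; rewrite /enorm/= expr0n addr0 sqrtr_sqr.
Qed.

(** Even, since the radial variable used below, a multiple of the first coordinate,
    takes both signs. *)
Definition radial (w l r : R) : \bar R :=
  (if (r != 0%R) && (`|r| <= l)%R then f `|r|%R * `|r| `^ (1 - w) else 0%R)%:E.

Lemma radial_ge0 w l r : 0 <= radial w l r.
Proof. by rewrite lee_fin; case: ifP => // _; rewrite mulr_ge0 ?powR_ge0// f_ge0. Qed.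

Lemma measurable_radial w l : measurable_fun setT (radial w l).
Proof.
rewrite /radial; apply: mf_EFin; apply: mf_if; [|by mfun; apply: mf_absf|by mfun].
apply: mf_and; last by mfun.
by apply: measurable_neg; mfun.
Qed.

(** Substituting [z2 = u * z1] turns the norm of [z] into [sqrt (1 + u^2) * |z1|];
    rescaling [z1] by this factor splits the integral into the radial integral
    times that of [(1 + u^2) `^ ((w - 2) / 2)], which converges because [w < 1]. *)
Lemma polar_bound (w l : R) : (0 < w < 1)%R -> (0 <= l)%R ->
  \int[L]_r radial w l r < +oo ->
  \int[plane_measure R]_z (if (enorm z <= l)%R then (f (enorm z))%:E * sing w z.1 else 0)
   < +oo.
Proof.
move=> w01 l0 hJ; have [w0 w1] := andP w01.
pose H (z : plane R) := if (enorm z <= l)%R then (f (enorm z))%:E * sing w z.1 else 0.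
have men : measurable_fun setT (@enorm R) by rewrite /enorm; mfun.
have mH : measurable_fun setT H.
  by rewrite /H; mfun; exact: measurable_kernel.
have H0 z : 0 <= H z.
  rewrite /H; case: ifP => // _; rewrite mule_ge0 ?sing_ge0// lee_fin f_ge0//.
  exact: enorm_ge0.
rewrite -/(\int[plane_measure R]_z H z) (plane_integral mH H0).
(* The substitution degenerates on the line [z1 = 0]. *)
rewrite (@leb_setD1 _ _ 0%R); last 2 first.
- exact: measurable_integral2.
- by move=> x; exact: integral_ge0.
pose G (z : plane R) := if z.1 == 0%R then 0 else `|z.1|%:E * H (z.1, z.1 * z.2)%R.
have mG : measurable_fun setT G.
  have mH' : measurable_fun setT (fun z : plane R => H (z.1, z.1 * z.2)%R).
    by apply: (measurableT_comp mH); mfun.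
  by rewrite /G; mfun.
have G0 z : 0 <= G z.
  by rewrite /G; case: ifP => // _; rewrite mule_ge0// lee_fin.
have -> : \int[L]_x (if x == 0%R then 0 else \int[L]_y H (x, y)) =
    \int[L]_x \int[L]_u G (x, u).
  apply: eq_integral => x _; rewrite /G /=; case: eqVneq => [_|x0].
    by rewrite integral0_eq.
  have mHx : measurable_fun setT (fun y : R => H (x, y)) by apply: (measurableT_comp mH); mfun.
  have mHxu : measurable_fun setT (fun u : R => H (x, x * u)%R) by apply: (measurableT_comp mH); mfun.
  rewrite (leb_mull (normr_ge0 x) (fun=> H0 _) mHxu).
  rewrite (@ge0_integral_affine _ x 0%R (fun y => H (x, y)) x0 mHx (fun=> H0 _)).
  by congr (_ * _); apply: eq_integral => u _; rewrite addr0.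
(* The inner variable is now the radial one. *)
rewrite plane_swap//.
pose s (u : R) := Num.sqrt (1 + u ^+ 2).
have s1 u : (1 <= s u)%R.
  by rewrite -[leLHS]sqrtr1 ler_sqrt ?lerDl ?sqr_ge0// addr_ge0// sqr_ge0.
have s0 u : (0 < s u)%R by exact: lt_le_trans (s1 u).
have su u : (`|u| <= s u)%R.
  by rewrite -sqrtr_sqr ler_sqrt ?lerDr// addr_ge0// sqr_ge0.
have GE x u : G (x, u) = (s u `^ (w - 1))%:E * radial w l (s u * x + 0)%R.
  rewrite /G/= addr0 /radial; case: eqVneq => [->|x0].
    by rewrite mulr0 eqxx/= mule0.
  have -> : (s u * x == 0)%R = false by rewrite mulf_eq0 (negbTE x0) gt_eqF.
  have -> : `|(s u * x)%R|%R = enorm (x, x * u)%R.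
    rewrite /enorm/= exprMn -[X in (X + _)%R]mulr1 -mulrDr sqrtrM ?sqr_ge0//.
    by rewrite sqrtr_sqr normrM mulrC (ger0_norm (ltW (s0 u))).
  rewrite /H/=; case: ifPn => _/=; last by rewrite !mule0.
  rewrite /sing (negbTE x0) -!EFinM; congr EFin.
  have -> : enorm (x, x * u)%R = (s u * `|x|)%R.
    rewrite /enorm/= exprMn -[X in (X + _)%R]mulr1 -mulrDr sqrtrM ?sqr_ge0//.
    by rewrite sqrtr_sqr mulrC.
  rewrite powRM// ?(ltW (s0 u))// mulrCA -[RHS]mulrCA; congr (_ * _)%R.
  rewrite mulrA -powRD; last by rewrite (gt_eqF (s0 u)) implybT.
  have -> : (w - 1 + (1 - w) = 0 :> R)%R by ring.
  rewrite powRr0 mul1r powRD; last by rewrite normr_eq0 x0 implybT.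
  by rewrite powRr1.
pose J := \int[L]_r radial w l r.
have J0 : 0 <= J by apply: integral_ge0 => x _; exact: radial_ge0.
have IG u : \int[L]_x G (x, u) = J * (s u `^ (w - 2))%:E.
  under eq_integral do rewrite GE.
  have mr : measurable_fun setT (fun x : R => radial w l (s u * x + 0)%R).
    by apply: (measurableT_comp (measurable_radial w l)); mfun.
  rewrite (leb_mull (powR_ge0 _ _) (fun=> radial_ge0 _ _ _) mr).
  rewrite /J (@ge0_integral_affine _ (s u) 0%R (radial w l) (lt0r_neq0 (s0 u)) (measurable_radial w l) (radial_ge0 w l)).
  rewrite (ger0_norm (ltW (s0 u))) muleAC -EFinM; congr (_%:E * _).
  have -> : (w - 1 = 1 + (w - 2) :> R)%R by ring.
  rewrite [LHS]powRD; last by rewrite (gt_eqF (s0 u)) implybT.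
  by rewrite powRr1// (ltW (s0 u)).
under eq_integral do rewrite IG.
have ms : measurable_fun setT (fun u => (s u `^ (w - 2))%:E) by rewrite /s; mfun.
rewrite ge0_integralZl//; last by move=> x _; rewrite lee_fin powR_ge0.
rewrite lte_mul_pinfty// ?ge0_fin_numE//.
have [B B0 hB] : exists2 B : R, (0 <= B)%R &
  \int[L]_x (if (1 < x)%R then x `^ (- (2 - w)) else 0%R)%:E <= B%:E.
  by apply: power_infty_bound; lra.
pose q (x : R) := (if (1 < x)%R then x `^ (- (2 - w)) else 0%R : R)%:E.
have mq : measurable_fun setT q by rewrite /q; mfun.
have q0 y : 0 <= q y by rewrite /q lee_fin; case: ifP => // _; exact: powR_ge0.
pose i (x : R) := (if (`|x| <= 1)%R then 1%R else 0%R : R)%:E.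
have mi : measurable_fun setT i by rewrite /i; mfun.
have i0 y : 0 <= i y by rewrite /i lee_fin; case: ifP.
have mq2 : measurable_fun setT (fun x : R => q (0 - x)%R) by apply: (measurableT_comp mq); mfun.
apply: (@le_lt_trans _ _ (\int[L]_x (q x + q (0 - x)%R + i x))).
  apply: leb_le => //; first by move=> x; rewrite lee_fin powR_ge0.
    by mfun.
  move=> x; have -> : (w - 2 = - (2 - w) :> R)%R by ring.
  have [x1|x1] := leP `|x|%R 1%R.
    apply: lee_paddl; first by rewrite adde_ge0.
    rewrite /i x1 lee_fin powRN invf_le1 ?powR_gt0//.
    have {1}-> : 1%R = (1 `^ (2 - w))%R :> R by rewrite powR1.
    by rewrite ge0_ler_powR ?nnegrE ?(ltW (s0 _))//; lra.
  apply: lee_paddr => //.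
  have hs : (s x `^ (- (2 - w)) <= `|x| `^ (- (2 - w)))%R.
    rewrite !powRN lef_pV2 ?posrE ?powR_gt0 ?(lt_trans _ x1)//.
    by rewrite ge0_ler_powR ?nnegrE ?(ltW (s0 _))//; lra.
  have [x0|x0] := leP 0%R x.
    apply: lee_paddr => //; rewrite ger0_norm// in x1 hs.
    by rewrite /q x1 lee_fin.
  apply: lee_paddl => //; rewrite ltr0_norm// in x1 hs.
  by rewrite /q sub0r x1 lee_fin.
rewrite leb_add//; last 2 first.
- by move=> x; exact: adde_ge0.
- by mfun.
rewrite leb_add// (@ge0_integral_reflect _ 0%R q)//.
have I1 : \int[L]_x i x <= (2 * 1)%:E by rewrite integral_box.
have qB : \int[L]_x q x < +oo by apply: le_lt_trans hB _; rewrite ltry.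
have iB : \int[L]_x i x < +oo by apply: le_lt_trans I1 _; rewrite ltry.
by apply: lte_add_pinfty => //; apply: lte_add_pinfty.
Qed.

End polar.

(** * Integration on the plane *)

Lemma plane_sigma_finite (R : realType) : sigma_finite setT (plane_measure R).
Proof.
exists (fun n : nat => (`[- n%:R, n%:R] : set R) `*` (`[- n%:R, n%:R] : set R)).
  apply/seteqP; split => // -[x y] _.
  exists (maxn (Num.bound `|x|) (Num.bound `|y|)) => //=.
  rewrite !in_itv/= -!ler_norml; split.
    apply: (@le_trans _ _ (Num.bound `|x|)%:R); last by rewrite ler_nat leq_maxl.
    by rewrite ltW// archi_boundP.
  apply: (@le_trans _ _ (Num.bound `|y|)%:R); last by rewrite ler_nat leq_maxr.
  by rewrite ltW// archi_boundP.
move=> k; split; first exact: measurableX.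
rewrite product_measure1E//= !lebesgue_measure_itv/=.
by case: ifP => _; rewrite ?mule0 -?EFinD -?EFinM ltry.
Qed.

Definition plane_sf (R : realType) :
    {sigma_finite_measure set (measurableTypeR R * measurableTypeR R)%type -> \bar R} :=
  HB.pack (plane_measure R) (Measure.on (plane_measure R))
    (Measure_isSigmaFinite.Build _ _ _ (plane_measure R) (plane_sigma_finite R)).

Section tonelli.
Context (R : realType).
Local Notation L := (@lebesgue_measure R).
Local Notation PL := (plane_measure R).
Local Open Scope ereal_scope.

Lemma measurable_plane_integral d (T : measurableType d) (h : T * plane R -> \bar R) :
  measurable_fun setT h -> (forall x, 0 <= h x) ->
  measurable_fun setT (fun x => \int[PL]_y h (x, y)).
Proof.
by move=> mh h0; exact: (@measurable_fun_fubini_tonelli_F _ _ T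
  (measurableTypeR R * measurableTypeR R)%type R (plane_sf R) h mh h0).
Qed.

Lemma tonelli_line_plane (h : R * plane R -> \bar R) :
  measurable_fun setT h -> (forall x, 0 <= h x) ->
  \int[L]_x \int[PL]_y h (x, y) = \int[PL]_y \int[L]_x h (x, y).
Proof.
by move=> mh h0; exact: (@fubini_tonelli _ _ (measurableTypeR R)
  (measurableTypeR R * measurableTypeR R)%type R L (plane_sf R) h mh h0).
Qed.

Lemma tonelli_planes (h : plane R * plane R -> \bar R) :
  measurable_fun setT h -> (forall x, 0 <= h x) ->
  \int[PL]_x \int[PL]_y h (x, y) = \int[PL]_y \int[PL]_x h (x, y).
Proof.
by move=> mh h0; exact: (@fubini_tonelli _ _ (measurableTypeR R * measurableTypeR R)%type
  (measurableTypeR R * measurableTypeR R)%type R (plane_sf R) (plane_sf R) h mh h0).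
Qed.

Lemma planes_integral (h : plane R * plane R -> \bar R) :
  measurable_fun setT h -> (forall x, 0 <= h x) ->
  \int[PL \x PL]_x h x = \int[PL]_x \int[PL]_y h (x, y).
Proof.
by move=> mh h0; exact: (@fubini_tonelli1 _ _ (measurableTypeR R * measurableTypeR R)%type
  (measurableTypeR R * measurableTypeR R)%type R (plane_sf R) (plane_sf R) h mh h0).
Qed.

Lemma plane_le (f g : plane R -> \bar R) : (forall x, 0 <= f x) ->
  measurable_fun setT f -> measurable_fun setT g -> (forall x, f x <= g x) ->
  \int[PL]_x f x <= \int[PL]_x g x.
Proof.
by move=> f0 mf mg fg; apply: (@ge0_leT_integral _
  (measurableTypeR R * measurableTypeR R)%type R PL).
Qed.

Lemma plane_add (f g : plane R -> \bar R) : (forall x, 0 <= f x) -> (forall x, 0 <= g x) ->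
  measurable_fun setT f -> measurable_fun setT g ->
  \int[PL]_x (f x + g x) = \int[PL]_x f x + \int[PL]_x g x.
Proof.
by move=> f0 g0 mf mg; apply: (@ge0_integralD _
  (measurableTypeR R * measurableTypeR R)%type R PL).
Qed.

Lemma plane_mull (k : \bar R) (f : plane R -> \bar R) : 0 <= k -> (forall x, 0 <= f x) ->
  measurable_fun setT f -> \int[PL]_x (k * f x) = k * \int[PL]_x f x.
Proof.
by move=> k0 f0 mf; apply: (@ge0_integralZl _
  (measurableTypeR R * measurableTypeR R)%type R PL).
Qed.

Lemma leb_emull (k : \bar R) (f : R -> \bar R) : 0 <= k -> (forall x, 0 <= f x) ->
  measurable_fun setT f -> \int[L]_x (k * f x) = k * \int[L]_x f x.
Proof. by move=> k0 f0 mf; apply: ge0_integralZl. Qed.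

End tonelli.

(** * The covariance form of the plane *)

Section plane_form.
Context (R : realType) (f : R -> R).
Hypothesis f_ge0 : forall r : R, 0 <= r -> 0 <= f r.
Hypothesis f_cont : forall r : R, 0 < r -> {for r, continuous f}.
Local Notation L := (@lebesgue_measure R).
Local Notation PL := (plane_measure R).
Local Open Scope ereal_scope.

Definition pform (u v : plane R -> R) : \bar R :=
  \int[PL]_x \int[PL]_y (u x * f (enorm (x - y)%R) * v y)%:E.

Lemma covE (phi psi : spacetime R -> R) : cov f phi psi =
  \int[L]_(t in `[0%R, +oo[) pform (fun x => phi (t, x)) (fun x => psi (t, x)).
Proof. by []. Qed.

Lemma f_enorm_ge0 x : (0 <= f (enorm x))%R.
Proof. by apply: f_ge0; exact: enorm_ge0. Qed.

Lemma enormN (x : plane R) : enorm (- x)%R = enorm x.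
Proof. by rewrite /enorm/= !sqrrN. Qed.

Lemma measurable_pform_integrand (u v : plane R -> R) :
  measurable_fun setT u -> measurable_fun setT v ->
  measurable_fun setT (fun z : plane R * plane R =>
    (u z.1 * f (enorm (z.1 - z.2)%R) * v z.2)%:E).
Proof.
move=> mu mv; apply: mf_EFin; apply: mf_mul; last by apply: (measurableT_comp mv); mfun.
apply: mf_mul; first by apply: (measurableT_comp mu); mfun.
by apply: (mf_kernel f_cont); mfun.
Qed.

Lemma pform_reflect (c : plane R) (u v : plane R -> R) :
  measurable_fun setT u -> measurable_fun setT v ->
  (forall x, 0 <= u x)%R -> (forall x, 0 <= v x)%R ->
  pform (fun x => u (c - x)%R) (fun x => v (c - x)%R) = pform u v.
Proof.
move=> mu mv u0 v0; rewrite /pform.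
have mI := measurable_pform_integrand mu mv.
have I0 (z : plane R * plane R) : 0 <= (u z.1 * f (enorm (z.1 - z.2)%R) * v z.2)%:E.
  by rewrite lee_fin !mulr_ge0// f_enorm_ge0.
rewrite -[RHS](@plane_reflect _ c); last 2 first.
- exact: (measurable_plane_integral mI).
- by move=> x; apply: integral_ge0 => y _; exact: (I0 (x, y)).
apply: eq_integral => x _.
rewrite -[RHS](@plane_reflect _ c); last 2 first.
- apply: mf_EFin; apply: mf_mul => //; apply: mf_mul; first by mfun.
  by apply: (mf_kernel f_cont); mfun.
- by move=> y; exact: (I0 (_, y)).
apply: eq_integral => y _.
have -> // : enorm (c - x - (c - y))%R = enorm (x - y)%R.
by rewrite /enorm/=; congr Num.sqrt; ring.
Qed.

(** With [y = z + x], the form integrates the kernel against the correlation of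
    [u] and [v]. *)
Lemma pform_shift (u v : plane R -> R) :
  measurable_fun setT u -> measurable_fun setT v ->
  (forall x, 0 <= u x)%R -> (forall x, 0 <= v x)%R ->
  pform u v = \int[PL]_z ((f (enorm z))%:E * \int[PL]_x (u x * v (z + x)%R)%:E).
Proof.
move=> mu mv u0 v0; rewrite /pform.
pose h (p : plane R * plane R) := (u p.1 * f (enorm p.2) * v (p.2 + p.1)%R)%:E.
have mh : measurable_fun setT h.
  apply: mf_EFin; apply: mf_mul; last by apply: (measurableT_comp mv); mfun.
  by apply: mf_mul; [apply: (measurableT_comp mu)|apply: (mf_kernel f_cont)]; mfun.
have h0 p : 0 <= h p by rewrite lee_fin !mulr_ge0// f_enorm_ge0.
transitivity (\int[PL]_x \int[PL]_z h (x, z)).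
  apply: eq_integral => x _.
  rewrite -[LHS](@plane_shift _ x); last 2 first.
  - apply: mf_EFin; apply: mf_mul => //; apply: mf_mul; first by mfun.
    by apply: (mf_kernel f_cont); mfun.
  - by move=> y; rewrite lee_fin !mulr_ge0// f_enorm_ge0.
  apply: eq_integral => z _; rewrite /h/=.
  have -> // : enorm (x - (z + x))%R = enorm z.
  by rewrite /enorm/=; congr Num.sqrt; ring.
rewrite tonelli_planes//; apply: eq_integral => z _.
rewrite -plane_mull ?lee_fin ?f_enorm_ge0//.
- by apply: eq_integral => x _; rewrite /h/= -EFinM; congr EFin; ring.
- by move=> x; rewrite lee_fin mulr_ge0.
- apply: mf_EFin; apply: mf_mul => //; apply: (measurableT_comp mv); mfun.
Qed.

End plane_form.

Lemma measurable_line_swap (R : realType) d (T : measurableType d) (h : R * T -> \bar R) :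
  measurable_fun setT h -> (forall x, 0 <= h x)%E ->
  measurable_fun setT (fun y => \int[@lebesgue_measure R]_x h (x, y))%E.
Proof.
move=> mh h0; apply: (@measurable_integral2 _ _ _ (fun c : T * R => h (c.2, c.1))) => //.
by apply: (measurableT_comp mh); mfun.
Qed.

(** * Powers of the quadratic form of the cone *)

Section profile.
Context (R : realType).
Local Notation L := (@lebesgue_measure R).
Local Notation PL := (plane_measure R).
Local Open Scope ereal_scope.

Lemma powRN_le (a b r : R) : (0 < a)%R -> (a <= b)%R -> (0 <= r)%R ->
  (b `^ (- r) <= a `^ (- r))%R.
Proof.
move=> a0 ab r0; have b0 : (0 < b)%R by exact: lt_le_trans ab.
rewrite !powRN lef_pV2 ?posrE ?powR_gt0//.
by rewrite ge0_ler_powR ?nnegrE// ltW.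
Qed.

Lemma sing_gt0 (w x : R) : 0 < sing w x.
Proof.
rewrite /sing; case: eqVneq => // x0.
by rewrite lte_fin powR_gt0// normr_gt0.
Qed.

(** For [b = 1/2] this is, up to a constant, the fundamental solution of the
    planar wave equation. *)
Definition wprof (b t : R) (x : plane R) : R :=
  if (0 < t)%R && (0 < t ^+ 2 - x.1 ^+ 2 - x.2 ^+ 2)%R
  then ((t ^+ 2 - x.1 ^+ 2 - x.2 ^+ 2) `^ (- b))%R else 0%R.

Lemma wprof_ge0 b t x : (0 <= wprof b t x)%R.
Proof. by rewrite /wprof; case: ifP => // _; exact: powR_ge0. Qed.

Lemma mf_wprof d (T : measurableType d) b (h : T -> R) (k : T -> plane R) :
  measurable_fun setT h -> measurable_fun setT k ->
  measurable_fun setT (fun x => wprof b (h x) (k x)).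
Proof. by move=> mh mk; rewrite /wprof; mfun. Qed.

Lemma enorm_le_sum (z : plane R) : (enorm z <= `|z.1| + `|z.2|)%R.
Proof.
have h : (0 <= `|z.1| + `|z.2|)%R by rewrite addr_ge0.
rewrite /enorm -[leRHS]ger0_norm// -sqrtr_sqr ler_sqrt ?sqr_ge0//.
rewrite sqrrD !real_normK ?num_real// lerD2r lerDl.
by rewrite mulrn_wge0// mulr_ge0.
Qed.

Lemma sqr_lt_norm (x t : R) : (0 < t)%R -> (x ^+ 2 < t ^+ 2)%R -> (`|x| < t)%R.
Proof.
move=> t0 h; rewrite -(ltr_pXn2r (n := 2))// ?nnegrE ?(ltW t0)//.
by rewrite real_normK ?num_real.
Qed.

(** Factoring out the slope [2 * k] costs the singular factor [sing w k]; for
    [k = 0] that factor is [+oo], which makes the bound trivial. *)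
Lemma sing_affine_bound (w : R) : (0 <= w < 1)%R -> exists2 B : R, (0 <= B)%R &
  forall r k c : R, (0 < r)%R ->
  \int[L]_x (if (`|x| <= r)%R then sing w (2 * k * x + c) else 0)
    <= sing w k * (B + 2 * r)%:E.
Proof.
move=> w01; have [B B0 hB] := sing_bound w01; exists B => // r k c r0.
have [->|k0] := eqVneq k 0%R.
  rewrite {2}/sing eqxx gt0_mulye ?leey// lte_fin; lra.
have mk : measurable_fun setT (fun x : R => if (`|x| <= r)%R then sing w (x + c / (2 * k)) else 0).
  by apply: mf_if; mfun; apply: mf_sing; mfun.
have h0 (x : R) : 0 <= if (`|x| <= r)%R then sing w (x + c / (2 * k)) else 0.
  by case: ifP => // _; exact: sing_ge0.
apply: (@le_trans _ _ (\int[L]_x (sing w k *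
    (if (`|x| <= r)%R then sing w (x + c / (2 * k)) else 0)))).
  apply: leb_le.
  - by move=> x; case: ifP => // _; exact: sing_ge0.
  - by apply: mf_if; mfun; apply: mf_sing; mfun.
  - by mfun.
  - move=> x; case: ifP => _; last by rewrite mule0.
    have e : (2 * k * x + c = (2 * k) * (x + c / (2 * k)))%R by field.
    rewrite e {1 3}/sing mulf_eq0 (_ : (2 * k == 0 = false)%R)/=; last first.
      by rewrite mulf_eq0 (negbTE k0) orbF pnatr_eq0.
    case: eqVneq => _; first by rewrite gt0_muley ?sing_gt0.
    rewrite /sing (negbTE k0) -EFinM lee_fin normrM powRM//.
    rewrite ler_wpM2r ?powR_ge0// powRN_le ?normr_gt0//; last by case/andP: w01.
    by rewrite normrM ger0_norm// ler_peMl//; lra.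
rewrite leb_emull ?sing_ge0// lee_wpmul2l ?sing_ge0//.
by apply: hB; exact: ltW.
Qed.

Context (alpha : R).
Hypothesis a01 : (0 < alpha < 1)%R.
Let b := (2^-1 + alpha / 4)%R.
Let w := (3 * alpha / 4)%R.
Let q := (1 - alpha / 4)%R.

(** The exponents satisfy [2 * b = q + w] and [b - w >= 0], so the excess power
    [b - w] of [v + D] can be moved to [v <= v + D], and the rest to [D <= v + D].
    The choice of [w] and [q] leaves both powers integrable and [w < alpha]. *)
Lemma wprof_power (v D : R) : (0 < v)%R -> (0 < D)%R ->
  (v `^ (- b) * (v + D) `^ (- b) <= v `^ (- q) * D `^ (- w))%R.
Proof.
move=> v0 D0; have /andP[a0 a1] := a01.
have vD : (0 < v + D)%R by rewrite addr_gt0.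
have e1 : ((v + D) `^ (- b) = (v + D) `^ (- w) * (v + D) `^ (- (b - w)))%R.
  rewrite -powRD; last by rewrite (gt_eqF vD) implybT.
  by congr (_ `^ _)%R; ring.
have e2 : (v `^ (- q) = v `^ (- b) * v `^ (- (b - w)))%R.
  rewrite -powRD; last by rewrite (gt_eqF v0) implybT.
  by congr (_ `^ _)%R; rewrite /q /b /w; lra.
rewrite e1 e2 -mulrA ler_wpM2l ?powR_ge0// mulrC ler_pM ?powR_ge0//.
  by apply: powRN_le => //; rewrite /b /w; lra.
by apply: powRN_le => //; rewrite /b /w; lra.
Qed.

(** Let [v] be the smaller and [v + D] the larger of the two quadratic forms; [D] is
    the absolute value of an affine function of [x.1] with slope [2 * z.1].
    With [mu] the larger of the two norms, [v = (t - mu) * (t + mu)] is at least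
    [(t - mu) * `|x.2|].  After [wprof_power] the product is therefore bounded by
    singular powers of [t - mu], of [x.2] and of an affine function of [x.1], which
    can be integrated one variable at a time. *)
Lemma wprof_mul_le (T t : R) (x z : plane R) : (0 < t < T)%R ->
  (wprof b t x * wprof b t (z + x)%R)%:E <=
  if [&& (`|x.1| <= T)%R, (`|x.2| <= T)%R, (enorm z <= 4 * T)%R & (`|t| <= T)%R]
  then sing q x.2 * sing w (2 * z.1 * x.1 + (2 * z.2 * x.2 + z.1 ^+ 2 + z.2 ^+ 2)) *
    sing q (t - Num.sqrt (Num.max (x.1 ^+ 2 + x.2 ^+ 2)
      ((z + x)%R.1 ^+ 2 + (z + x)%R.2 ^+ 2)))%R
  else 0.
Proof.
move=> /andP[t0 tT]; have /andP[al0 al1] := a01.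
set RHS := (X in _ <= X).
have R0 : 0 <= RHS by rewrite /RHS; case: ifP => // _; rewrite !mule_ge0// sing_ge0.
have [p1|] := boolP (0 < t ^+ 2 - x.1 ^+ 2 - x.2 ^+ 2)%R; last first.
  by move=> /negbTE h; rewrite {1}/wprof h andbF mul0r.
have [p2|] := boolP (0 < t ^+ 2 - (z + x)%R.1 ^+ 2 - (z + x)%R.2 ^+ 2)%R; last first.
  by move=> /negbTE h; rewrite {2}/wprof h andbF mulr0.
have x1 : (`|x.1| < t)%R by apply: sqr_lt_norm => //; have := sqr_ge0 x.2; lra.
have x2 : (`|x.2| < t)%R by apply: sqr_lt_norm => //; have := sqr_ge0 x.1; lra.
have y1 : (`|(z + x)%R.1| < t)%R.
  by apply: sqr_lt_norm => //; have := sqr_ge0 (z + x)%R.2; lra.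
have y2 : (`|(z + x)%R.2| < t)%R.
  by apply: sqr_lt_norm => //; have := sqr_ge0 (z + x)%R.1; lra.
have zT : (enorm z <= 4 * T)%R.
  apply: (le_trans (enorm_le_sum z)).
  have -> : z.1 = ((z + x)%R.1 - x.1)%R by rewrite /=; ring.
  have -> : z.2 = ((z + x)%R.2 - x.2)%R by rewrite /=; ring.
  have := ler_normB (z + x)%R.1 x.1; have := ler_normB (z + x)%R.2 x.2.
  lra.
rewrite /RHS ifT; last first.
  by rewrite zT (ger0_norm (ltW t0)) (ltW tT) (ltW (lt_trans x1 tT)) (ltW (lt_trans x2 tT)).
set e := (2 * z.1 * x.1 + (2 * z.2 * x.2 + z.1 ^+ 2 + z.2 ^+ 2))%R.
set A0 := (x.1 ^+ 2 + x.2 ^+ 2)%R; set A1 := ((z + x)%R.1 ^+ 2 + (z + x)%R.2 ^+ 2)%R.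
have eE : (e = A1 - A0)%R by rewrite /e /A1 /A0 /=; ring.
set mu := Num.sqrt _.
have M0 : (0 <= Num.max A0 A1)%R by rewrite le_max addr_ge0 ?sqr_ge0.
have mu0 : (0 <= mu)%R by exact: sqrtr_ge0.
have muE : (mu ^+ 2 = Num.max A0 A1)%R by rewrite sqr_sqrtr.
have mut : (mu < t)%R.
  rewrite -(ltr_pXn2r (n := 2))// ?nnegrE ?(ltW t0)// muE gt_max.
  by apply/andP; split; rewrite /A0 /A1; lra.
(* Where the argument of a singular factor vanishes, the right-hand side is infinite. *)
have [e0|e0] := eqVneq e 0%R.
  by rewrite {2}/sing e0 eqxx gt0_muley ?sing_gt0// gt0_mulye ?sing_gt0// leey.
have [x20|x20] := eqVneq x.2 0%R.
  by rewrite {1}/sing x20 eqxx gt0_mulye ?sing_gt0// gt0_mulye ?sing_gt0// leey.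
rewrite /sing (negbTE e0) (negbTE x20) subr_eq0 (gt_eqF mut) -!EFinM lee_fin.
have mux2 : (`|x.2| <= mu)%R.
  rewrite -(ler_pXn2r (n := 2))// ?nnegrE// muE real_normK ?num_real//.
  by rewrite le_max /A0 lerDr sqr_ge0.
pose v := (t ^+ 2 - Num.max A0 A1)%R.
have v0 : (0 < v)%R by rewrite /v subr_gt0 -muE ltr_pXn2r// ?nnegrE// ltW.
have prodE : (wprof b t x * wprof b t (z + x)%R = v `^ (- b) * (v + `|e|) `^ (- b))%R.
  rewrite /wprof t0 p1 p2 /= eE /v.
  have [h|h] := leP A0 A1.
    rewrite ger0_norm ?subr_ge0// mulrC; congr (_ `^ _ * _ `^ _)%R; rewrite /A1 /A0 /=; ring.
  rewrite ltr0_norm ?subr_lt0//; congr (_ `^ _ * _ `^ _)%R; rewrite /A1 /A0 /=; ring.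
rewrite prodE (le_trans (wprof_power v0 _))// ?normr_gt0//.
rewrite -mulrA mulrCA [leLHS]mulrC ler_wpM2l ?powR_ge0//.
rewrite -powRM//; apply: powRN_le; [|  |by rewrite /q; lra].
  by rewrite mulr_gt0 ?normr_gt0// subr_eq0 gt_eqF.
have tm : (0 <= t - mu)%R by rewrite subr_ge0 ltW.
rewrite (ger0_norm tm).
have -> : (v = (t - mu) * (t + mu))%R by rewrite /v -muE; ring.
by rewrite mulrC ler_wpM2l//; lra.
Qed.

Context (f : R -> R).
Hypothesis f_ge0 : forall r : R, (0 <= r)%R -> (0 <= f r)%R.
Hypothesis f_cont : forall r : R, (0 < r)%R -> {for r, continuous f}.

(** The bound of [wprof_mul_le] is integrated in [t], then in [x.1], then in [x.2];
    each step costs a constant, and the second leaves the factor [sing w z.1].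
    What remains is the integral of [polar_bound]. *)
Lemma wprof_time_bound (T : R) : (0 < T)%R ->
  \int[L]_r radial f w (4 * T) r < +oo ->
  \int[L]_t (if (0 < t < T)%R then pform f (wprof b t) (wprof b t) else 0) < +oo.
Proof.
move=> T0 hrad; have /andP[al0 al1] := a01.
have [w0 w1] : (0 < w)%R /\ (w < 1)%R by rewrite /w; split; lra.
have [q0 q1] : (0 < q)%R /\ (q < 1)%R by rewrite /q; split; lra.
have w01 : (0 <= w < 1)%R by rewrite ltW.
have q01 : (0 <= q < 1)%R by rewrite ltW.
have [Bq Bq0 hBq] := sing_bound q01.
have [Bw Bw0 hBw] := sing_affine_bound w01.
pose p (a : R * plane R * plane R) : \bar R :=
  if (0 < a.1.1 < T)%R then (wprof b a.1.1 a.2 * wprof b a.1.1 (a.1.2 + a.2)%R)%:E else 0.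
have mp : measurable_fun setT p.
  by rewrite /p; mfun; apply: mf_wprof; mfun.
have p0 a : 0 <= p a by rewrite /p; case: ifP => // _; rewrite lee_fin mulr_ge0// wprof_ge0.
pose g (c : R * plane R) : \bar R := (f (enorm c.2))%:E * \int[PL]_x p (c, x).
have mP : measurable_fun setT (fun c : R * plane R => \int[PL]_x p (c, x)).
  exact: measurable_plane_integral.
have P0 c : 0 <= \int[PL]_x p (c, x) by exact: integral_ge0.
have mg : measurable_fun setT g.
  by rewrite /g; apply: mf_emul => //; apply: mf_EFin; apply: (mf_kernel f_cont); mfun.
have fe0 (z : plane R) : 0 <= (f (enorm z))%:E by rewrite lee_fin f_ge0// enorm_ge0.
have g0 c : 0 <= g c by rewrite /g mule_ge0.
have -> : \int[L]_t (if (0 < t < T)%R then pform f (wprof b t) (wprof b t) else 0) =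
    \int[L]_t \int[PL]_z g (t, z).
  apply: eq_integral => t _; rewrite /g/=; case: ifPn => tT; last first.
    rewrite integral0_eq// => z _; rewrite integral0_eq ?mule0// => x _.
    by rewrite /p/= (negbTE tT).
  rewrite (pform_shift f_ge0 f_cont); [|by apply: mf_wprof; mfun|by apply: mf_wprof; mfun
    |by move=> x; exact: wprof_ge0|by move=> x; exact: wprof_ge0].
  apply: eq_integral => z _; congr (_ * _); apply: eq_integral => x _.
  by rewrite /p/= tT.
rewrite tonelli_line_plane//.
pose K : R := ((Bq + 2 * T) * (Bq + 2 * T) * (Bw + 2 * T))%R.
have K0 : (0 <= K)%R by rewrite !mulr_ge0//; lra.
pose s (z : plane R) := if (enorm z <= 4 * T)%R then (f (enorm z))%:E * sing w z.1 else 0.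
have ms : measurable_fun setT s.
  by rewrite /s; mfun; exact: measurable_kernel.
have s0 z : 0 <= s z by rewrite /s; case: ifP => // _; rewrite mule_ge0// sing_ge0.
apply: (@le_lt_trans _ _ (\int[PL]_z (K%:E * s z))); last first.
  rewrite plane_mull// lte_mul_pinfty//.
  by apply: polar_bound => //; [rewrite w0|lra].
have sw (z : plane R) : measurable_fun setT (fun x : plane R =>
    sing w (2 * z.1 * x.1 + (2 * z.2 * x.2 + z.1 ^+ 2 + z.2 ^+ 2))%R).
  by apply: mf_sing; mfun.
have key (z : plane R) : \int[L]_t \int[PL]_x p (t, z, x) <=
    if (enorm z <= 4 * T)%R then K%:E * sing w z.1 else 0.
  have mpz : measurable_fun setT (fun c : R * plane R => p (c.1, z, c.2)).
    by apply: (measurableT_comp mp); mfun.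
  rewrite (@tonelli_line_plane _ (fun c => p (c.1, z, c.2)))//=.
  pose k (x : plane R) : \bar R :=
    if (`|x.1| <= T)%R && (`|x.2| <= T)%R then sing q x.2 *
      sing w (2 * z.1 * x.1 + (2 * z.2 * x.2 + z.1 ^+ 2 + z.2 ^+ 2))%R else 0.
  have mk : measurable_fun setT k.
    by rewrite /k; apply: mf_if; [mfun|apply: mf_emul => //; apply: mf_sing; mfun|mfun].
  have k0 x : 0 <= k x by rewrite /k; case: ifP => // _; rewrite mule_ge0// sing_ge0.
  have inner (x : plane R) : \int[L]_t p (t, z, x) <=
     if (enorm z <= 4 * T)%R then (Bq + 2 * T)%:E * k x else 0.
    pose mu := Num.sqrt (Num.max (x.1 ^+ 2 + x.2 ^+ 2)
        ((z + x)%R.1 ^+ 2 + (z + x)%R.2 ^+ 2))%R.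
    have mst : measurable_fun setT (fun t : R => if (`|t| <= T)%R then sing q (t + - mu) else 0).
      by apply: mf_if; [mfun|apply: mf_sing; mfun|mfun].
    have st0 (t : R) : 0 <= if (`|t| <= T)%R then sing q (t + - mu) else 0.
      by case: ifP => // _; exact: sing_ge0.
    have mpt : measurable_fun setT (fun t : R => p (t, z, x)).
      by apply: (measurableT_comp mp); mfun.
    apply: (@le_trans _ _ (\int[L]_t ((if (enorm z <= 4 * T)%R then k x else 0) *
        (if (`|t| <= T)%R then sing q (t + - mu) else 0)))).
      apply: leb_le => //; first by mfun.
      move=> t; rewrite /p/=; case: ifPn => tT; last first.
        by rewrite mule_ge0//; case: ifP.
      apply: (le_trans (wprof_mul_le _ _ tT)); rewrite /k.
      case: (`|x.1| <= T)%R => /=; last by case: ifP => _; rewrite mul0e.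
      case: (`|x.2| <= T)%R => /=; last by case: ifP => _; rewrite mul0e.
      case: (enorm z <= 4 * T)%R => /=; last by rewrite mul0e.
      by case: ifP => _ //; rewrite mule0.
    rewrite leb_emull//; last by case: ifP.
    case: ifP => _; last by rewrite mul0e.
    by rewrite muleC lee_wpmul2r// hBq// ltW.
  apply: (@le_trans _ _ (\int[PL]_x (if (enorm z <= 4 * T)%R then (Bq + 2 * T)%:E * k x else 0))).
    apply: plane_le => //.
    - by move=> x; exact: integral_ge0.
    - apply: (@measurable_integral2 _ _ _ (fun c : plane R * R => p (c.2, z, c.1))) => //.
      by apply: (measurableT_comp mp); mfun.
    - by mfun.
  case: ifP => _; last by rewrite integral0.
  have BT : 0 <= (Bq + 2 * T)%:E by rewrite lee_fin; lra.
  rewrite plane_mull// /K -mulrA EFinM -muleA lee_wpmul2l//.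
  rewrite plane_integral// plane_swap//.
  have msq : measurable_fun setT (fun y : R => if (`|y| <= T)%R then sing q (y + 0) else 0).
    by apply: mf_if; [mfun|apply: mf_sing; mfun|mfun].
  have sq0 (y : R) : 0 <= if (`|y| <= T)%R then sing q (y + 0) else 0.
    by case: ifP => // _; exact: sing_ge0.
  have S0 : 0 <= sing w z.1 * (Bw + 2 * T)%:E.
    by rewrite mule_ge0 ?sing_ge0// lee_fin; lra.
  apply: (@le_trans _ _ (\int[L]_y ((sing w z.1 * (Bw + 2 * T)%:E) *
     (if (`|y| <= T)%R then sing q (y + 0) else 0)))).
    apply: leb_le.
    - by move=> y; exact: integral_ge0.
    - apply: (@measurable_integral2 _ _ _ (fun c : plane R => k (c.2, c.1))) => //.
      by apply: (measurableT_comp mk); mfun.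
    - by mfun.
    - move=> y; rewrite addr0 /k/=; case: (`|y| <= T)%R; last first.
        by rewrite mule0 integral0_eq// => x _; rewrite andbF.
      have mxy : measurable_fun setT (fun x : R => if (`|x| <= T)%R
          then sing w (2 * z.1 * x + (2 * z.2 * y + z.1 ^+ 2 + z.2 ^+ 2))%R else 0).
        by apply: mf_if; [mfun|apply: mf_sing; mfun|mfun].
      have xy0 (x : R) : 0 <= if (`|x| <= T)%R
          then sing w (2 * z.1 * x + (2 * z.2 * y + z.1 ^+ 2 + z.2 ^+ 2))%R else 0.
        by case: ifP => // _; exact: sing_ge0.
      have -> : \int[L]_x (if (`|x| <= T)%R && true then sing q y *
          sing w (2 * z.1 * x + (2 * z.2 * y + z.1 ^+ 2 + z.2 ^+ 2))%R else 0) =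
          \int[L]_x (sing q y * (if (`|x| <= T)%R
          then sing w (2 * z.1 * x + (2 * z.2 * y + z.1 ^+ 2 + z.2 ^+ 2))%R else 0)).
        by apply: eq_integral => x _; rewrite andbT; case: ifP => _ //; rewrite mule0.
      rewrite leb_emull ?sing_ge0// muleC lee_wpmul2r ?sing_ge0//.
      exact: hBw.
  rewrite leb_emull//.
  have -> : ((Bq + 2 * T) * (Bw + 2 * T))%:E * sing w z.1 =
      (sing w z.1 * (Bw + 2 * T)%:E) * (Bq + 2 * T)%:E.
    by rewrite EFinM -muleA muleC; congr (_ * _); rewrite muleC.
  by rewrite lee_wpmul2l// hBq// ltW.
apply: plane_le.
- by move=> z; exact: integral_ge0.
- exact: measurable_line_swap.
- by mfun.
- move=> z; rewrite /g /= leb_emull//; last first.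
    apply: (@measurable_plane_integral _ _ _ (fun c : R * plane R => p (c.1, z, c.2))) => //.
    by apply: (measurableT_comp mp); mfun.
  rewrite /s; apply: (le_trans (lee_wpmul2l (fe0 z) (key z))).
  by case: ifP => _; rewrite ?mule0// muleCA.
Qed.

End profile.

(** * The Green function and its increments *)

Section wave.
Context (R : realType) (m : R).
Hypothesis m01 : 0 <= m < 1.

Lemma half_power (q : R) : 0 < q -> (Num.sqrt q)^-1 = q `^ (- 2^-1).
Proof. by move=> q0; rewrite powRN powR12_sqrt// ltW. Qed.

(** Multiplying the quadratic form of the Green function by [1 - m^2] completes the
    square to [t^2 - (x.1 - m * t)^2 - x.2^2].  The two support conditions agree
    because [m < 1] makes [rho m x] dominate the drift term. *)
Lemma green_wprof (t : R) (x : plane R) : 0 <= t ->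
  green t x m = (2 * pi)^-1 * wprof 2^-1 t (x.1 - m * t, x.2).
Proof.
move=> t0; have /andP[m0 m1] := m01.
have c0 : 0 < 1 - m ^+ 2 by rewrite subr_gt0 expr_lt1.
set c := 1 - m ^+ 2 in c0.
pose q := t ^+ 2 - (x.1 - m * t) ^+ 2 - x.2 ^+ 2.
have r0 : 0 <= x.1 ^+ 2 / c ^+ 2 + x.2 ^+ 2 / c.
  by rewrite addr_ge0// divr_ge0// ?sqr_ge0// ltW.
have qE : (t + m * x.1 / c) ^+ 2 - rho m x ^+ 2 = q / c.
  rewrite /rho -/c sqr_sqrtr// /q.
  have e : m ^+ 2 = 1 - c by rewrite /c; ring.
  have -> : (t + m * x.1 / c) ^+ 2 - (x.1 ^+ 2 / c ^+ 2 + x.2 ^+ 2 / c) =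
    (t ^+ 2 * c ^+ 2 + 2 * t * m * x.1 * c + m ^+ 2 * x.1 ^+ 2 - x.1 ^+ 2
      - x.2 ^+ 2 * c) / c ^+ 2 by field; rewrite gt_eqF.
  have -> : t ^+ 2 - (x.1 - m * t) ^+ 2 - x.2 ^+ 2 =
     t ^+ 2 - x.1 ^+ 2 + 2 * x.1 * m * t - m ^+ 2 * t ^+ 2 - x.2 ^+ 2 by ring.
  by rewrite e; field; rewrite gt_eqF.
rewrite /green -/c /wprof/= -/q.
have rho0 : 0 <= rho m x by exact: sqrtr_ge0.
have rhox : `|x.1| / c <= rho m x.
  rewrite /rho -/c -[leLHS]ger0_norm ?divr_ge0 ?normr_ge0 ?(ltW c0)// -sqrtr_sqr ler_sqrt//.
  by rewrite exprMn exprVn real_normK ?num_real// lerDl divr_ge0 ?sqr_ge0 ?(ltW c0).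
case: ifPn => [h|h].
  have q0 : 0 <= q.
    have : 0 <= q / c.
      rewrite -qE subr_ge0 ler_pXn2r// ?nnegrE//; lra.
    by rewrite pmulr_lge0// invr_gt0.
  (* On the boundary of the cone both sides vanish, by the convention [0^-1 = 0]. *)
  case: (ltgtP 0 q) q0 => // [qp _|q0 _]; last first.
    by rewrite andbF mulr0 qE -q0 mul0r sqrtr0 mulr0 invr0.
  rewrite andbT; have tp : 0 < t.
    rewrite lt_neqAle t0 andbT; apply/eqP => t00.
    by move: qp; rewrite /q -t00; have := sqr_ge0 x.1; have := sqr_ge0 x.2; lra.
  rewrite tp -half_power// qE sqrtrM ?(ltW qp)// sqrtrV ?(ltW c0)//.
  by rewrite -invfM; congr (_^-1); field; rewrite sqrtr_eq0 -ltNge.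
rewrite ifF ?mulr0//; apply/negbTE; apply: contra h => /andP[tp qp].
have : 0 < q / c by rewrite divr_gt0.
rewrite -qE subr_gt0 -[ltRHS](real_normK (num_real _)) ltr_pXn2r// ?nnegrE// => h.
have [s0|s0] := leP 0 (t + m * x.1 / c).
  by rewrite ger0_norm// in h; lra.
exfalso; rewrite ltr0_norm// in h.
have hx : - (m * x.1 / c) <= `|x.1| / c.
  rewrite -mulNr ler_pM2r ?invr_gt0//.
  apply: (@le_trans _ _ (m * `|x.1|)); last by rewrite ler_piMl// ltW.
  by rewrite -mulrN ler_wpM2l// -normrN ler_norm.
lra.
Qed.

(** As a function of the source point [a], with observation point [z]. *)
Definition wave (b : R) (z a : spacetime R) : R :=
  if 0 < a.1 then
    wprof b (z.1 - a.1) (z.2.1 - a.2.1 - m * (z.1 - a.1), z.2.2 - a.2.2)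
  else 0.

Lemma wave_ge0 b z a : 0 <= wave b z a.
Proof. by rewrite /wave; case: ifP => // _; exact: wprof_ge0. Qed.

Lemma measurable_wave b z : measurable_fun setT (wave b z).
Proof. by rewrite /wave; apply: mf_if; [mfun|apply: mf_wprof; mfun|mfun]. Qed.

Lemma green_kernel (t : R) (x : plane R) (a : spacetime R) : 0 < t ->
  \1_(`]0, t] `*` [set: plane R]) a * green (t - a.1) (x - a.2) m =
  (2 * pi)^-1 * wave 2^-1 (t, x) a.
Proof.
move=> t0; rewrite indicE /wave /=.
have -> : (a \in `]0, t] `*` [set: plane R]) = (0 < a.1 <= t).
  apply/idP/idP; first by rewrite inE/= => -[] /=; rewrite in_itv.
  by move=> h; rewrite inE/=; split => //=; rewrite in_itv.
have [a0|a0] := ltP 0 a.1; last by rewrite mul0r mulr0.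
have [at_|at_] := leP a.1 t; last first.
  rewrite mul0r /wprof ifF ?mulr0//.
  by apply/negbTE; rewrite negb_and -leNgt subr_le0 ltW.
by rewrite mul1r green_wprof// subr_ge0.
Qed.

(** [q <= H] lets [q^(-1/2)] trade the power [k] of [q] for one of [H]. *)
Lemma power_diff1 (k q H : R) : 0 < q -> 0 <= k -> q <= H ->
  q `^ (- 2^-1) <= H `^ k * q `^ (- (2^-1 + k)).
Proof.
move=> q0 k0 qH.
have -> : - 2^-1 = k + - (2^-1 + k) by ring.
rewrite powRD; last by rewrite (gt_eqF q0) implybT.
by rewrite ler_wpM2r ?powR_ge0// ge0_ler_powR// ?nnegrE ?(ltW q0)// (le_trans (ltW q0)).
Qed.

(** If [q <= H] this is [power_diff1].  Otherwise the relative change of the inverse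
    square root is at most [H / q <= 1], hence at most its power of exponent [k <= 1]. *)
Lemma power_diff2 (k q q' H : R) : 0 < q -> 0 <= k <= 1 -> q <= q' -> q' - q <= H ->
  `|q `^ (- 2^-1) - q' `^ (- 2^-1)| <= H `^ k * q `^ (- (2^-1 + k)).
Proof.
move=> q0 /andP[k0 k1] qq' qH.
have q'0 : 0 < q' by exact: lt_le_trans qq'.
have mono : q' `^ (- 2^-1) <= q `^ (- 2^-1) by apply: powRN_le.
rewrite ger0_norm ?subr_ge0//.
have [h|h] := leP q H.
  by apply: le_trans (power_diff1 q0 k0 h); rewrite gerBl powR_ge0.
have H0 : 0 <= H by apply: le_trans qH; rewrite subr_ge0.
have rq : 0 <= H / q <= 1 by rewrite divr_ge0 ?(ltW q0)//= ler_pdivrMr// mul1r ltW.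
have e1 : q' `^ (- 2^-1) = q `^ (- 2^-1) * Num.sqrt (q / q').
  rewrite -!half_power// sqrtrM ?(ltW q0)// sqrtrV ?(ltW q'0)//.
  by rewrite mulrA mulVf ?mul1r// sqrtr_eq0 -ltNge.
have e2 : 1 - Num.sqrt (q / q') <= (H / q) `^ k.
  apply: (@le_trans _ _ (1 - q / q')).
    have r0 : 0 <= q / q' by rewrite divr_ge0 ?ltW.
    have r1 : q / q' <= 1 by rewrite ler_pdivrMr// mul1r.
    rewrite lerD2l lerN2 -{1}(sqr_sqrtr r0) expr2 ler_piMl ?sqrtr_ge0//.
    by rewrite -sqrtr1 ler_sqrt.
  apply: (@le_trans _ _ (H / q)).
    have -> : 1 - q / q' = (q' - q) / q' by field; rewrite gt_eqF.
    by rewrite ler_pM ?subr_ge0 ?invr_ge0 ?(ltW q'0)// lef_pV2.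
  case/andP: rq => r0 r1; have [->|rn0] := eqVneq (H / q) 0; first exact: powR_ge0.
  by apply: ger1_powR => //; rewrite r1 lt_neqAle r0 eq_sym rn0.
apply: (@le_trans _ _ (q `^ (- 2^-1) * (H / q) `^ k)).
  by rewrite e1 -[X in X - _]mulr1 -mulrBr ler_wpM2l ?powR_ge0.
rewrite powRM ?invr_ge0 ?(ltW q0)// mulrCA ler_wpM2l ?powR_ge0//.
rewrite -(powR_inv1 (ltW q0)) -powRrM -powRD; last by rewrite (gt_eqF q0) implybT.
by rewrite mulN1r opprD.
Qed.

Lemma enorm_ge1 (x : plane R) : `|x.1| <= enorm x.
Proof.
by rewrite /enorm -sqrtr_sqr ler_sqrt ?addr_ge0 ?sqr_ge0// lerDl sqr_ge0.
Qed.

Lemma enorm_ge2 (x : plane R) : `|x.2| <= enorm x.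
Proof.
by rewrite /enorm -sqrtr_sqr ler_sqrt ?addr_ge0 ?sqr_ge0// lerDr sqr_ge0.
Qed.

Definition dist_st (z z' : spacetime R) : R := `|z.1 - z'.1| + enorm (z.2 - z'.2).

(** If both points see the source [a], their quadratic forms differ by at most
    [14 * T * dist_st z z'], and [power_diff2] applies.  If only one does, its own
    form is at most that quantity, because the form of the other is nonpositive, or
    because the time elapsed since [a] is at most the distance; then [power_diff1]
    applies. *)
Lemma wave_diff (k T : R) (z z' a : spacetime R) : 0 <= k <= 1 -> 0 < T ->
  0 < z.1 <= T -> 0 < z'.1 <= T -> `|z.2.1| <= T -> `|z.2.2| <= T ->
  `|z'.2.1| <= T -> `|z'.2.2| <= T ->
  `|wave 2^-1 z a - wave 2^-1 z' a| <=
  (14 * T * dist_st z z') `^ k * (wave (2^-1 + k) z a + wave (2^-1 + k) z' a).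
Proof.
move=> k01 T0.
wlog: z z' / 0 < a.1.
  move=> W; have [a0|a0] := ltP 0 a.1; first exact: W.
  move=> *; rewrite /wave !ifF ?subrr ?normr0 ?addr0 ?mulr0//;
    by apply/negbTE; rewrite -leNgt.
move=> a0; have /andP[k0 k1] := k01; have /andP[m0 m1] := m01.
pose q (z : spacetime R) := (z.1 - a.1) ^+ 2 -
  (z.2.1 - a.2.1 - m * (z.1 - a.1)) ^+ 2 - (z.2.2 - a.2.2) ^+ 2.
have waveE b (y : spacetime R) : wave b y a =
    if (0 < y.1 - a.1) && (0 < q y) then q y `^ (- b) else 0.
  by rewrite /wave a0 /wprof.
(* The form is a combination of three squares; each sum of terms is bounded by
   a multiple of T (2, 5 and 4) and each difference by the distance, which gives
   2 + 5 + 4 = 11 <= 14. *)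
have C2 (y y' : spacetime R) : 0 < y.1 <= T -> 0 < y'.1 <= T ->
    `|y.2.1| <= T -> `|y.2.2| <= T -> `|y'.2.1| <= T -> `|y'.2.2| <= T ->
    0 < y.1 - a.1 -> 0 < y'.1 - a.1 -> 0 < q y -> `|q y - q y'| <= 14 * T * dist_st y y'.
  move=> /andP[t0 tT] /andP[t0' tT'] x1 x2 x1' x2' s0 s0' qy.
  set h := dist_st y y'.
  have ht : `|y.1 - y'.1| <= h by rewrite lerDl enorm_ge0.
  have h1 : `|y.1 - y'.1| + `|y.2.1 - y'.2.1| <= h.
    by rewrite lerD2l; exact: (enorm_ge1 (y.2 - y'.2)).
  have h2 : `|y.2.2 - y'.2.2| <= h.
    by rewrite -[leLHS]add0r lerD//; exact: (enorm_ge2 (y.2 - y'.2)).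
  set t := y.1 - a.1 in s0 *; set t' := y'.1 - a.1 in s0' *.
  set e1 := y.2.1 - a.2.1 - m * t; set e1' := y'.2.1 - a.2.1 - m * t'.
  set e2 := y.2.2 - a.2.2; set e2' := y'.2.2 - a.2.2.
  have qyE : q y = t ^+ 2 - e1 ^+ 2 - e2 ^+ 2 by [].
  have qyE' : q y' = t' ^+ 2 - e1' ^+ 2 - e2' ^+ 2 by [].
  rewrite qyE in qy.
  have tt' : `|t - t'| <= h by rewrite /t /t' opprB addrA subrK.
  have b1 : `|e1| < t by apply: sqr_lt_norm => //; have := sqr_ge0 e2; lra.
  have b2 : `|e2| < t by apply: sqr_lt_norm => //; have := sqr_ge0 e1; lra.
  have d1 : `|e1 - e1'| <= h.
    apply: le_trans h1; rewrite [leRHS]addrC.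
    have -> : e1 - e1' = (y.2.1 - y'.2.1) - m * (y.1 - y'.1) by rewrite /e1 /e1' /t /t'; ring.
    apply: (le_trans (ler_normB _ _)); rewrite lerD2l normrM (ger0_norm m0).
    by rewrite ler_piMl// ltW.
  have d2 : `|e2 - e2'| <= h.
    by have -> : e2 - e2' = y.2.2 - y'.2.2 by rewrite /e2 /e2'; ring.
  have dt2 : `|y.1 - y'.1| <= T by rewrite ler_norml; apply/andP; split; lra.
  have dx1 : `|y.2.1 - y'.2.1| <= 2 * T.
    by apply: (le_trans (ler_normB _ _)); lra.
  have dx2 : `|y.2.2 - y'.2.2| <= 2 * T.
    by apply: (le_trans (ler_normB _ _)); lra.
  have B1 : `|e1 + e1'| <= 5 * T.
    have -> : e1 + e1' = 2 * e1 - (y.2.1 - y'.2.1) + m * (y.1 - y'.1).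
      by rewrite /e1 /e1' /t /t'; ring.
    apply: (le_trans (ler_normD _ _)); apply: (@le_trans _ _ (4 * T + T)); last by lra.
    rewrite lerD//.
      apply: (le_trans (ler_normB _ _)); rewrite normrM ger0_norm//.
      by rewrite /t in b1; lra.
    by rewrite normrM (ger0_norm m0) -[leRHS]mul1r ler_pM// ltW.
  have B2 : `|e2 + e2'| <= 4 * T.
    have -> : e2 + e2' = 2 * e2 - (y.2.2 - y'.2.2) by rewrite /e2 /e2'; ring.
    apply: (le_trans (ler_normB _ _)); rewrite normrM ger0_norm//.
    by rewrite /t in b2; lra.
  have Bt : `|t + t'| <= 2 * T by rewrite ger0_norm; rewrite /t /t' in s0 s0' *; lra.
  have -> : q y - q y' = (t - t') * (t + t') - (e1 - e1') * (e1 + e1')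
     - (e2 - e2') * (e2 + e2') by rewrite qyE qyE'; ring.
  have pr (u v U V : R) : `|u| <= U -> `|v| <= V -> `|u * v| <= U * V.
    by move=> uU vV; rewrite normrM ler_pM.
  have h0 : 0 <= h by apply: le_trans ht.
  have := pr _ _ _ _ tt' Bt; have := pr _ _ _ _ d1 B1; have := pr _ _ _ _ d2 B2.
  set u1 := (t - t') * _; set u2 := (e1 - e1') * _; set u3 := (e2 - e2') * _.
  move=> k3 k2 k1'; have := ler_normB (u1 - u2) u3; have := ler_normB u1 u2.
  have : 0 <= h * T by rewrite mulr_ge0// ltW.
  move: k1' k2 k3; set hT := h * T; rewrite !(mulrCA h) -/hT.
  have -> : 14 * T * h = 14 * hT by rewrite /hT; ring.
  lra.
have C1 (y y' : spacetime R) : 0 < y.1 <= T -> 0 < y'.1 <= T ->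
    `|y.2.1| <= T -> `|y.2.2| <= T -> `|y'.2.1| <= T -> `|y'.2.2| <= T ->
    0 < y.1 - a.1 -> 0 < q y -> ~~ ((0 < y'.1 - a.1) && (0 < q y')) ->
    q y <= 14 * T * dist_st y y'.
  move=> ty ty' x1 x2 x1' x2' s0 qy; rewrite negb_and -!leNgt.
  have [s0' /=|s0' _] := ltP 0 (y'.1 - a.1).
    move=> q0; apply: (@le_trans _ _ `|q y - q y'|); last exact: C2.
    by apply: (@le_trans _ _ (q y - q y')); [lra|exact: ler_norm].
  have ht : y.1 - a.1 <= dist_st y y'.
    apply: (@le_trans _ _ `|y.1 - y'.1|); last by rewrite lerDl enorm_ge0.
    by apply: (@le_trans _ _ (y.1 - y'.1)); [lra|exact: ler_norm].
  apply: (@le_trans _ _ ((y.1 - a.1) ^+ 2)).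
    by rewrite /q -addrA gerDl -opprD oppr_le0 addr_ge0// sqr_ge0.
  rewrite expr2 ler_pM ?(ltW s0)//.
  by case/andP: ty => _ ty; lra.
move=> ty ty' x1 x2 x1' x2'.
have dC y y' : dist_st y y' = dist_st y' y.
  by rewrite /dist_st distrC -enormN opprB.
have one (y y' : spacetime R) : 0 < y.1 <= T -> 0 < y'.1 <= T ->
    `|y.2.1| <= T -> `|y.2.2| <= T -> `|y'.2.1| <= T -> `|y'.2.2| <= T ->
    (0 < y.1 - a.1) && (0 < q y) -> ~~ ((0 < y'.1 - a.1) && (0 < q y')) ->
    wave 2^-1 y a <= (14 * T * dist_st y y') `^ k * wave (2^-1 + k) y a.
  move=> ??????; rewrite !waveE => h1 h2; rewrite h1; case/andP: h1 => s0 q0.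
  by apply: power_diff1 => //; exact: C1.
have [p|p] := boolP ((0 < z.1 - a.1) && (0 < q z));
  have [p'|p'] := boolP ((0 < z'.1 - a.1) && (0 < q z')).
- case/andP: (p) => s0 qz; case/andP: (p') => s0' qz'.
  have dq : `|q z - q z'| <= 14 * T * dist_st z z' by exact: C2.
  rewrite !waveE p p'; have [qq|qq] := leP (q z) (q z').
    have hq : q z' - q z <= 14 * T * dist_st z z'.
      by apply: le_trans dq; rewrite distrC; exact: ler_norm.
    apply: (le_trans (power_diff2 qz k01 qq hq)).
    by rewrite ler_wpM2l ?powR_ge0// lerDl powR_ge0.
  have hq : q z - q z' <= 14 * T * dist_st z z' by apply: le_trans dq; exact: ler_norm.
  rewrite distrC; apply: (le_trans (power_diff2 qz' k01 (ltW qq) hq)).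
  by rewrite ler_wpM2l ?powR_ge0// lerDr powR_ge0.
- have -> : wave 2^-1 z' a = 0 by rewrite waveE (negbTE p').
  rewrite subr0 ger0_norm ?wave_ge0//.
  apply: (le_trans (one _ _ ty ty' x1 x2 x1' x2' p p')).
  by rewrite ler_wpM2l ?powR_ge0// lerDl wave_ge0.
- have -> : wave 2^-1 z a = 0 by rewrite waveE (negbTE p).
  rewrite sub0r normrN ger0_norm ?wave_ge0// dC.
  apply: (le_trans (one _ _ ty' ty x1' x2' x1 x2 p' p)).
  by rewrite ler_wpM2l ?powR_ge0// lerDr wave_ge0.
- have -> : wave 2^-1 z a = 0 by rewrite waveE (negbTE p).
  have -> : wave 2^-1 z' a = 0 by rewrite waveE (negbTE p').
  by rewrite subrr normr0 mulr_ge0 ?powR_ge0// addr_ge0 ?wave_ge0.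
Qed.

End wave.

(** * Uniform covariance bound for the singular kernel *)

Section wave_cov.
Context (R : realType) (m alpha : R) (f : R -> R).
Hypothesis m01 : 0 <= m < 1.
Hypothesis a01 : 0 < alpha < 1.
Hypothesis f_ge0 : forall r : R, (0 <= r)%R -> (0 <= f r)%R.
Hypothesis f_cont : forall r : R, (0 < r)%R -> {for r, continuous f}.
Local Notation L := (@lebesgue_measure R).
Local Notation PL := (plane_measure R).
Local Open Scope ereal_scope.

Lemma measurable_pform d (T : measurableType d) (u v : T * plane R -> R) :
  measurable_fun setT u -> measurable_fun setT v ->
  (forall x, 0 <= u x)%R -> (forall x, 0 <= v x)%R ->
  measurable_fun setT (fun t => pform f (fun x => u (t, x)) (fun x => v (t, x))).
Proof.
move=> mu mv u0 v0; rewrite /pform.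
pose h (p : T * plane R * plane R) :=
  (u (p.1.1, p.1.2) * f (enorm (p.1.2 - p.2)%R) * v (p.1.1, p.2))%:E.
have mh : measurable_fun setT h.
  apply: mf_EFin; apply: mf_mul; last by apply: (measurableT_comp mv); mfun.
  by apply: mf_mul; [apply: (measurableT_comp mu)|apply: (mf_kernel f_cont)]; mfun.
have h0 p : 0 <= h p by rewrite lee_fin !mulr_ge0// f_enorm_ge0.
apply: (@measurable_plane_integral _ _ _ (fun p : T * plane R => \int[PL]_y h (p, y))).
  exact: (measurable_plane_integral mh).
by move=> p; exact: integral_ge0.
Qed.

(** At each time [s] the kernel is the profile at time [t - s], reflected and
    translated, and the form is invariant under these maps.  The covariance is thus
    at most the integral of [wprof_time_bound], up to a reflection of the time axis. *)
Lemma wave_cov_bound (T : R) : (0 < T)%R ->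
  (\int[L]_r radial f (3 * alpha / 4) (4 * T) r < +oo) ->
  exists2 B : R, (0 <= B)%R & forall z : spacetime R, (0 < z.1 <= T)%R ->
  cov f (wave m (2^-1 + alpha / 4) z) (wave m (2^-1 + alpha / 4) z) <= B%:E.
Proof.
move=> T0 hrad; set b := (2^-1 + alpha / 4)%R.
have := wprof_time_bound a01 f_ge0 f_cont T0 hrad; rewrite -/b.
pose P (t : R) := if (0 < t < T)%R then pform f (wprof b t) (wprof b t) else 0.
move=> hP0; have hP : \int[L]_t P t < +oo by exact: hP0.
have pf0 t : 0 <= pform f (wprof b t) (wprof b t).
  apply: integral_ge0 => x _; apply: integral_ge0 => y _.
  by rewrite lee_fin !mulr_ge0 ?wprof_ge0// f_enorm_ge0.
have P0 t : 0 <= P t by rewrite /P; case: ifP.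
have mP : measurable_fun setT P.
  apply: mf_if; [mfun| |mfun].
  apply: (@measurable_pform _ _ (fun p : R * plane R => wprof b p.1 p.2)
    (fun p : R * plane R => wprof b p.1 p.2)); try (by apply: mf_wprof; mfun);
    by move=> x; exact: wprof_ge0.
have PE s : P s = if (0 < s < T)%R then pform f (wprof b s) (wprof b s) else 0 by [].
clearbody P.
have IP0 : 0 <= \int[L]_t P t by exact: integral_ge0.
exists (fine (\int[L]_t P t)); first exact: fine_ge0.
rewrite fineK ?ge0_fin_numE// => -[t x] /= /andP[t0 tT].
have mPt : measurable_fun setT (fun s : R => P (t - s)%R) by apply: (measurableT_comp mP); mfun.
pose W (s : R) := if (0 < s < t)%R then P (t - s)%R else 0.
have mW : measurable_fun setT W by apply: mf_if => //; mfun.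
apply: (@le_trans _ _ (\int[L]_s P (t - s)%R)); last first.
  by have := ge0_integral_reflect t mP P0 => ->.
apply: (@le_trans _ _ (\int[L]_s W s)); last first.
  apply: leb_le => //.
  - by move=> s; rewrite /W; case: ifP.
  - by move=> s; rewrite /W; case: ifP.
rewrite covE integral_mkcond le_eqVlt; apply/orP; left; apply/eqP.
apply: eq_integral => s _; rewrite patchE /W.
have zero : ~~ (0 < s < t)%R -> pform f (fun y => wave m b (t, x) (s, y))
    (fun y => wave m b (t, x) (s, y)) = 0.
  move=> h; rewrite /pform integral0_eq// => y _; rewrite integral0_eq// => y' _.
  rewrite {1}/wave/=; case: ifPn => [s0|]; last by rewrite !mul0r.
  by rewrite /wprof subr_gt0 (_ : (s < t)%R = false) ?mul0r//; apply/negbTE; move: h; rewrite s0.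
case: ifPn => [sD|]; last first.
  rewrite mem_setE in_itv/= andbT -ltNge => s0; rewrite ifF//.
  by apply/negbTE; rewrite negb_and -leNgt ltW.
case: ifPn => [st|/zero//].
have /andP[s0 st'] := st.
rewrite PE ifT; last by apply/andP; split; lra.
pose c : plane R := (x.1 - m * (t - s), x.2)%R.
have mw : measurable_fun setT (fun y : plane R => wprof b (t - s) y) by apply: mf_wprof; mfun.
have w0 y : (0 <= wprof b (t - s) y)%R by exact: wprof_ge0.
have e := pform_reflect f_ge0 f_cont c mw mw w0 w0.
rewrite -e.
suff ee : (fun y => wave m b (t, x) (s, y)) = (fun y : plane R => wprof b (t - s) (c - y)%R).
  exact: (congr1 (fun u => pform f u u) ee).
apply/funext => y; rewrite /wave/= s0; congr (wprof _ _ (_, _)).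
by rewrite /c/=; ring.
Qed.

End wave_cov.

(** * Smooth bumps *)

Section flat.
Context (R : realType).

(** The family is closed under differentiation, up to linear combinations; this
    makes [flat 0] smooth without computing its higher derivatives. *)
Definition flat (n : nat) (x : R) : R := if 0 < x then x^-1 ^+ n * expR (- x^-1) else 0.

Lemma flat_ge0 n x : 0 <= flat n x.
Proof.
rewrite /flat; case: ifP => // x0.
by rewrite mulr_ge0 ?expR_ge0// exprn_ge0// invr_ge0 ltW.
Qed.

(** The exponential dominates [x^-1 ^+ n.+1 / n.+1`!], one power more than the
    prefactor. *)
Lemma flat_bound n : exists2 C : R, 0 <= C & forall x, `|flat n x| <= C * `|x|.
Proof.
exists (n.+1)`!%:R => // x; rewrite (ger0_norm (flat_ge0 _ _)) /flat.
case: ifPn => [x0|_]; last by rewrite mulr_ge0.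
rewrite (ger0_norm (ltW x0)); set y := x^-1.
have y0 : 0 < y by rewrite invr_gt0.
have -> : x = y^-1 by rewrite invrK.
have := expR_ge1Dxn n (ltW y0); set E := expR y => hE.
have E0 : 0 < E by exact: expR_gt0.
rewrite expRN -/E ler_pdivrMr// mulrAC ler_pdivlMr// mulrC -exprS.
rewrite mulrC -ler_pdivrMr ?ltr0n ?fact_gt0//.
by apply: le_trans hE; rewrite lerDr.
Qed.

(** At 0 the difference quotient of [flat n] is [flat n.+1], which [flat_bound]
    sends to 0. *)
Lemma flat_derive (n : nat) (x : R) :
  is_derive x 1 (flat n) (flat n.+2 x - n%:R * flat n.+1 x).
Proof.
have [x0|x0|x0] := ltgtP x 0; last first.
- rewrite x0 /flat ltxx mulr0 subr0; have [C C0 hC] := flat_bound n.+1.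
  have cv : h^-1 *: (flat n (h *: 1 + 0) - flat n 0) @[h --> 0^'] --> 0.
    apply/cvgrPdist_le => e e0; near=> h; rewrite sub0r normrN.
    have h0 : h != 0 by near: h; exact: nbhs_dnbhs_neq.
    rewrite {2}/flat ltxx subr0 addr0 scaler1.
    have -> : h^-1 *: flat n h = flat n.+1 h.
      by rewrite /flat; case: ifP; rewrite ?scaler0// exprS -mulrA.
    apply: (le_trans (hC h)).
    apply: (@le_trans _ _ ((C + 1) * `|h|)); first by rewrite ler_wpM2r// lerDl.
    rewrite -ler_pdivlMl ?ltr_wpDl//.
    near: h; apply: dnbhs0_le; rewrite mulr_gt0// invr_gt0 ltr_wpDl//.
  apply: DeriveDef; first by apply/cvg_ex; exists 0; exact: cv.
  by apply/cvg_lim => //; exact: cv.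
- have e0 : (x == 0) = false by rewrite gt_eqF.
  rewrite /flat x0.
  apply: (@near_eq_is_derive _ _ _ (fun y : R => y^-1 ^+ n * expR (- y^-1))).
    near=> y; rewrite ifT//.
    by near: y; exact: lt_nbhsr.
  have dV : is_derive x 1 (fun y : R => y^-1) (- x ^- 2).
    apply: (is_derive_eq (@is_deriveV R id x 1 1 (negbT e0) (is_derive_id x 1))).
    by rewrite [LHS]mulr1.
  have dE : is_derive x 1 (fun y : R => expR (- y^-1)) (x ^- 2 * expR (- x^-1)).
    apply: (is_derive_eq (@is_derive1_comp R expR (fun y : R => - y^-1) x _ _
      (is_derive_expR _) (is_deriveN dV))).
    by rewrite mulrC opprK.
  have dX : is_derive x 1 (fun y : R => y^-1 ^+ n) (- n%:R * x^-1 ^+ n.+1).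
    case: n => [|k].
      rewrite (_ : (fun y : R => _) = cst 1); last by apply/funext => y; rewrite expr0.
      by apply: (is_derive_eq (is_derive_cst _ _ _)); rewrite oppr0 mul0r.
    rewrite (_ : (fun y : R => _) = (fun y : R => y^-1) ^+ k.+1); last first.
      by apply/funext => y; rewrite fctE.
    apply: (is_derive_eq (is_deriveX k.+1 dV)) => /=.
    rewrite [LHS]mulrN -exprVn mulNr; congr (- _).
    by rewrite -mulrA -exprD addn2.
  apply: (is_derive_eq (is_deriveM dX dE)).
  rewrite -[LHS]/(x^-1 ^+ n * (x ^- 2 * expR (- x^-1)) +
    expR (- x^-1) * (- n%:R * x^-1 ^+ n.+1)) -exprVn !exprS expr0; ring.
- rewrite /flat ltNge (ltW x0)/= mulr0 subr0.
  apply: (@near_eq_is_derive _ _ _ (cst 0)).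
    near=> y; rewrite ifF//; apply/negbTE; rewrite -leNgt ltW//.
    by near: y; exact: lt_nbhsl.
Unshelve. all: by end_near. Qed.

Lemma flat_continuous n : continuous (flat n).
Proof.
move=> x; apply: differentiable_continuous; apply/derivable1_diffP.
by have [] := flat_derive n x.
Qed.

Lemma flat_derive_dir (n : nat) (x v : R) :
  is_derive x v (flat n) (v * (flat n.+2 x - n%:R * flat n.+1 x)).
Proof.
have dn := flat_derive n x.
have df : differentiable (flat n) x by apply/derivable1_diffP; case: dn.
apply: DeriveDef; first exact: diff_derivable.
rewrite deriveE// -[X in 'd _ _ X]mulr1 -[X in 'd _ _ X]/(v *: 1) linearZ/=.
by rewrite -deriveE//; case: dn => _ ->.
Qed.

End flat.

Section smooth.
Context (R : realType).
Local Notation ST := (spacetime R).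

(** The algebra generated by flat functions of affine forms.  It is closed under
    directional derivatives, so that its members have derivatives of all orders. *)
Inductive smooth : (ST -> R) -> Prop :=
| smooth_cst (c : R) : smooth (cst c)
| smooth_flat n (l lam : ST -> R) : continuous l ->
    (forall s z v, l (s *: v + z) = s * lam v + l z) -> smooth (fun z => flat n (l z))
| smooth_add f g : smooth f -> smooth g -> smooth (f + g)
| smooth_mul f g : smooth f -> smooth g -> smooth (f * g).

Lemma smooth_continuous f : smooth f -> continuous f.
Proof.
elim=> [c|n l lam cl _|g h _ cg _ ch|g h _ cg _ ch] z.
- exact: cvg_cst.
- by apply: continuous_comp; [exact: cl|exact: flat_continuous].
- by apply: cvgD; [exact: cg|exact: ch].
- by apply: cvgM; [exact: cg|exact: ch].
Qed.

Lemma smooth_is_derive f (v : ST) : smooth f ->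
  exists2 g, smooth g & forall z, is_derive z v f (g z).
Proof.
elim=> [c|n l lam cl ll|g h _ [g' sg' dg] _ [h' sh' dh]|g h sg [g' sg' dg] sh [h' sh' dh]].
- by exists (cst 0) => [|z]; [exact: smooth_cst|exact: is_derive_cst].
- exists (cst (lam v) * ((fun z => flat n.+2 (l z)) + cst (- n%:R) * (fun z => flat n.+1 (l z)))).
    apply: smooth_mul; first exact: smooth_cst.
    apply: smooth_add; first exact: smooth_flat cl ll.
    by apply: smooth_mul; [exact: smooth_cst|exact: smooth_flat cl ll].
  move=> z; have [dv de] := flat_derive_dir n (l z) (lam v).
  have e : (fun s : R => s^-1 *: (((fun z => flat n (l z)) \o shift z) (s *: v) - flat n (l z))) =
     (fun s : R => s^-1 *: ((flat n \o shift (l z)) (s *: lam v) - flat n (l z))).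
    by apply/funext => s /=; rewrite ll.
  apply: DeriveDef; first by rewrite /derivable e.
  by rewrite /derive e -/(derive (flat n) (l z) (lam v)) de !fctE /= mulNr.
- by exists (g' + h') => [|z]; [exact: smooth_add|exact: is_deriveD].
- exists (g * h' + h * g') => [|z]; last exact: is_deriveM.
  by apply: smooth_add; apply: smooth_mul.
Qed.

Lemma smooth_Ck k f : smooth f -> Ck k f.
Proof.
elim: k f => [|k IH] f sf /=; first exact: smooth_continuous.
split; first exact: smooth_continuous.
- by move=> z v; have [g _ dg] := smooth_is_derive v sf; have [] := dg z.
- move=> v; have [g sg dg] := smooth_is_derive v sf.
  rewrite (_ : (fun z => _) = g); first exact: IH.
  by apply/funext => z; have [_ ->] := dg z.
Qed.

Definition bump (x : R) : R := flat 0 x * flat 0 (1 - x).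

Lemma bump_ge0 x : 0 <= bump x.
Proof. by rewrite mulr_ge0 ?flat_ge0. Qed.

Lemma bump_out x : ~~ (0 < x < 1) -> bump x = 0.
Proof.
rewrite /bump /flat subr_gt0 negb_and => /orP[/negbTE ->|/negbTE ->].
  by rewrite mul0r.
by rewrite mulr0.
Qed.

Lemma bump_continuous : continuous bump.
Proof.
move=> x; apply: cvgM; first exact: flat_continuous.
apply: (@continuous_comp _ _ _ (fun y : R => 1 - y) (flat 0)); last exact: flat_continuous.
by apply: cvgB; [exact: cvg_cst|exact: cvg_id].
Qed.

Lemma bump_le1 x : bump x <= 1.
Proof.
have fl (y : R) : flat 0 y <= 1.
  rewrite /flat; case: ifP => // y0; rewrite expr0 mul1r -expR0 ler_expR oppr_le0.
  by rewrite invr_ge0 ltW.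
by rewrite -[leRHS]mulr1 ler_pM ?flat_ge0 ?fl.
Qed.

(** Supported by the square of side [1 / n] whose lower left corner is
    [(i / n, j / n)]. *)
Definition cell_bump (n i j : R) (x : plane R) : R :=
  bump (n * x.1 - i) * bump (n * x.2 - j).

Let c21 : continuous (fun z : ST => z.2.1).
Proof. by move=> z; apply: (@continuous_comp _ _ _ snd fst); [exact: cvg_snd|exact: cvg_fst]. Qed.

Let c22 : continuous (fun z : ST => z.2.2).
Proof. by move=> z; apply: (@continuous_comp _ _ _ snd snd); [exact: cvg_snd|exact: cvg_snd]. Qed.

Let caff (n i : R) (h : ST -> R) : continuous h -> continuous (fun z => n * h z - i).
Proof.
move=> ch z; apply: cvgB; last exact: cvg_cst.
by apply: cvgM; [exact: cvg_cst|exact: ch].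
Qed.

Let caff1 (n i : R) (h : ST -> R) : continuous h -> continuous (fun z => 1 - (n * h z - i)).
Proof. by move=> ch z; apply: cvgB; [exact: cvg_cst|exact: caff]. Qed.

Lemma test_cell_bump (n i j : R) : 0 < n ->
  test_function (fun z : ST => bump z.1 * cell_bump n i j z.2).
Proof.
move=> n0; split.
  move=> k; apply: smooth_Ck; apply: smooth_mul; [|apply: smooth_mul].
  - apply: smooth_mul.
      apply: (@smooth_flat 0 (fun z => z.1) (fun z => z.1)) => [z|s z v]; first exact: cvg_fst.
      by [].
    apply: (@smooth_flat 0 (fun z => 1 - z.1) (fun z => - z.1)) => [z|s z v /=]; last by rewrite -[_ *: _]/(_ * _); ring.
    by apply: cvgB; [exact: cvg_cst|exact: cvg_fst].
  - apply: smooth_mul.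
      apply: (@smooth_flat 0 (fun z => n * z.2.1 - i) (fun z => n * z.2.1)).
        exact: caff c21.
      by move=> s z v /=; rewrite -[_ *: _]/(_ * _); ring.
    apply: (@smooth_flat 0 (fun z => 1 - (n * z.2.1 - i)) (fun z => - (n * z.2.1))).
      exact: caff1 c21.
    by move=> s z v /=; rewrite -[_ *: _]/(_ * _); ring.
  - apply: smooth_mul.
      apply: (@smooth_flat 0 (fun z => n * z.2.2 - j) (fun z => n * z.2.2)).
        exact: caff c22.
      by move=> s z v /=; rewrite -[_ *: _]/(_ * _); ring.
    apply: (@smooth_flat 0 (fun z => 1 - (n * z.2.2 - j)) (fun z => - (n * z.2.2))).
      exact: caff1 c22.
    by move=> s z v /=; rewrite -[_ *: _]/(_ * _); ring.
set K : set ST := `[0, 1] `*` (`[i / n, (i + 1) / n] `*` `[j / n, (j + 1) / n]).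
have cK : compact K.
  by apply: compact_setX; [|apply: compact_setX]; exact: segment_compact.
have clK : closed K by apply: compact_closed => //; exact: norm_hausdorff.
apply: (subclosed_compact _ cK); first exact: closed_closure.
rewrite [X in _ `<=` X](closure_id _).1//; apply: closureS => -[t [x y]] /=.
rewrite /cell_bump mulf_eq0 negb_or => /andP[ht].
rewrite mulf_eq0 negb_or => /andP[hx hy].
have nb (u : R) : bump u != 0 -> 0 < u < 1.
  by move=> h; apply/negPn/negP => /bump_out e; rewrite e eqxx in h.
have /andP[t0 t1] := nb _ ht; have /andP[x0 x1] := nb _ hx; have /andP[y0 y1] := nb _ hy.
split; [|split] => /=; rewrite in_itv/=; apply/andP; split;
  rewrite ?ler_pdivrMr ?ler_pdivlMr//=; rewrite /= in x0 x1 y0 y1 t0 t1; lra.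
Qed.

End smooth.

(** * Bilinearity and bounds for the covariance form *)

Section bilinear.
Context (R : realType) (g : R -> R).
Hypothesis g_ge0 : forall r : R, 0 <= r -> 0 <= g r.
Hypothesis g_cont : forall r : R, 0 < r -> {for r, continuous g}.
Local Notation PL := (plane_measure R).
Local Open Scope ereal_scope.
Implicit Types u v p q : plane R -> R.

Definition nnmeas (u : plane R -> R) := measurable_fun setT u /\ forall x, (0 <= u x)%R.

Let mI u v : nnmeas u -> nnmeas v -> measurable_fun setT (fun z : plane R * plane R =>
    (u z.1 * g (enorm (z.1 - z.2)%R) * v z.2)%:E).
Proof. by move=> [mu _] [mv _]; exact: measurable_pform_integrand. Qed.

Let I0 u v : nnmeas u -> nnmeas v -> forall z : plane R * plane R,
  0 <= (u z.1 * g (enorm (z.1 - z.2)%R) * v z.2)%:E.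
Proof. by move=> [_ u0] [_ v0] z; rewrite lee_fin !mulr_ge0// g_ge0// enorm_ge0. Qed.

Let mIx u v x : nnmeas u -> nnmeas v -> measurable_fun setT (fun y : plane R =>
    (u x * g (enorm (x - y)%R) * v y)%:E).
Proof.
move=> hu hv; have := mI hu hv => h.
by apply: (measurableT_comp h (_ : measurable_fun setT (fun y : plane R => (x, y)))); mfun.
Qed.

Let mIy u v : nnmeas u -> nnmeas v -> measurable_fun setT (fun x : plane R =>
    \int[PL]_y (u x * g (enorm (x - y)%R) * v y)%:E).
Proof. by move=> hu hv; exact: (measurable_plane_integral (mI hu hv) (I0 hu hv)). Qed.

Lemma pform_ge0 u v : nnmeas u -> nnmeas v -> 0 <= pform g u v.
Proof.
move=> hu hv; apply: integral_ge0 => x _; apply: integral_ge0 => y _.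
exact: (I0 hu hv (x, y)).
Qed.

Lemma pform_sym u v : nnmeas u -> nnmeas v -> pform g u v = pform g v u.
Proof.
move=> hu hv; rewrite /pform (tonelli_planes (mI hu hv) (I0 hu hv)).
apply: eq_integral => y _; apply: eq_integral => x _ /=; congr EFin.
have -> : enorm (x - y)%R = enorm (y - x)%R by rewrite -enormN opprB.
by ring.
Qed.

Lemma pform_le u v p q : nnmeas u -> nnmeas v -> nnmeas p -> nnmeas q ->
  (forall x, u x <= p x)%R -> (forall x, v x <= q x)%R -> pform g u v <= pform g p q.
Proof.
move=> hu hv hp hq up vq; apply: plane_le.
- by move=> x; apply: integral_ge0 => y _; exact: (I0 hu hv (x, y)).
- exact: mIy.
- exact: mIy.
- move=> x; apply: plane_le.
  + by move=> y; exact: (I0 hu hv (x, y)).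
  + exact: mIx.
  + exact: mIx.
  + move=> y; have gg : (0 <= g (enorm (x - y)))%R by rewrite g_ge0// enorm_ge0.
    case: hu => _ u0; case: hv => _ v0.
    by rewrite lee_fin ler_pM// ?mulr_ge0// ler_wpM2r.
Qed.

Lemma pformDl u v p : nnmeas u -> nnmeas v -> nnmeas p ->
  pform g (fun x => u x + v x)%R p = pform g u p + pform g v p.
Proof.
move=> hu hv hp; rewrite /pform -plane_add; [| | |exact: mIy|exact: mIy]; last 2 first.
- by move=> x; apply: integral_ge0 => y _; exact: (I0 hu hp (x, y)).
- by move=> x; apply: integral_ge0 => y _; exact: (I0 hv hp (x, y)).
apply: eq_integral => x _; rewrite -plane_add; [| | |exact: mIx|exact: mIx].
- by apply: eq_integral => y _; rewrite -EFinD; congr EFin; ring.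
- by move=> y; exact: (I0 hu hp (x, y)).
- by move=> y; exact: (I0 hv hp (x, y)).
Qed.

Lemma pformZl c u p : (0 <= c)%R -> nnmeas u -> nnmeas p ->
  pform g (fun x => c * u x)%R p = c%:E * pform g u p.
Proof.
move=> c0 hu hp; rewrite /pform -plane_mull; [| |move=> x|exact: mIy]; last 2 first.
- by rewrite lee_fin.
- by apply: integral_ge0 => y _; exact: (I0 hu hp (x, y)).
apply: eq_integral => x _; rewrite -plane_mull; [| |move=> y|exact: mIx].
- by apply: eq_integral => y _; rewrite -EFinM; congr EFin; ring.
- by rewrite lee_fin.
- exact: (I0 hu hp (x, y)).
Qed.

Lemma pform0l p : pform g (fun=> 0%R) p = 0.
Proof.
by rewrite /pform integral0_eq// => x _; rewrite integral0_eq// => y _; rewrite !mul0r.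
Qed.

Lemma nnmeas0 : nnmeas (fun=> 0%R). Proof. by split. Qed.

Lemma nnmeasD u v : nnmeas u -> nnmeas v -> nnmeas (fun x => u x + v x)%R.
Proof. by move=> [mu u0] [mv v0]; split; [mfun|move=> x; rewrite addr_ge0]. Qed.

Lemma nnmeasM u v : nnmeas u -> nnmeas v -> nnmeas (fun x => u x * v x)%R.
Proof. by move=> [mu u0] [mv v0]; split; [mfun|move=> x; rewrite mulr_ge0]. Qed.

Lemma nnmeasZ c u : (0 <= c)%R -> nnmeas u -> nnmeas (fun x => c * u x)%R.
Proof. by move=> c0 [mu u0]; split; [mfun|move=> x; rewrite mulr_ge0]. Qed.

Lemma nnmeas_sum (I : Type) (s : seq I) (F : I -> plane R -> R) :
  (forall i, nnmeas (F i)) -> nnmeas (fun x => \sum_(i <- s) F i x)%R.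
Proof.
move=> hF; elim: s => [|i s IH].
  by rewrite (_ : (fun x => _) = (fun=> 0%R)); [exact: nnmeas0|apply/funext => x; rewrite big_nil].
rewrite (_ : (fun x => _) = (fun x => F i x + \sum_(j <- s) F j x)%R).
  exact: nnmeasD.
by apply/funext => x; rewrite big_cons.
Qed.

Lemma pform_suml (I : Type) (s : seq I) (F : I -> plane R -> R) p :
  (forall i, nnmeas (F i)) -> nnmeas p ->
  pform g (fun x => \sum_(i <- s) F i x)%R p = \sum_(i <- s) pform g (F i) p.
Proof.
move=> hF hp; elim: s => [|i s IH].
  rewrite big_nil (_ : (fun x => _) = (fun=> 0%R)); first exact: pform0l.
  by apply/funext => x; rewrite big_nil.
have e : (fun x => \sum_(j <- i :: s) F j x)%R = (fun x => F i x + \sum_(j <- s) F j x)%R.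
  by apply/funext => x; rewrite big_cons.
rewrite e (pformDl (hF i) (nnmeas_sum s hF) hp) big_cons.
by congr (_ + _).
Qed.

Lemma pform_sum (I J : Type) (s : seq I) (r : seq J) (F : I -> plane R -> R)
    (G : J -> plane R -> R) :
  (forall i, nnmeas (F i)) -> (forall j, nnmeas (G j)) ->
  pform g (fun x => \sum_(i <- s) F i x)%R (fun x => \sum_(j <- r) G j x)%R =
  \sum_(i <- s) \sum_(j <- r) pform g (F i) (G j).
Proof.
move=> hF hG; have nG := nnmeas_sum r hG.
rewrite (pform_suml s hF nG); apply: eq_bigr => i _.
rewrite (pform_sym (hF i) nG) (pform_suml r hG (hF i)).
by apply: eq_bigr => j _; exact: (pform_sym (hG j) (hF i)).
Qed.

(** The kernel only matters at the pairs of points that the supports allow; with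
    [pform_lower] this compares the form with a discrete double sum. *)
Lemma pform_upper u v (s a b : R) : nnmeas u -> nnmeas v -> (0 <= s)%R ->
  \int[PL]_x (u x)%:E = a%:E -> \int[PL]_x (v x)%:E = b%:E ->
  (forall x y, u x != 0 -> v y != 0 -> g (enorm (x - y)) <= s)%R ->
  pform g u v <= (s * a * b)%:E.
Proof.
move=> hu hv s0 ia ib h; have [[mu u0] [mv v0]] := (hu, hv).
have b0 : (0 <= b)%R by rewrite -lee_fin -ib; apply: integral_ge0 => x _; rewrite lee_fin.
apply: (@le_trans _ _ (\int[PL]_x ((s * b)%:E * (u x)%:E))).
  apply: plane_le.
  - by move=> x; apply: integral_ge0 => y _; exact: (I0 hu hv (x, y)).
  - exact: mIy.
  - by mfun.
  - move=> x; have sux : (0 <= s * u x)%R by rewrite mulr_ge0.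
    apply: (@le_trans _ _ (\int[PL]_y ((s * u x)%:E * (v y)%:E))).
      apply: plane_le.
      + by move=> y; exact: (I0 hu hv (x, y)).
      + exact: mIx.
      + by mfun.
      + move=> y; rewrite -EFinM lee_fin.
        have [->|ux] := eqVneq (u x) 0%R; first by rewrite !(mul0r, mulr0).
        have [->|vy] := eqVneq (v y) 0%R; first by rewrite !mulr0.
        by rewrite ler_wpM2r// mulrC ler_wpM2r// h.
    rewrite plane_mull ?lee_fin//; last by mfun.
    by rewrite ib -!EFinM lee_fin mulrAC.
rewrite plane_mull ?lee_fin ?mulr_ge0//; last by mfun.
by rewrite ia -EFinM lee_fin mulrAC.
Qed.

Lemma pform_lower u v (s a b : R) : nnmeas u -> nnmeas v -> (0 <= s)%R ->
  \int[PL]_x (u x)%:E = a%:E -> \int[PL]_x (v x)%:E = b%:E ->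
  (forall x y, u x != 0 -> v y != 0 -> s <= g (enorm (x - y)))%R ->
  (s * a * b)%:E <= pform g u v.
Proof.
move=> hu hv s0 ia ib h; have [[mu u0] [mv v0]] := (hu, hv).
have b0 : (0 <= b)%R by rewrite -lee_fin -ib; apply: integral_ge0 => x _; rewrite lee_fin.
apply: (@le_trans _ _ (\int[PL]_x ((s * b)%:E * (u x)%:E))).
  rewrite plane_mull ?lee_fin ?mulr_ge0//; last by mfun.
  by rewrite ia -EFinM lee_fin mulrAC.
apply: plane_le.
- by move=> x; rewrite -EFinM lee_fin !mulr_ge0.
- by mfun.
- exact: mIy.
- move=> x; have sux : (0 <= s * u x)%R by rewrite mulr_ge0.
  apply: (@le_trans _ _ (\int[PL]_y ((s * u x)%:E * (v y)%:E))).
    rewrite plane_mull ?lee_fin//; last by mfun.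
    by rewrite ib -!EFinM lee_fin mulrAC.
  apply: plane_le.
  + by move=> y; rewrite -EFinM lee_fin mulr_ge0.
  + by mfun.
  + exact: mIx.
  + move=> y; rewrite -EFinM lee_fin.
    have [->|ux] := eqVneq (u x) 0%R; first by rewrite !(mul0r, mulr0).
    have [->|vy] := eqVneq (v y) 0%R; first by rewrite !mulr0.
    by rewrite ler_wpM2r// mulrC ler_wpM2l// h.
Qed.

End bilinear.

Section kernel_split.
Context (R : realType) (f1 f2 : R -> R).
Hypothesis f1_ge0 : forall r : R, 0 <= r -> 0 <= f1 r.
Hypothesis f1_cont : forall r : R, 0 < r -> {for r, continuous f1}.
Hypothesis f2_ge0 : forall r : R, 0 <= r -> 0 <= f2 r.
Hypothesis f2_cont : forall r : R, 0 < r -> {for r, continuous f2}.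
Local Notation PL := (plane_measure R).
Local Open Scope ereal_scope.

Lemma pform_kernelD (f : R -> R) (u v : plane R -> R) : nnmeas u -> nnmeas v ->
  (forall r, 0 <= r -> f r = f1 r + f2 r)%R ->
  pform f u v = pform f1 u v + pform f2 u v.
Proof.
move=> hu hv fE.
have mI g : (forall r : R, 0 < r -> {for r, continuous g})%R -> measurable_fun setT
    (fun z : plane R * plane R => (u z.1 * g (enorm (z.1 - z.2)%R) * v z.2)%:E).
  by case: hu => mu _; case: hv => mv _ gc; exact: measurable_pform_integrand.
have I0 g : (forall r : R, 0 <= r -> 0 <= g r)%R -> forall z : plane R * plane R,
    0 <= (u z.1 * g (enorm (z.1 - z.2)%R) * v z.2)%:E.
  case: hu => _ u0; case: hv => _ v0 g0 z.
  by rewrite lee_fin !mulr_ge0// g0// enorm_ge0.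
rewrite /pform -plane_add; last 4 first.
- by move=> x; apply: integral_ge0 => y _; exact: (I0 _ f1_ge0 (x, y)).
- by move=> x; apply: integral_ge0 => y _; exact: (I0 _ f2_ge0 (x, y)).
- exact: (measurable_plane_integral (mI _ f1_cont) (I0 _ f1_ge0)).
- exact: (measurable_plane_integral (mI _ f2_cont) (I0 _ f2_ge0)).
apply: eq_integral => x _; rewrite -plane_add; last 4 first.
- by move=> y; exact: (I0 _ f1_ge0 (x, y)).
- by move=> y; exact: (I0 _ f2_ge0 (x, y)).
- by apply: (measurableT_comp (mI _ f1_cont) (_ : measurable_fun setT (fun y : plane R => (x, y)))); mfun.
- by apply: (measurableT_comp (mI _ f2_cont) (_ : measurable_fun setT (fun y : plane R => (x, y)))); mfun.
by apply: eq_integral => y _; rewrite -EFinD fE ?enorm_ge0//; congr EFin; ring.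
Qed.

End kernel_split.

(** * Discretisation over square cells *)

Section cells.
Context (R : realType).

Lemma enorm_triangle (x y : plane R) : enorm (x + y) <= enorm x + enorm y.
Proof.
have ge0 (z : plane R) : 0 <= z.1 ^+ 2 + z.2 ^+ 2 by rewrite addr_ge0 ?sqr_ge0.
have ex (z : plane R) : enorm z ^+ 2 = z.1 ^+ 2 + z.2 ^+ 2 by rewrite sqr_sqrtr.
have s0 : 0 <= enorm x + enorm y by rewrite addr_ge0 ?enorm_ge0.
rewrite -(ler_pXn2r (_ : 0 < 2)%N) ?nnegrE ?enorm_ge0//.
rewrite ex (sqrrD (enorm x)) !ex /=.
have cs : x.1 * y.1 + x.2 * y.2 <= enorm x * enorm y.
  apply: le_trans (ler_norm _) _.
  have m0 : 0 <= enorm x * enorm y by rewrite mulr_ge0 ?enorm_ge0.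
  rewrite -(ler_pXn2r (_ : 0 < 2)%N) ?nnegrE//.
  rewrite real_normK ?num_real// exprMn !ex.
  have := sqr_ge0 (x.1 * y.2 - x.2 * y.1); nra.
by move: cs; nra.
Qed.

Lemma enorm_lip (x y : plane R) : `|enorm x - enorm y| <= enorm (x - y).
Proof.
have h1 := enorm_triangle (x - y) y; have h2 := enorm_triangle (y - x) x.
have e : enorm (y - x) = enorm (x - y) by rewrite -enormN opprB.
by move: h1 h2; rewrite !subrK e ler_norml => h1 h2; apply/andP; split; lra.
Qed.

(** Heine's theorem, in the one-sided form that is used: only one of the two points
    must lie in the segment, so the compactness argument is run directly. *)
Lemma uniform_on_segment (h : R -> R) (l e : R) : continuous h -> 0 < e ->
  exists2 dl : R, 0 < dl & forall s t, 0 <= s <= l -> `|s - t| < dl -> `|h s - h t| < e.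
Proof.
move=> hc e0; have cpt := @segment_compact R 0 l.
have /compact_near_coveringP ncov := cpt.
have := ncov R (0 : R)^'+ (fun dl s => forall t, `|s - t| < dl -> `|h s - h t| < e) _.
have H : forall x : R, `[0, l]%classic x -> \forall x' \near x & i \near (0 : R)^'+,
    (fun dl s => forall t, `|s - t| < dl -> `|h s - h t| < e) i x'.
  move=> x _; have /cvgrPdist_lt /(_ (e / 2)) h2 := hc x.
  have e20 : 0 < e / 2 by rewrite divr_gt0.
  have /nbhs_ballP[r /= r0 hr] := h2 e20.
  near=> x' i => t ht.
  have b1 : `|x - x'| < r / 2.
    near: x'; exists (r / 2) => /=; first by rewrite divr_gt0.
    by move=> z.
  have b2 : i < r / 2 by near: i; apply: nbhs_right_lt; rewrite divr_gt0.
  have k1 : `|h x - h x'| < e / 2.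
    by apply: hr; rewrite /ball/= (lt_trans b1)// ltr_pdivrMr// ltr_pMr// ltr1n.
  have k2 : `|h x - h t| < e / 2.
    apply: hr; change (`|x - t| < r).
    apply: (le_lt_trans (ler_distD x' x t)); rewrite [ltRHS]splitr ltrD//.
    exact: (lt_trans ht b2).
  have := ler_distD (h x) (h x') (h t); rewrite (distrC (h x') (h x)).
  by move: k1 k2; lra.
move=> /(_ _ H) h3.
have [dl /= dl0 hd] : exists2 dl : R, 0 < dl &
    forall s, `[0, l]%classic s -> forall t, `|s - t| < dl -> `|h s - h t| < e.
  near (0 : R)^'+ => dl; exists dl; first by [].
  have : `[0, l]%classic `<=` (fun s => forall t, `|s - t| < dl -> `|h s - h t| < e).
    by near: dl.
  by [].
by exists dl => // s t hs; apply: hd; rewrite /= in_itv.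
Unshelve. all: by end_near. Qed.

Definition cell (t : R) (i : nat) : R := if (i%:R <= t) && (t < i.+1%:R) then 1 else 0.

Lemma cell_ge0 t i : 0 <= cell t i. Proof. by rewrite /cell; case: ifP. Qed.

Lemma cell_partition (M : nat) (t : R) : 0 <= t < M%:R -> \sum_(i < M) cell t i = 1.
Proof.
elim: M => [|M IH] /andP[t0 tM]; first by move: tM t0; rewrite ltNge => /negP.
rewrite big_ord_recr/= {2}/cell; have [Mt|tM'] := leP M%:R t.
  rewrite tM /= big1 ?add0r// => i _; rewrite /cell; case: ifP => // /andP[_ ti].
  have iM : (i.+1%:R <= M%:R :> R) by rewrite ler_nat.
  by have := lt_le_trans ti iM; rewrite ltNge Mt.
by rewrite /= addr0 IH// t0.
Qed.

Lemma cell_partition2 (M : nat) (s t : R) : 0 <= s < M%:R -> 0 <= t < M%:R ->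
  \sum_(p : 'I_M * 'I_M) cell s p.1 * cell t p.2 = 1.
Proof.
move=> hs ht; rewrite -(pair_big xpredT xpredT (fun i j : 'I_M => cell s i * cell t j))/=.
under eq_bigr do rewrite -mulr_sumr (cell_partition ht) mulr1.
exact: cell_partition.
Qed.

Section cell_sums.
Context (g : R -> R).
Hypothesis g_ge0 : forall r : R, 0 <= r -> 0 <= g r.
Hypothesis g_cont : forall r : R, 0 < r -> {for r, continuous g}.
Local Notation PL := (plane_measure R).

(** If the kernel varies by at most [om] over each pair of supports, the form depends
    on its arguments through their masses only, up to [om] times the product of
    the total masses.  Two pairs of families with the same masses thus have
    nearby forms. *)
Lemma pform_cells (I : finType) (u v : I -> plane R -> R) (a b : I -> R)
    (s : I -> I -> R) (om : R) : 0 <= om ->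
  (forall i, nnmeas (u i)) -> (forall i, nnmeas (v i)) ->
  (forall i, \int[PL]_x (u i x)%:E = (a i)%:E)%E ->
  (forall i, \int[PL]_x (v i x)%:E = (b i)%:E)%E ->
  (forall i j, 0 <= s i j) ->
  (forall i j x y, u i x != 0 -> v j y != 0 -> `|g (enorm (x - y)) - s i j| <= om) ->
  (pform g (fun x => \sum_i u i x)%R (fun x => \sum_i v i x)%R <=
    (\sum_i \sum_j s i j * a i * b j + om * (\sum_i a i) * (\sum_j b j))%R%:E)%E /\
  ((\sum_i \sum_j s i j * a i * b j - om * (\sum_i a i) * (\sum_j b j))%R%:E <=
    pform g (fun x => \sum_i u i x)%R (fun x => \sum_i v i x)%R)%E.
Proof.
move=> om0 hu hv ia ib s0 hs.
have a0 i : 0 <= a i.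
  rewrite -lee_fin -ia; apply: integral_ge0 => x _.
  by case: (hu i) => _ u0; rewrite lee_fin.
have b0 i : 0 <= b i.
  rewrite -lee_fin -ib; apply: integral_ge0 => x _.
  by case: (hv i) => _ v0; rewrite lee_fin.
have e (c : R) : \sum_i \sum_j s i j * a i * b j + c * (\sum_i a i) * (\sum_j b j) =
    \sum_i \sum_j (s i j + c) * a i * b j.
  rewrite -mulrA big_distrlr mulr_sumr -big_split; apply: eq_bigr => i _ /=.
  rewrite mulr_sumr -big_split; apply: eq_bigr => j _ /=.
  by ring.
rewrite (pform_sum g_ge0 g_cont _ _ hu hv); split.
  rewrite e -sumEFin; apply: lee_sum => i _; rewrite -sumEFin; apply: lee_sum => j _.
  apply: (pform_upper g_ge0 g_cont (hu i) (hv j) _ (ia i) (ib j)).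
    by rewrite addr_ge0.
  move=> x y ux vy; have := hs i j x y ux vy; rewrite ler_norml => /andP[_ h].
  by rewrite -lerBlDl.
rewrite -!mulNr e -sumEFin; apply: lee_sum => i _; rewrite -sumEFin; apply: lee_sum => j _.
(* The lower bound of the kernel must be nonnegative. *)
apply: (@le_trans _ _ (Num.max 0 (s i j - om) * a i * b j)%:E).
  by rewrite lee_fin !ler_wpM2r// le_max lexx orbT.
apply: (pform_lower g_ge0 g_cont (hu i) (hv j) _ (ia i) (ib j)).
  by rewrite le_max lexx.
move=> x y ux vy; rewrite ge_max g_ge0 ?enorm_ge0//=.
by have := hs i j x y ux vy; rewrite ler_norml => /andP[h _]; lra.
Qed.

(** Young's inequality: the convolution of a kernel of mass [S] with a function
    bounded by [C] is bounded by [S * C]. *)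
Lemma pform_mass_bound (u v : plane R -> R) (C A S : R) : nnmeas u -> nnmeas v ->
  (forall x, v x <= C) ->
  (\int[PL]_x (u x)%:E = A%:E)%E -> (\int[PL]_z (g (enorm z))%:E <= S%:E)%E ->
  (pform g u v <= (A * (S * C))%:E)%E.
Proof.
move=> [mu u0] [mv v0] vC iA iS.
have C0 : 0 <= C by exact: le_trans (v0 0) (vC 0).
have mg d (T : measurableType d) (h : T -> plane R) : measurable_fun setT h ->
  measurable_fun setT (fun t => g (enorm (h t))) by move=> mh; exact: mf_kernel.
have S0 : 0 <= S.
  rewrite -lee_fin; apply: le_trans iS; apply: integral_ge0 => z _.
  by rewrite lee_fin g_ge0// enorm_ge0.
have mI : measurable_fun setT (fun z : plane R * plane R =>
    (u z.1 * g (enorm (z.1 - z.2)) * v z.2)%:E) by exact: measurable_pform_integrand.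
have I0 : forall z : plane R * plane R,
    (0 <= (u z.1 * g (enorm (z.1 - z.2)) * v z.2)%:E)%E.
  by move=> z; rewrite lee_fin !mulr_ge0// g_ge0// enorm_ge0.
apply: (@le_trans _ _ (\int[PL]_x ((S * C)%:E * (u x)%:E))%E); last first.
  rewrite plane_mull ?lee_fin ?mulr_ge0//; last by mfun.
  by rewrite iA -EFinM lee_fin mulrC.
apply: plane_le.
- by move=> x; apply: integral_ge0 => y _; exact: (I0 (x, y)).
- exact: (measurable_plane_integral mI I0).
- by mfun.
- move=> x; have mgx : measurable_fun setT (fun y : plane R => (g (enorm (x - y)))%:E).
    by apply: mf_EFin; apply: mg; apply: mf_padd; [|apply: mf_popp]; mfun.
  have gx0 y : (0 <= (g (enorm (x - y)))%:E)%E by rewrite lee_fin g_ge0// enorm_ge0.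
  apply: (@le_trans _ _ (\int[PL]_y ((u x * C)%:E * (g (enorm (x - y)))%:E))%E).
    apply: plane_le.
    + by move=> y; exact: (I0 (x, y)).
    + by apply: (measurableT_comp mI (_ : measurable_fun setT (fun y : plane R => (x, y)))); mfun.
    + by mfun.
    + move=> y; rewrite -EFinM lee_fin mulrAC ler_wpM2r ?ler_wpM2l//.
      by rewrite g_ge0// enorm_ge0.
  rewrite plane_mull ?lee_fin ?mulr_ge0//.
  have mgz : measurable_fun setT (fun z : plane R => (g (enorm z))%:E).
    by apply: mf_EFin; exact: measurable_kernel.
  have g0 z : (0 <= (g (enorm z))%:E)%E by rewrite lee_fin g_ge0// enorm_ge0.
  have hr := plane_reflect x mgz g0.
  apply: (@le_trans _ _ ((u x * C)%:E * S%:E)%E).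
    apply: lee_wpmul2l; first by rewrite lee_fin mulr_ge0.
    by apply: le_trans iS; rewrite hr.
  by rewrite -!EFinM lee_fin; nra.
Qed.

End cell_sums.

End cells.

Section cell_masses.
Context (R : realType).
Local Notation PL := (plane_measure R).
Local Notation L := (@lebesgue_measure R).

Lemma plane_product_scale (h k : R -> R) (n c e I J : R) : 0 < n ->
  measurable_fun setT h -> measurable_fun setT k ->
  (forall x, 0 <= h x) -> (forall x, 0 <= k x) ->
  (\int[L]_x (h x)%:E = I%:E)%E -> (\int[L]_x (k x)%:E = J%:E)%E ->
  (\int[PL]_x (h (n * x.1 + c) * k (n * x.2 + e))%:E = (n ^- 2 * (I * J))%:E)%E.
Proof.
move=> n0 mh mk h0 k0 hI kJ.
have scale (q : R -> R) (s Q : R) : measurable_fun setT q -> (forall x, 0 <= q x) ->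
    (\int[L]_x (q x)%:E = Q%:E)%E -> (\int[L]_x (q (n * x + s))%:E = (n^-1 * Q)%:E)%E.
  move=> mq q0 qQ.
  have n1 : n != 0 by rewrite gt_eqF.
  have mqe : measurable_fun setT (fun x => (q x)%:E) by apply: mf_EFin.
  have := @ge0_integral_affine R n s _ n1 mqe (fun x => q0 x).
  rewrite qQ gtr0_norm// => e1.
  have e2 : ((n^-1)%:E * (n%:E * \int[L]_x (q (n * x + s)%R)%:E) = (n^-1 * Q)%:E)%E.
    by rewrite -e1 EFinM.
  by rewrite -e2 muleA -EFinM mulVf// mul1e.
have maff (q : R -> R) (s : R) : measurable_fun setT q ->
    measurable_fun setT (fun x : R => q (n * x + s)).
  by move=> mq; apply: (measurableT_comp mq); mfun.
have m1 := maff h c mh; have m2 := maff k e mk.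
rewrite plane_integral; last 2 first.
- apply: mf_EFin; apply: mf_mul.
    by apply: (measurableT_comp m1); mfun.
  by apply: (measurableT_comp m2); mfun.
- by move=> x; rewrite lee_fin mulr_ge0.
transitivity (\int[L]_x ((n^-1 * J)%:E * (h (n * x + c))%:E))%E.
  apply: eq_integral => x _; rewrite /= -(scale k e J mk k0 kJ) muleC -leb_mull//.
  - by move=> y; rewrite lee_fin.
  - exact: mf_EFin.
have nJ : 0 <= n^-1 * J.
  by rewrite -lee_fin -(scale k e J mk k0 kJ); apply: integral_ge0 => y _; rewrite lee_fin.
rewrite leb_mull//; last 2 first.
- by move=> y; rewrite lee_fin.
- exact: mf_EFin.
rewrite (scale h c I mh h0 hI) -EFinM; congr EFin.
by rewrite -exprVn; ring.
Qed.

Lemma measurable_cell i : measurable_fun setT (fun t : R => cell t i).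
Proof. by rewrite /cell; mfun. Qed.

Lemma integral_cell i : (\int[L]_t (cell t i)%:E = 1%:E)%E.
Proof.
transitivity (\int[L]_(t in `[i%:R, i.+1%:R[) 1%:E)%E.
  rewrite [RHS]integral_mkcond; apply: eq_integral => x _.
  by rewrite patchE mem_setE in_itv/= /cell; case: ifP.
rewrite integral_cst//= lebesgue_measure_itv/= lte_fin mul1e ltr_nat ltnSn.
by rewrite -EFinD -natrB ?subSnn.
Qed.

Lemma integral_bump_pow p : exists2 c : R, 0 < c &
  (\int[L]_t (bump t ^+ p.+1)%:E = c%:E)%E.
Proof.
have mb : measurable_fun setT (fun t : R => bump t ^+ p.+1).
  by apply: mf_exp; apply: continuous_measurable_fun; exact: bump_continuous.
have bp0 (t : R) : 0 <= bump t ^+ p.+1 by rewrite exprn_ge0 ?bump_ge0.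
have b1 : (\int[L]_t (bump t ^+ p.+1)%:E <= 1%:E)%E.
  rewrite -(integral_cell 0); apply: leb_le.
  - by move=> x; rewrite lee_fin.
  - exact: mf_EFin.
  - by apply: mf_EFin; exact: measurable_cell.
  - move=> x; rewrite lee_fin /cell; case: ifPn => [_|nx].
      by rewrite exprn_ile1 ?bump_ge0 ?bump_le1.
    rewrite bump_out ?expr0n//; apply: contra nx => /andP[x0 x1].
    by rewrite ltW.
pose k : R := expR (-4) * expR (-4).
have k0 : 0 < k by rewrite mulr_gt0 ?expR_gt0.
have b2 : ((k ^+ p.+1 * 2^-1)%:E <= \int[L]_t (bump t ^+ p.+1)%:E)%E.
  have -> : (k ^+ p.+1 * 2^-1)%:E =
      (\int[L]_x (if (4^-1 < x)%R && (x <= 3 / 4)%R then k ^+ p.+1 else 0%R)%:E)%E.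
    rewrite integral_ocitv_cst; [congr EFin; congr (_ * _); lra|lra|].
    by rewrite exprn_ge0// ltW.
  apply: leb_le.
  - by move=> x; rewrite lee_fin; case: ifP => // _; rewrite exprn_ge0// ltW.
  - by apply: mf_EFin; mfun.
  - exact: mf_EFin.
  - move=> x; rewrite lee_fin; case: ifP => [/andP[x1 x2]|_]; last exact: bp0.
    have ex (y : R) : 4^-1 <= y -> expR (-4) <= flat 0 y.
      move=> y4; have y0 : 0 < y by apply: lt_le_trans y4; rewrite invr_gt0.
      rewrite /flat y0 expr0 mul1r ler_expR lerN2 -[leRHS]invrK lef_pV2//.
      by rewrite posrE invr_gt0.
    rewrite lerXn2r ?nnegrE ?bump_ge0 ?(ltW k0)//.
    by rewrite /k ler_pM ?expR_ge0// ex//; lra.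
have fb : (\int[L]_t (bump t ^+ p.+1)%:E \is a fin_num)%E.
  rewrite ge0_fin_numE; first by apply: le_lt_trans b1 _; rewrite ltry.
  by apply: integral_ge0 => x _; rewrite lee_fin.
exists (fine (\int[L]_t (bump t ^+ p.+1)%:E)%E); last by rewrite fineK.
rewrite -lte_fin fineK//; apply: lt_le_trans b2.
by rewrite lte_fin mulr_gt0 ?invr_gt0// exprn_gt0.
Qed.

Lemma integral_bump : exists2 c : R, 0 < c & (\int[L]_t (bump t)%:E = c%:E)%E.
Proof.
by have [c c0 cE] := integral_bump_pow 0; exists c.
Qed.

End cell_masses.

Section cell_smoothing.
Context (R : realType) (N n : nat) (c0 : R).
Hypothesis n_gt0 : (0 < n)%N.
Hypothesis c0_gt0 : 0 < c0.
Local Notation PL := (plane_measure R).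
Hypothesis c0E : (\int[@lebesgue_measure R]_t (bump t)%:E = c0%:E)%E.
Let I : finType := ('I_(2 * N * n) * 'I_(2 * N * n))%type.

Definition in_box (x : plane R) := (- N%:R <= x.1 < N%:R) && (- N%:R <= x.2 < N%:R).
Let co (t : R) := n%:R * t + n%:R * N%:R.
Let cell2 (p : I) (x : plane R) : R := cell (co x.1) p.1 * cell (co x.2) p.2.
Let part (u : plane R -> R) (p : I) (x : plane R) := u x * cell2 p x.
Let mass (u : plane R -> R) (p : I) : R := fine (\int[PL]_x (part u p x)%:E)%E.
Let corner (p : I) : plane R := (p.1%:R / n%:R - N%:R, p.2%:R / n%:R - N%:R).
Let bumpc (p : I) : plane R -> R :=
  cell_bump n%:R (p.1%:R - n%:R * N%:R) (p.2%:R - n%:R * N%:R).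
Let coef (u : plane R -> R) (p : I) : R := mass u p * (n%:R ^+ 2 / (c0 * c0)).

(** The mass of [u] in each cell is spread by the bump of this cell; the constant
    [n^2 / c0^2] normalises the bump. *)
Definition smoothing (u : plane R -> R) (x : plane R) : R :=
  \sum_p coef u p * bumpc p x.

Definition boxed (C : R) (u : plane R -> R) :=
  [/\ nnmeas u, forall x, u x <= C & forall x, u x != 0 -> in_box x].

Let nR : 0 < n%:R :> R. Proof. by rewrite ltr0n. Qed.

Let mcell2 p : measurable_fun setT (cell2 p).
Proof.
rewrite /cell2 /co; apply: mf_mul.
  by apply: (measurableT_comp (measurable_cell p.1)); mfun.
by apply: (measurableT_comp (measurable_cell p.2)); mfun.
Qed.

Let cell2_ge0 p x : 0 <= cell2 p x.
Proof. by rewrite mulr_ge0 ?cell_ge0. Qed.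

Let nn_part u p : nnmeas u -> nnmeas (part u p).
Proof. by move=> hu; apply: nnmeasM. Qed.

Let nn_bumpc p : nnmeas (bumpc p).
Proof.
split; last by move=> x; rewrite mulr_ge0 ?bump_ge0.
have mb : measurable_fun setT (@bump R).
  by apply: continuous_measurable_fun; exact: bump_continuous.
rewrite /bumpc /cell_bump; apply: mf_mul.
  by apply: (measurableT_comp mb); mfun.
by apply: (measurableT_comp mb); mfun.
Qed.

Let co_range t : - N%:R <= t < N%:R -> 0 <= co t < (2 * N * n)%:R.
Proof.
move=> /andP[t1 t2]; rewrite /co -mulrDr; apply/andP; split.
  by apply: mulr_ge0; [exact: ltW|lra].
by rewrite natrM mulrC ltr_pM2r// natrM; lra.
Qed.

Let sum_cell2 x : in_box x -> \sum_p cell2 p x = 1.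
Proof. by move=> /andP[h1 h2]; apply: cell_partition2; exact: co_range. Qed.

Let sum_part C u x : boxed C u -> \sum_p part u p x = u x.
Proof.
move=> [_ _ ub]; rewrite -mulr_sumr; have [->|ux] := eqVneq (u x) 0; first by rewrite mul0r.
by rewrite (sum_cell2 (ub x ux)) mulr1.
Qed.

Let int_cell2 p : (\int[PL]_x (cell2 p x)%:E = (n%:R ^- 2)%:E)%E.
Proof.
have := plane_product_scale (n%:R * N%:R) (n%:R * N%:R) nR (measurable_cell p.1)
  (measurable_cell p.2) (fun x => cell_ge0 x p.1) (fun x => cell_ge0 x p.2)
  (integral_cell R p.1) (integral_cell R p.2).
by rewrite !mulr1.
Qed.

Let int_bumpc p : (\int[PL]_x (bumpc p x)%:E = (n%:R ^- 2 * (c0 * c0))%:E)%E.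
Proof.
have mb : measurable_fun setT (@bump R).
  by apply: continuous_measurable_fun; exact: bump_continuous.
exact: (plane_product_scale (- (p.1%:R - n%:R * N%:R)) (- (p.2%:R - n%:R * N%:R)) nR mb mb
  (@bump_ge0 R) (@bump_ge0 R) c0E c0E).
Qed.

Let massE C u p : boxed C u ->
  (\int[PL]_x (part u p x)%:E = (mass u p)%:E)%E /\ 0 <= mass u p <= C * n%:R ^- 2.
Proof.
move=> [hu uC _]; have [mu u0] := hu.
have C0 : 0 <= C by exact: le_trans (u0 0) (uC 0).
have [mp p0] := nn_part p hu.
have i0 : (0 <= \int[PL]_x (part u p x)%:E)%E.
  by apply: integral_ge0 => x _; rewrite lee_fin.
have iC : (\int[PL]_x (part u p x)%:E <= (C * n%:R ^- 2)%:E)%E.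
  have e := @plane_mull R C%:E (fun x => (cell2 p x)%:E) C0 (cell2_ge0 p) (mf_EFin (mcell2 p)).
  rewrite EFinM -(int_cell2 p) -e.
  apply: plane_le => //.
  - exact: mf_EFin.
  - by apply: mf_emul => //; exact: mf_EFin.
  - by move=> x; rewrite -EFinM lee_fin ler_wpM2r.
have fi : (\int[PL]_x (part u p x)%:E \is a fin_num)%E.
  by rewrite ge0_fin_numE//; apply: le_lt_trans iC _; rewrite ltry.
rewrite /mass fineK//; split=> //; rewrite fine_ge0//=.
by rewrite -lee_fin fineK.
Qed.

Let K := n%:R ^+ 2 / (c0 * c0) : R.
Let K0 : 0 <= K. Proof. by rewrite divr_ge0 ?exprn_ge0 ?mulr_ge0 ?ltW. Qed.

Let nn_term C u p : boxed C u -> nnmeas (fun x => coef u p * bumpc p x).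
Proof.
move=> hu; have [_ /andP[a0 _]] := massE p hu.
by apply: nnmeasZ => //; rewrite mulr_ge0.
Qed.

Let int_term C u p : boxed C u ->
  (\int[PL]_x (coef u p * bumpc p x)%:E = (mass u p)%:E)%E.
Proof.
move=> hu; have [_ /andP[a0 _]] := massE p hu; have [mb b0] := nn_bumpc p.
have e := @plane_mull R (coef u p)%:E (fun x => (bumpc p x)%:E) _ _ _.
rewrite (e _ _ _); last 3 first.
- by rewrite lee_fin mulr_ge0.
- by move=> x; rewrite lee_fin.
- exact: mf_EFin.
rewrite int_bumpc -EFinM; congr EFin; rewrite /coef.
have n1 : n%:R != 0 :> R by rewrite gt_eqF.
have c1 : c0 != 0 by rewrite gt_eqF.
by field; rewrite n1 c1.
Qed.

Lemma nn_smoothing C u : boxed C u -> nnmeas (smoothing u).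
Proof. by move=> hu; apply: nnmeas_sum => p; exact: nn_term hu. Qed.

Let bump_cell (t : R) (i : nat) : bump (t - i%:R) <= cell t i.
Proof.
rewrite /cell; case: ifPn => [_|h]; first exact: bump_le1.
rewrite bump_out//; apply: contra h => /andP[t1 t2].
by rewrite -[in X in _ && X]natr1; apply/andP; split; lra.
Qed.

Let bumpc_cell2 p x : bumpc p x <= cell2 p x.
Proof.
rewrite /bumpc /cell_bump /cell2 /co !opprB !addrA.
by rewrite ler_pM ?bump_ge0 ?bump_cell.
Qed.

Let cell2_box p x : cell2 p x != 0 -> in_box x.
Proof.
have h (t : R) (i : 'I_(2 * N * n)) : cell (co t) i != 0 -> - N%:R <= t < N%:R.
  rewrite /cell; case: ifP => [/andP[h1 h2] _|_]; last by rewrite eqxx.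
  have i0 : 0 <= i%:R :> R by rewrite ler0n.
  have i1 : i.+1%:R <= (2 * N * n)%:R :> R by rewrite ler_nat.
  have {}h1 : 0 <= n%:R * (t + N%:R) by rewrite mulrDr; exact: le_trans h1.
  have {}h2 : n%:R * (t + N%:R) < n%:R * (2 * N%:R).
    by rewrite mulrDr (lt_le_trans h2)// (le_trans i1)// natrM mulrC natrM.
  rewrite pmulr_rge0// in h1; rewrite ltr_pM2l// in h2.
  by apply/andP; split; lra.
by rewrite mulf_eq0 negb_or => /andP[h1 h2]; rewrite /in_box (h _ _ h1) (h _ _ h2).
Qed.

Let sum_cell2_le x : \sum_p cell2 p x <= 1.
Proof.
have [bx|bx] := boolP (in_box x); first by rewrite sum_cell2.
rewrite big1 // => p _; apply/eqP; apply/negPn; apply/negP => /cell2_box; exact/negP.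
Qed.

Lemma smoothing_le C u x : boxed C u -> smoothing u x <= C / (c0 * c0).
Proof.
move=> hu; have C0 : 0 <= C by case: hu => -[_ u0] uC _; exact: le_trans (u0 0) (uC 0).
have Cc : 0 <= C / (c0 * c0) by apply: divr_ge0 => //; apply: mulr_ge0; exact: ltW.
apply: (@le_trans _ _ (\sum_p C / (c0 * c0) * cell2 p x)); last first.
  by rewrite -mulr_sumr -[leRHS]mulr1 ler_wpM2l ?sum_cell2_le.
apply: ler_sum => p _; have [_ /andP[a0 aC]] := massE p hu; have [_ b0] := nn_bumpc p.
apply: ler_pM => //; first by rewrite mulr_ge0.
have -> : C / (c0 * c0) = (C * n%:R ^- 2) * K.
  have n1 : n%:R != 0 :> R by rewrite gt_eqF.
  have c1 : c0 != 0 by rewrite gt_eqF.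
  by rewrite /K; field; rewrite n1 c1.
by rewrite ler_wpM2r.
Qed.

Definition total_mass u := \sum_p mass u p.

Lemma integral_boxed C u : boxed C u -> (\int[PL]_x (u x)%:E = (total_mass u)%:E)%E.
Proof.
move=> hu; have [hn _ _] := hu.
transitivity (\int[PL]_x (\sum_p (part u p x)%:E))%E.
  by apply: eq_integral => x _; rewrite sumEFin (sum_part x hu).
rewrite ge0_integral_sum//; last 2 first.
- by move=> p; apply: mf_EFin; case: (nn_part p hn).
- by move=> p x _; rewrite lee_fin; case: (nn_part p hn).
by rewrite /total_mass -sumEFin; apply: eq_bigr => p _; have [] := massE p hu.
Qed.

Lemma integral_smoothing C u : boxed C u ->
  (\int[PL]_x (smoothing u x)%:E = (total_mass u)%:E)%E.
Proof.
move=> hu.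
transitivity (\int[PL]_x (\sum_p (coef u p * bumpc p x)%:E))%E.
  by apply: eq_integral => x _; rewrite sumEFin.
rewrite ge0_integral_sum//; last 2 first.
- by move=> p; apply: mf_EFin; case: (nn_term p hu).
- by move=> p x _; rewrite lee_fin; case: (nn_term p hu).
by rewrite /total_mass -sumEFin; apply: eq_bigr => p _; exact: int_term hu.
Qed.

Lemma total_mass_ge0 C u : boxed C u -> 0 <= total_mass u.
Proof. by move=> hu; apply: sumr_ge0 => p _; have [_ /andP[]] := massE p hu. Qed.

Lemma smoothing_combination C u : boxed C u -> exists2 a : I -> R,
  (forall p, 0 <= a p) &
  smoothing u = (fun x => \sum_p a p * cell_bump n%:R (p.1%:R - n%:R * N%:R)
    (p.2%:R - n%:R * N%:R) x).
Proof.
move=> hu; exists (coef u) => // p; have [_ /andP[a0 _]] := massE p hu.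
by rewrite mulr_ge0.
Qed.

Section compare.
Context (g : R -> R) (om : R).
Hypothesis g_ge0 : forall r : R, 0 <= r -> 0 <= g r.
Hypothesis g_cont : forall r : R, 0 < r -> {for r, continuous g}.
Hypothesis om_ge0 : 0 <= om.
Hypothesis g_osc : forall s t, 0 <= s <= 4 * N%:R -> `|s - t| <= 4 / n%:R -> `|g s - g t| <= om.

Let near_corner p x : cell2 p x != 0 -> enorm (x - corner p) <= 2 / n%:R.
Proof.
have h (t : R) (i : nat) : cell (co t) i != 0 -> `|t - (i%:R / n%:R - N%:R)| <= n%:R^-1.
  rewrite /cell; case: ifP => [/andP[h1 h2] _|_]; last by rewrite eqxx.
  have e : t - (i%:R / n%:R - N%:R) = (co t - i%:R) / n%:R.
    by have n1 : n%:R != 0 :> R; [rewrite gt_eqF|rewrite /co; field].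
  have e0 : 0 <= (co t - i%:R) / n%:R by rewrite divr_ge0 ?subr_ge0// ltW.
  rewrite e ger0_norm// -[leRHS]mul1r ler_pM2r ?invr_gt0//.
  by move: h2; rewrite -natr1; lra.
rewrite mulf_eq0 negb_or => /andP[h1 h2]; apply: le_trans (enorm_le_sum _) _.
rewrite mulr_natl mulr2n.
exact: (lerD (h _ _ h1) (h _ _ h2)).
Qed.

Let corner_box p : in_box (corner p).
Proof.
have h (i : 'I_(2 * N * n)) : - N%:R <= (i%:R / n%:R - N%:R : R) < N%:R.
  have i0 : 0 <= i%:R / n%:R :> R by rewrite divr_ge0 ?ler0n.
  have i1 : i%:R / n%:R < 2 * N%:R :> R.
    by rewrite ltr_pdivrMr// -!natrM ltr_nat.
  by apply/andP; split; lra.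
by rewrite /in_box !h.
Qed.

Let box_diam x y : in_box x -> in_box y -> enorm (x - y) <= 4 * N%:R.
Proof.
move=> /andP[/andP[a1 a2] /andP[a3 a4]] /andP[/andP[b1 b2] /andP[b3 b4]].
apply: le_trans (enorm_le_sum _) _.
have h (s t : R) : - N%:R <= s -> s < N%:R -> - N%:R <= t -> t < N%:R -> `|s - t| <= 2 * N%:R.
  by move=> *; rewrite ler_norml; apply/andP; split; lra.
by have := lerD (h _ _ a1 a2 b1 b2) (h _ _ a3 a4 b3 b4); rewrite /=; lra.
Qed.

Let s p q := g (enorm (corner p - corner q)).

Let osc p q x y : cell2 p x != 0 -> cell2 q y != 0 -> `|g (enorm (x - y)) - s p q| <= om.
Proof.
move=> hx hy; rewrite distrC; apply: g_osc; first by rewrite enorm_ge0 box_diam ?corner_box.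
apply: le_trans (enorm_lip _ _) _.
have -> : corner p - corner q - (x - y) = - (x - corner p) + (y - corner q).
  by rewrite !opprB [LHS]addrACA [RHS]addrACA; congr (_ + _); exact: addrC.
apply: le_trans (enorm_triangle _ _) _; rewrite enormN.
have := lerD (near_corner hx) (near_corner hy) => h; apply: le_trans h _.
by rewrite -mulrDl -(natrD _ 2 2).
Qed.

(** [u] and its smoothing have the same mass in each cell, and [pform_cells] applies to
    both, with the values of the kernel at the corners as the discrete kernel. *)
Lemma smoothing_compare C u v : boxed C u -> boxed C v ->
  (pform g u v <= pform g (smoothing u) (smoothing v) +
     (2 * om * total_mass u * total_mass v)%:E)%E /\
  (pform g (smoothing u) (smoothing v) <= pform g u v +
     (2 * om * total_mass u * total_mass v)%:E)%E.
Proof.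
move=> hu hv.
have nzl (a b : R) : a * b != 0 -> b != 0 by rewrite mulf_eq0 negb_or => /andP[].
have s0 p q : 0 <= s p q by apply: g_ge0; exact: enorm_ge0.
have bz p x : bumpc p x != 0 -> cell2 p x != 0.
  have [_ b0] := nn_bumpc p.
  move=> h; rewrite gt_eqF//; apply: lt_le_trans (bumpc_cell2 p x).
  by rewrite lt0r h b0.
have eu : (fun x => \sum_p part u p x) = u by apply/funext => x; exact: sum_part hu.
have ev : (fun x => \sum_p part v p x) = v by apply/funext => x; exact: sum_part hv.
have [hnu _ _] := hu; have [hnv _ _] := hv.
have [A1 A2] := pform_cells g_ge0 g_cont om_ge0 (fun p => nn_part p hnu)
  (fun p => nn_part p hnv) (fun p => (massE p hu).1) (fun p => (massE p hv).1) s0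
  (fun p q x y hx hy => osc (nzl _ _ hx) (nzl _ _ hy)).
have [B1 B2] := pform_cells g_ge0 g_cont om_ge0 (fun p => nn_term p hu)
  (fun p => nn_term p hv) (fun p => int_term p hu) (fun p => int_term p hv) s0
  (fun p q x y hx hy => osc (bz _ _ (nzl _ _ hx)) (bz _ _ (nzl _ _ hy))).
rewrite eu ev in A1 A2.
(* Each of the two forms is within T of the same discrete sum S. *)
have key (x y : \bar R) (S T : R) : (x <= (S + T)%:E)%E -> ((S - T)%:E <= y)%E ->
    (x <= y + (2 * T)%:E)%E.
  move=> h1 h2; apply: le_trans h1 _; have -> : S + T = (S - T) + 2 * T by ring.
  by rewrite EFinD leeD2r.
have -> : 2 * om * total_mass u * total_mass v = 2 * (om * total_mass u * total_mass v).
  by ring.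
split; first exact: key A1 B2.
exact: key B1 A2.
Qed.

End compare.

End cell_smoothing.

(** * Positive definiteness of the covariance form *)

Section cutoff.
Context (R : realType) (f : R -> R).
Hypothesis f_ge0 : forall r : R, 0 <= r -> 0 <= f r.
Hypothesis f_cont : forall r : R, 0 < r -> {for r, continuous f}.

Definition ramp (k r : R) : R := Num.max 0 (Num.min 1 (r / k - 1)).

Lemma ramp01 k r : 0 <= ramp k r <= 1.
Proof. by rewrite /ramp le_max lexx /= ge_max ler01 ge_min lexx. Qed.

Lemma ramp_continuous k : continuous (ramp k).
Proof.
move=> x; have h0 : {for x, continuous (fun _ : R => 0 : R^o)} by exact: cvg_cst.
have h1 : {for x, continuous (fun _ : R => 1 : R^o)} by exact: cvg_cst.
have h2 : {for x, continuous (fun r : R => r / k - 1 : R^o)}.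
  by apply: cvgB; [apply: cvgMl; exact: cvg_id|exact: cvg_cst].
exact: (continuous_max h0 (continuous_min h1 h2)).
Qed.

Lemma ramp_eq0 k r : 0 < k -> r <= k -> ramp k r = 0.
Proof.
move=> k0 rk; apply: max_l; rewrite ge_min; apply/orP; right.
by rewrite subr_le0 ler_pdivrMr// mul1r.
Qed.

Lemma ramp_eq1 k r : 0 < k -> 2 * k <= r -> ramp k r = 1.
Proof.
move=> k0 rk; rewrite /ramp min_l; first by rewrite max_r.
by rewrite lerBrDr ler_pdivlMr.
Qed.

Lemma ramped_continuous k : 0 < k -> continuous (fun r => f r * ramp k r).
Proof.
move=> k0 x; have [xk|kx] := ltP x k.
  rewrite /continuous_at ramp_eq0 ?(ltW xk)// mulr0; apply: cvg_near_cst.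
  near=> y; rewrite ramp_eq0 ?mulr0//; apply: ltW; near: y.
  exact: lt_nbhsl.
by apply: cvgM; [exact: (f_cont (lt_le_trans k0 kx))|exact: ramp_continuous].
Unshelve. all: by end_near. Qed.

End cutoff.

Section positive_definite.
Context (R : realType) (f : R -> R).
Hypothesis f_ge0 : forall r : R, 0 <= r -> 0 <= f r.
Hypothesis f_cont : forall r : R, 0 < r -> {for r, continuous f}.
Local Notation PL := (plane_measure R).

Definition locally_small := forall e : R, 0 < e -> exists2 k : R, 0 < k &
  (\int[PL]_z (if enorm z <= k then f (enorm z) else 0)%:E <= e%:E)%E.

(** The inequality [K(U - V, U - V) >= 0], written without subtraction so that it makes
    sense for the form of nonnegative functions with values in the extended reals. *)
Definition positive_on_bumps := forall (I : finType) (n : R) (e : I -> plane R) (a b : I -> R),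
  0 < n -> (forall i, 0 <= a i) -> (forall i, 0 <= b i) ->
  let U x := \sum_i a i * cell_bump n (e i).1 (e i).2 x in
  let V x := \sum_i b i * cell_bump n (e i).1 (e i).2 x in
  (2%:E * pform f U V <= pform f U U + pform f V V)%E.

Hypothesis f_small : locally_small.
Hypothesis f_pos : positive_on_bumps.

(** A continuous cutoff near 0 leaves a kernel continuous on the whole line; the part
    removed lives in a small disc. *)
Lemma short_range_split (S : R) : 0 < S -> exists f1 f2 : R -> R,
  [/\ forall r, 0 <= r -> 0 <= f1 r, forall r, 0 < r -> {for r, continuous f1},
      (\int[PL]_z (f1 (enorm z))%:E <= S%:E)%E,
      (forall r, 0 <= r -> 0 <= f2 r) /\ continuous f2 &
      forall r, f r = f1 r + f2 r].
Proof.
move=> S0; have [k k0 hk] := f_small S0.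
have h0 : 0 < k / 2 by rewrite divr_gt0.
have c2 := ramped_continuous f_cont h0.
have c1 : forall r, 0 < r -> {for r, continuous (fun r => f r - f r * ramp (k / 2) r)}.
  by move=> r r0; apply: cvgB; [exact: f_cont|exact: c2].
have p1 r : 0 <= r -> 0 <= f r - f r * ramp (k / 2) r.
  move=> r0; rewrite -[X in X - _]mulr1 -mulrBr mulr_ge0 ?f_ge0// subr_ge0.
  by have /andP[] := ramp01 (k / 2) r.
exists (fun r => f r - f r * ramp (k / 2) r), (fun r => f r * ramp (k / 2) r); split=> //.
- apply: le_trans hk; apply: plane_le.
  + by move=> z; rewrite lee_fin p1// enorm_ge0.
  + by apply: mf_EFin; exact: (measurable_kernel c1).
  + apply: mf_EFin; apply: mf_if; [|exact: (measurable_kernel f_cont)|by mfun].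
    by apply: mf_ler; [apply: mf_enorm|]; mfun.
  + move=> z; rewrite lee_fin; case: ifPn => [_|].
      rewrite lerBlDr lerDl mulr_ge0 ?f_ge0 ?enorm_ge0//.
      by have /andP[] := ramp01 (k / 2) (enorm z).
    rewrite -ltNge => zk; rewrite ramp_eq1 ?mulr1 ?subrr//.
    by rewrite mulrC divfK// ltW.
- split=> // r r0; rewrite mulr_ge0 ?f_ge0//.
  by have /andP[] := ramp01 (k / 2) r.
- by move=> r; rewrite subrK.
Qed.

(** Replace [u] and [v] by their smoothings [U] and [V], for which the inequality is
    known.  For the continuous part [f2] of the kernel, uniform continuity makes the
    cost small as the cells shrink; for the part [f1] of small mass,
    [pform_mass_bound] applies, uniformly in the size of the cells because
    smoothing preserves masses and multiplies the bound [C] by a constant. *)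
Lemma pform_cs_boxed (N : nat) (C : R) (u v : plane R -> R) :
  boxed N C u -> boxed N C v ->
  (2%:E * pform f u v <= pform f u u + pform f v v)%E.
Proof.
move=> hu hv; have [hnu uC _] := hu; have [hnv vC _] := hv.
have [c0 c0_gt0 c0E] := @integral_bump R.
pose A : R := total_mass N 1 u; pose B : R := total_mass N 1 v.
have uA : (\int[PL]_x (u x)%:E = A%:E)%E by apply: integral_boxed hu.
have vB : (\int[PL]_x (v x)%:E = B%:E)%E by apply: integral_boxed hv.
have A0 : 0 <= A by apply: total_mass_ge0 hu.
have B0 : 0 <= B by apply: total_mass_ge0 hv.
have C0 : 0 <= C by case: hnu => _ u0; exact: le_trans (u0 0) (uC 0).
clearbody A B.
have [C' C'E] : exists C' : R, C' = C / (c0 * c0) by exists (C / (c0 * c0)).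
have C'0 : 0 <= C' by rewrite C'E; apply: divr_ge0 => //; apply: mulr_ge0; exact: ltW.
apply/lee_addgt0Pr => eps eps0.
(* Q and Q' collect the coefficients of S and om in the final estimate. *)
pose Q := 2 * (A * C) + (A + B) * C'.
pose Q' := 4 * A * B + 2 * A * A + 2 * B * B.
have Q0 : 0 <= Q by rewrite /Q addr_ge0 ?mulr_ge0 ?addr_ge0.
have Q'0 : 0 <= Q' by rewrite /Q' !addr_ge0 ?mulr_ge0.
pose S := eps / 2 / (Q + 1); pose om := eps / 2 / (Q' + 1).
have S0 : 0 < S by rewrite !divr_gt0// ltr_pwDr.
have om0 : 0 < om by rewrite !divr_gt0// ltr_pwDr.
have SQ : S * Q <= eps / 2.
  rewrite /S mulrAC -mulrA ler_piMr ?divr_ge0 ?(ltW eps0)//.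
  by rewrite ler_pdivrMr ?ltr_pwDr// mul1r lerDl.
have omQ : om * Q' <= eps / 2.
  rewrite /om mulrAC -mulrA ler_piMr ?divr_ge0 ?(ltW eps0)//.
  by rewrite ler_pdivrMr ?ltr_pwDr// mul1r lerDl.
clearbody S om.
have [f1 [f2 [p1 cc1 sm [p2 cc2] fE]]] := short_range_split S0.
have cc2' : forall r, 0 < r -> {for r, continuous f2} by move=> r _; exact: cc2.
have [dl dl0 hdl] := uniform_on_segment (4 * N%:R) cc2 om0.
pose n := (Num.truncn (4 / dl)).+1.
have n0 : (0 < n)%N by [].
have ndl : 4 / n%:R < dl.
  rewrite ltr_pdivrMr ?ltr0n// mulrC -ltr_pdivrMr//.
  exact: truncnS_gt.
have osc : forall s t, 0 <= s <= 4 * N%:R -> `|s - t| <= 4 / n%:R -> `|f2 s - f2 t| <= om.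
  by move=> s t hs st; apply: ltW; apply: hdl => //; exact: le_lt_trans st ndl.
pose U := smoothing N n c0 u; pose V := smoothing N n c0 v.
have hnU : nnmeas U by apply: nn_smoothing hu.
have hnV : nnmeas V by apply: nn_smoothing hv.
have UC x : U x <= C' by rewrite C'E; apply: smoothing_le hu.
have VC x : V x <= C' by rewrite C'E; apply: smoothing_le hv.
have mA : total_mass N n u = A.
  by apply: EFin_inj; rewrite -uA; apply/esym; apply: integral_boxed hu.
have mB : total_mass N n v = B.
  by apply: EFin_inj; rewrite -vB; apply/esym; apply: integral_boxed hv.
have UA : (\int[PL]_x (U x)%:E = A%:E)%E.
  by rewrite -mA; apply: integral_smoothing hu.
have VB : (\int[PL]_x (V x)%:E = B%:E)%E.
  by rewrite -mB; apply: integral_smoothing hv.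
have cmp := fun u v hu hv => smoothing_compare n0 c0_gt0 c0E p2 cc2' (ltW om0) osc (C := C) (u := u) (v := v) hu hv.
have [cuv _] := cmp u v hu hv.
have [_ cuu] := cmp u u hu hu.
have [_ cvv] := cmp v v hv hv.
rewrite mA mB -/U -/V in cuv cuu cvv.
have split_f w z : nnmeas w -> nnmeas z -> pform f w z = (pform f1 w z + pform f2 w z)%E.
  by move=> hw hz; apply: pform_kernelD.
have ge01 w z : nnmeas w -> nnmeas z -> (0 <= pform f1 w z)%E.
  by move=> hw hz; apply: pform_ge0.
have ge02 w z : nnmeas w -> nnmeas z -> (0 <= pform f2 w z)%E.
  by move=> hw hz; apply: pform_ge0.
have b1 : (pform f1 u v <= (A * (S * C))%:E)%E by apply: pform_mass_bound.
have b2 : (pform f1 U U <= (A * (S * C'))%:E)%E by apply: pform_mass_bound.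
have b3 : (pform f1 V V <= (B * (S * C'))%:E)%E by apply: pform_mass_bound.
have [a a0 aE] := smoothing_combination n0 c0_gt0 hu.
have [b b0 bE] := smoothing_combination n0 c0_gt0 hv.
have nR : 0 < n%:R :> R by rewrite ltr0n.
have gr := @f_pos ('I_(2 * N * n) * 'I_(2 * N * n))%type n%:R
   (fun p => (p.1%:R - n%:R * N%:R, p.2%:R - n%:R * N%:R)) a b nR a0 b0.
rewrite /= in gr.
have {}gr : (2%:E * pform f U V <= pform f U U + pform f V V)%E.
  by rewrite /U /V aE bE; exact: gr.
clearbody U V; clear aE bE.
have comb (x1 x2 y1 y2 : \bar R) (r q : R) : (0 <= y1)%E -> (x1 <= r%:E)%E ->
    (x2 <= y2 + q%:E)%E -> (x1 + x2 <= (r + q)%:E + (y1 + y2))%E.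
  move=> y0 h1 h2; rewrite EFinD -addeA; apply: leeD h1 _; apply: le_trans h2 _.
  by rewrite [leLHS]addeC; apply: leeD2l; rewrite leeDr.
have h1 : (pform f u v <= (A * (S * C) + 2 * om * A * B)%:E + pform f U V)%E.
  by rewrite (split_f _ _ hnu hnv) (split_f _ _ hnU hnV); exact: comb (ge01 _ _ hnU hnV) b1 cuv.
have hU : (pform f U U <= (A * (S * C') + 2 * om * A * A)%:E + pform f u u)%E.
  by rewrite (split_f _ _ hnu hnu) (split_f _ _ hnU hnU); exact: comb (ge01 _ _ hnu hnu) b2 cuu.
have hV : (pform f V V <= (B * (S * C') + 2 * om * B * B)%:E + pform f v v)%E.
  by rewrite (split_f _ _ hnv hnv) (split_f _ _ hnV hnV); exact: comb (ge01 _ _ hnv hnv) b3 cvv.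
have pUV0 : (0 <= pform f U V)%E by exact: (pform_ge0 f_ge0 hnU hnV).
apply: (@le_trans _ _ (2%:E * ((A * (S * C) + 2 * om * A * B)%:E + pform f U V))%E).
  have t0 : (0 <= 2%:E :> \bar R)%E by rewrite lee_fin.
  exact: (lee_wpmul2l t0 h1).
have k0 : (0 <= (A * (S * C) + 2 * om * A * B)%:E)%E.
  rewrite lee_fin; have [SS oo] := (ltW S0, ltW om0).
  by rewrite addr_ge0 ?mulr_ge0.
rewrite (ge0_muleDr 2%:E k0 pUV0).
apply: le_trans (leeD2l _ gr) _.
apply: le_trans (leeD2l _ (leeD hU hV)) _.
rewrite [X in (_ + X <= _)%E]addeACA -EFinM addeA -!EFinD [leLHS]addeC; apply: leeD2l; rewrite lee_fin.
have -> : eps = eps / 2 + eps / 2 by rewrite -splitr.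
apply: le_trans (lerD SQ omQ); rewrite /Q /Q'.
by rewrite le_eqVlt; apply/orP; left; apply/eqP; ring.
Qed.

End positive_definite.

Section cauchy_schwarz.
Context (R : realType) (f : R -> R).
Hypothesis f_ge0 : forall r : R, (0 <= r)%R -> (0 <= f r)%R.
Hypothesis f_cont : forall r : R, (0 < r)%R -> {for r, continuous f}.
Hypothesis f_small : locally_small f.
Hypothesis f_pos : positive_on_bumps f.
Local Notation PL := (plane_measure R).
Local Open Scope ereal_scope.

Let trunc (k : nat) (u : plane R -> R) (x : plane R) : R :=
  (if in_box k x then Num.min (u x) k%:R else 0)%R.

Let boxed_trunc k u : nnmeas u -> boxed k k%:R (trunc k u).
Proof.
move=> [mu u0]; split; [split| |].
- rewrite /trunc /in_box; mfun.
- by move=> x; rewrite /trunc; case: ifP => // _; rewrite le_min u0 ler0n.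
- by move=> x; rewrite /trunc; case: ifP => // _; rewrite ge_min lexx orbT.
- by move=> x; rewrite /trunc; case: ifP => //; rewrite eqxx.
Qed.

Let in_boxS k l (x : plane R) : (k <= l)%N -> in_box k x -> in_box l x.
Proof.
move=> kl; have kl' : (k%:R <= l%:R :> R)%R by rewrite ler_nat.
move=> /andP[/andP[a1 a2] /andP[b1 b2]]; rewrite /in_box.
have h (t : R) : (- k%:R <= t -> t < k%:R -> (- l%:R <= t) && (t < l%:R))%R.
  by move=> h1 h2; apply/andP; split; lra.
by rewrite (h _ a1 a2) (h _ b1 b2).
Qed.

Let trunc_mono k l u x : nnmeas u -> (k <= l)%N -> (trunc k u x <= trunc l u x)%R.
Proof.
move=> [_ u0] kl; have kl' : (k%:R <= l%:R :> R)%R by rewrite ler_nat.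
rewrite /trunc; case: ifPn => [bk|_].
  rewrite (in_boxS kl bk) le_min !ge_min lexx/=; apply/orP; right; exact: kl'.
by case: ifP => // _; rewrite le_min u0 ler0n.
Qed.

Let trunc_le k u x : nnmeas u -> (trunc k u x <= u x)%R.
Proof. by move=> [_ u0]; rewrite /trunc; case: ifP => // _; rewrite ge_min lexx. Qed.

Let trunc_eq u x : exists k, forall l, (k <= l)%N -> trunc l u x = u x.
Proof.
exists (Num.truncn (`|u x| + `|x.1| + `|x.2|)%R).+1 => l kl.
have hl : (`|u x| + `|x.1| + `|x.2| < l%:R :> R)%R.
  by apply: lt_le_trans (truncnS_gt _) _; rewrite ler_nat.
have h1 : (`|x.1| < l%:R)%R.
  by apply: le_lt_trans hl; rewrite -addrA addrCA lerDl addr_ge0.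
have h2 : (`|x.2| < l%:R)%R by apply: le_lt_trans hl; rewrite lerDr addr_ge0.
have h3 : (`|u x| < l%:R)%R by apply: le_lt_trans hl; rewrite -addrA lerDl addr_ge0.
move: h1 h2; rewrite !ltr_norml => /andP[/ltW a1 a2] /andP[/ltW b1 b2].
rewrite /trunc /in_box a1 a2 b1 b2 /= min_l//.
by apply: ltW; apply: le_lt_trans (ler_norm _) h3.
Qed.

(** Truncations of [u] and [v] increase to [u] and [v], and are bounded with bounded
    support. *)
Lemma pform_cauchy_schwarz (u v : plane R -> R) : nnmeas u -> nnmeas v ->
  2%:E * pform f u v <= pform f u u + pform f v v.
Proof.
move=> hu hv; set B := pform f u u + pform f v v.
have tr k : pform f (trunc k u) (trunc k v) <= 2^-1%:E * B.
  have hb := boxed_trunc k hu; have hc := boxed_trunc k hv.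
  have [nb _ _] := hb; have [nc _ _] := hc.
  rewrite lee_pdivlMl; last by [].
  apply: le_trans (pform_cs_boxed f_ge0 f_cont f_small f_pos hb hc) _.
  apply: leeD; apply: (pform_le f_ge0 f_cont) => // x; exact: trunc_le.
rewrite -[leRHS]mul1e -[1](_ : 2%:E * 2^-1%:E = 1); last by rewrite -EFinM divff.
rewrite -muleA; apply: lee_wpmul2l; first by rewrite lee_fin.
have mI (w z : plane R -> R) : nnmeas w -> nnmeas z ->
    measurable_fun setT (fun p : plane R * plane R =>
      (w p.1 * f (enorm (p.1 - p.2)%R) * z p.2)%:E).
  by move=> [mw _] [mz _]; exact: measurable_pform_integrand.
have I0 (w z : plane R -> R) : nnmeas w -> nnmeas z -> forall p : plane R * plane R,
    0 <= (w p.1 * f (enorm (p.1 - p.2)%R) * z p.2)%:E.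
  by move=> [_ w0] [_ z0] p; rewrite lee_fin !mulr_ge0// f_ge0// enorm_ge0.
have nt w k : nnmeas w -> nnmeas (trunc k w) by move=> hw; have [] := boxed_trunc k hw.
have pI (w z : plane R -> R) : nnmeas w -> nnmeas z -> pform f w z =
    \int[PL \x PL]_p (w p.1 * f (enorm (p.1 - p.2)%R) * z p.2)%:E.
  by move=> hw hz; rewrite (planes_integral (mI _ _ hw hz) (I0 _ _ hw hz)).
rewrite (pI _ _ hu hv).
apply: (@integral_le_exhaust _ ((measurableTypeR R * measurableTypeR R) *
    (measurableTypeR R * measurableTypeR R))%type R (product_measure1 (plane_sf R) (plane_sf R))
  (fun k (p : plane R * plane R) =>
      (trunc k u p.1 * f (enorm (p.1 - p.2)%R) * trunc k v p.2)%:E)).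
- by move=> k; apply: mI; exact: nt.
- exact: mI.
- by move=> k; apply: I0; exact: nt.
- exact: I0.
- move=> k p; rewrite lee_fin.
  have [_ u0] := nt u k hu; have [_ v0] := nt v k hv.
  have g0 : (0 <= f (enorm (p.1 - p.2)))%R by rewrite f_ge0// enorm_ge0.
  by rewrite ler_pM ?mulr_ge0 ?ler_wpM2r// trunc_mono.
- move=> p; have [k1 h1] := trunc_eq u p.1; have [k2 h2] := trunc_eq v p.2.
  by exists (maxn k1 k2); rewrite h1 ?leq_maxl// h2 ?leq_maxr.
- by move=> k; rewrite -pI; [exact: tr|exact: nt|exact: nt].
Qed.

Lemma pform_quasi_triangle (u v : plane R -> R) : nnmeas u -> nnmeas v ->
  pform f (fun x => u x + v x)%R (fun x => u x + v x)%R <=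
    2%:E * pform f u u + 2%:E * pform f v v.
Proof.
move=> hu hv; have huv := nnmeasD hu hv.
rewrite (pformDl f_ge0 f_cont hu hv huv).
rewrite (pform_sym f_ge0 f_cont hu huv) (pform_sym f_ge0 f_cont hv huv).
rewrite (pformDl f_ge0 f_cont hu hv hu) (pformDl f_ge0 f_cont hu hv hv).
rewrite (pform_sym f_ge0 f_cont hv hu); move: (pform_cauchy_schwarz hu hv).
move: (pform f u u) (pform f v v) (pform f u v) => a b c; rewrite !mule_natl !mule2n => h.
by rewrite (addeC c b) addeACA; apply: le_trans (leeD2l _ h) _; rewrite addeACA.
Qed.

End cauchy_schwarz.

(** * The dominating norm on space-time *)

Section covariance_norm.
Context (R : realType) (f : R -> R).
Hypothesis f_ge0 : forall r : R, (0 <= r)%R -> (0 <= f r)%R.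
Hypothesis f_cont : forall r : R, (0 < r)%R -> {for r, continuous f}.
Local Notation L := (@lebesgue_measure R).
Local Open Scope ereal_scope.
Implicit Types u v : spacetime R -> R.

Definition nnst u := measurable_fun setT u /\ forall z, (0 <= u z)%R.

Lemma nnst_slice u t : nnst u -> nnmeas (fun x => u (t, x)).
Proof.
by move=> [mu u0]; split=> // ; apply: (measurableT_comp mu); mfun.
Qed.

Lemma nnst_norm u : measurable_fun setT u -> nnst (fun z => `|u z|)%R.
Proof. by move=> mu; split; [mfun|move=> z; exact: normr_ge0]. Qed.

Lemma nnstD u v : nnst u -> nnst v -> nnst (fun z => u z + v z)%R.
Proof. by move=> [mu u0] [mv v0]; split; [mfun|move=> x; rewrite addr_ge0]. Qed.

Lemma nnstZ c u : (0 <= c)%R -> nnst u -> nnst (fun z => c * u z)%R.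
Proof. by move=> c0 [mu u0]; split; [mfun|move=> x; rewrite mulr_ge0]. Qed.

Let mP u v : nnst u -> nnst v -> measurable_fun (`[0%R, +oo[%classic : set R)
  (fun t => pform f (fun x => u (t, x)) (fun x => v (t, x))).
Proof.
move=> [mu u0] [mv v0]; apply: measurable_funTS.
exact: (measurable_pform f_ge0 f_cont mu mv u0 v0).
Qed.

Let P0 u v t : nnst u -> nnst v -> 0 <= pform f (fun x => u (t, x)) (fun x => v (t, x)).
Proof. by move=> hu hv; exact: (pform_ge0 f_ge0 (nnst_slice t hu) (nnst_slice t hv)). Qed.

Lemma cov_ge0 u v : nnst u -> nnst v -> 0 <= cov f u v.
Proof. by move=> hu hv; rewrite covE; apply: integral_ge0 => t _; exact: P0. Qed.

Lemma cov_le u v p q : nnst u -> nnst v -> nnst p -> nnst q ->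
  (forall z, u z <= p z)%R -> (forall z, v z <= q z)%R -> cov f u v <= cov f p q.
Proof.
move=> hu hv hp hq up vq; rewrite !covE; apply: ge0_le_integral.
- exact: measurable_itv.
- by move=> t _; exact: P0.
- exact: mP.
- exact: mP.
- move=> t _; apply: (pform_le f_ge0 f_cont (nnst_slice t hu) (nnst_slice t hv)
    (nnst_slice t hp) (nnst_slice t hq)) => x; [exact: up|exact: vq].
Qed.

Lemma covD u v p : nnst u -> nnst v -> nnst p ->
  cov f (fun z => u z + v z)%R p = cov f u p + cov f v p.
Proof.
move=> hu hv hp; rewrite !covE -ge0_integralD; last 5 first.
- exact: measurable_itv.
- by move=> t _; exact: P0.
- exact: mP.
- by move=> t _; exact: P0.
- exact: mP.
apply: eq_integral => t _.
exact: (pformDl f_ge0 f_cont (nnst_slice t hu) (nnst_slice t hv) (nnst_slice t hp)).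
Qed.

Lemma cov_sym u v : nnst u -> nnst v -> cov f u v = cov f v u.
Proof.
move=> hu hv; rewrite !covE; apply: eq_integral => t _.
exact: (pform_sym f_ge0 f_cont (nnst_slice t hu) (nnst_slice t hv)).
Qed.

Lemma covZ c u v : (0 <= c)%R -> nnst u -> nnst v ->
  cov f (fun z => c * u z)%R v = c%:E * cov f u v.
Proof.
move=> c0 hu hv; rewrite !covE -ge0_integralZl; last 4 first.
- exact: measurable_itv.
- exact: mP.
- by move=> t _; exact: P0.
- by rewrite lee_fin.
by apply: eq_integral => t _; exact: (pformZl f_ge0 f_cont c0 (nnst_slice t hu) (nnst_slice t hv)).
Qed.

Lemma covZ2 c u : (0 <= c)%R -> nnst u ->
  cov f (fun z => c * u z)%R (fun z => c * u z)%R = (c ^+ 2)%:E * cov f u u.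
Proof.
move=> c0 hu; have hcu := nnstZ c0 hu.
by rewrite (covZ c0 hu hcu) (cov_sym hu hcu) (covZ c0 hu hu) muleA -EFinM expr2.
Qed.

Hypothesis f_small : locally_small f.
Hypothesis f_pos : positive_on_bumps f.

Let scale2_sum (g h : R -> \bar R) :
  measurable_fun (`[0%R, +oo[%classic : set R) g -> (forall t, 0 <= g t) ->
  measurable_fun (`[0%R, +oo[%classic : set R) h -> (forall t, 0 <= h t) ->
  \int[L]_(t in `[0%R, +oo[) (2%:E * g t + 2%:E * h t) =
  2%:E * \int[L]_(t in `[0%R, +oo[) g t + 2%:E * \int[L]_(t in `[0%R, +oo[) h t.
Proof.
move=> mg g0 mh h0; have t0 : (0 <= 2%:E :> \bar R) by rewrite lee_fin.
rewrite ge0_integralD; last 5 first.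
- exact: measurable_itv.
- by move=> t _; apply: mule_ge0.
- by apply: mf_emul; [exact: measurable_cst|].
- by move=> t _; apply: mule_ge0.
- by apply: mf_emul; [exact: measurable_cst|].
by rewrite !ge0_integralZl//; exact: measurable_itv.
Qed.

Lemma cov_quasi_triangle u v : nnst u -> nnst v ->
  cov f (fun z => u z + v z)%R (fun z => u z + v z)%R <=
    2%:E * cov f u u + 2%:E * cov f v v.
Proof.
move=> hu hv; have huv := nnstD hu hv.
have t0 : (0 <= 2%:E :> \bar R) by rewrite lee_fin.
have e := scale2_sum (mP hu hu) (fun t => P0 t hu hu) (mP hv hv) (fun t => P0 t hv hv).
have e2 : 2%:E * cov f u u + 2%:E * cov f v v = _ := esym e.
rewrite e2 [X in X <= _]covE.
apply: ge0_le_integral.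
- exact: measurable_itv.
- by move=> t _; exact: (P0 t huv huv).
- exact: (mP huv huv).
- by apply: mf_eadd; apply: mf_emul; [exact: measurable_cst|exact: (mP hu hu)|exact: measurable_cst|exact: (mP hv hv)].
- move=> t _; exact: (pform_quasi_triangle f_ge0 f_cont f_small f_pos
    (nnst_slice t hu) (nnst_slice t hv)).
Qed.

Lemma dom_norm2_le u v : measurable_fun setT u -> nnst v -> (forall z, `|u z| <= v z)%R ->
  dom_norm2 f u <= cov f v v.
Proof. by move=> mu hv uv; apply: cov_le => //; exact: nnst_norm. Qed.

Lemma dom_norm2Z c u : measurable_fun setT u ->
  dom_norm2 f (fun z => c * u z)%R = (c ^+ 2)%:E * dom_norm2 f u.
Proof.
move=> mu; have hu := nnst_norm mu.
have -> : (c ^+ 2 = `|c| ^+ 2)%R by rewrite real_normK ?num_real.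
rewrite /dom_norm2 -(covZ2 (normr_ge0 c) hu).
have e : (fun z => `|c * u z|%R) = (fun z => `|c| * `|u z|)%R.
  by apply/funext => z; rewrite normrM.
by rewrite e.
Qed.

Lemma dom_norm2D u v : measurable_fun setT u -> measurable_fun setT v ->
  dom_norm2 f (fun z => u z + v z)%R <= 2%:E * dom_norm2 f u + 2%:E * dom_norm2 f v.
Proof.
move=> mu mv; have hu := nnst_norm mu; have hv := nnst_norm mv.
apply: le_trans (cov_quasi_triangle hu hv); apply: dom_norm2_le.
- exact: mf_add.
- exact: nnstD.
- by move=> z; exact: ler_normD.
Qed.

End covariance_norm.

(** * Local integrability of the kernel *)

Section local_integrability.
Context (R : realType) (f : R -> R) (alpha : R).
Hypothesis f_ge0 : forall r : R, (0 <= r)%R -> (0 <= f r)%R.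
Hypothesis f_cont : forall r : R, (0 < r)%R -> {for r, continuous f}.
Hypothesis a01 : (0 < alpha < 1)%R.
Local Notation L := (@lebesgue_measure R).
Local Notation PL := (plane_measure R).
Local Open Scope ereal_scope.

Lemma bounded_on_segment (a b : R) : (0 < a)%R -> exists2 C : R, (0 <= C)%R &
  forall r, (a <= r <= b)%R -> (f r <= C)%R.
Proof.
move=> a0; have [ab|ba] := leP a b; last first.
  by exists 0%R => // r /andP[ar rb]; have := le_trans ar rb; rewrite leNgt ba.
have fc : {within `[a, b], continuous f}.
  apply: continuous_in_subspaceT => r; rewrite inE/= in_itv/= => /andP[ar _].
  exact: f_cont (lt_le_trans a0 ar).
have [c cab hc] := EVT_max ab fc.
exists (f c); first by apply: f_ge0; move: cab; rewrite in_itv/= => /andP[/(le_trans (ltW a0))].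
by move=> r rab; apply: hc; rewrite in_itv.
Qed.

(** Near 0, [r^(1-3alpha/4) <= r^(1-alpha)] and the hypothesis applies; away from 0
    the integrand is bounded. *)
Lemma radial_finite (l : R) : (0 <= l)%R ->
  (exists2 delta : R, (0 < delta)%R &
     \int[L]_(r in `]0%R, delta[) (f r * r `^ (1 - alpha))%:E < +oo) ->
  \int[L]_r radial f (3 * alpha / 4) l r < +oo.
Proof.
move=> l0 [dl dl0 hd]; have [al0 al1] := andP a01.
pose w := (3 * alpha / 4)%R; pose g (r : R) : \bar R :=
  (if (0 < r)%R && (r < dl)%R then (f `|r| * `|r| `^ (1 - alpha))%R else 0%R)%:E.
have mfa : measurable_fun setT (fun r : R => f `|r|%R) by apply: mf_absf.
have mg : measurable_fun setT g.
  apply: mf_EFin; apply: mf_if; [apply: mf_and; mfun| |by mfun].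
  by apply: mf_mul => //; mfun.
have g0 r : 0 <= g r.
  by rewrite lee_fin; case: ifP => // _; rewrite mulr_ge0 ?powR_ge0// f_ge0.
have Ig : \int[L]_r g r < +oo.
  rewrite (_ : \int[L]_r g r = \int[L]_(r in `]0%R, dl[) (f r * r `^ (1 - alpha))%:E)//.
  rewrite [RHS]integral_mkcond; apply: eq_integral => r _.
  rewrite patchE mem_setE in_itv/= /g; case: ifP => // /andP[r0 _].
  by rewrite gtr0_norm.
have Ig' : \int[L]_r g (0 - r)%R < +oo by rewrite (ge0_integral_reflect 0%R mg g0).
(* Powers of r are compared below 1, the hypothesis is used below dl. *)
pose d1 : R := (Num.min dl 1)%R.
have d10 : (0 < d1)%R by rewrite lt_min dl0 ltr01.
have [C C0 hC] := bounded_on_segment l d10.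
pose K : R := (C * l `^ (1 - w))%R.
have K0 : (0 <= K)%R by rewrite mulr_ge0 ?powR_ge0.
pose h (r : R) : \bar R := (if (`|r| <= l)%R then 1%R else 0%R : R)%:E.
have mh : measurable_fun setT h by rewrite /h; mfun.
have h0 r : 0 <= h r by rewrite lee_fin; case: ifP.
have mKh : measurable_fun setT (fun r => K%:E * h r) by apply: mf_emul => //; exact: measurable_cst.
have Kh0 r : 0 <= K%:E * h r by rewrite mule_ge0.
have mg' : measurable_fun setT (fun r : R => g (0 - r)%R).
  by apply: (measurableT_comp mg); mfun.
have mgg : measurable_fun setT (fun r : R => g r + g (0 - r)%R) by exact: mf_eadd.
have gg0 r : 0 <= g r + g (0 - r)%R by exact: adde_ge0.
apply: (@le_lt_trans _ _ (\int[L]_r ((g r + g (0 - r)%R) + K%:E * h r))); last first.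
  have e1 := leb_add gg0 Kh0 mgg mKh; have e2 := leb_add g0 (fun r => g0 (0 - r)%R) mg mg'.
  have e3 := leb_mull K0 h0 mh; have e4 : \int[L]_r h r = (2 * l)%:E := integral_box l0.
  have e5 : K%:E * (2 * l)%:E < +oo :> \bar R by rewrite -EFinM ltry.
  rewrite e1 e2 e3 e4.
  exact: (lte_add_pinfty (lte_add_pinfty Ig Ig') e5).
apply: leb_le.
- by move=> r; exact: radial_ge0.
- exact: measurable_radial.
- exact: mf_eadd.
- move=> r; rewrite /radial; case: ifPn => [/andP[rn rl]|_]; last by rewrite adde_ge0.
  have r0 : (0 < `|r|)%R by rewrite normr_gt0.
  have fr0 : (0 <= f `|r|)%R by exact: f_ge0.
  have [rd|dr] := ltP `|r|%R d1; last first.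
    apply: (@le_trans _ _ (K%:E * h r)); last by rewrite leeDr.
    rewrite /h rl mule1 lee_fin /K ler_pM ?powR_ge0//; first by rewrite hC// dr.
    by apply: ge0_ler_powR; rewrite ?nnegrE// subr_ge0; lra.
  have [rdl r1] : (`|r| < dl)%R /\ (`|r| < 1)%R.
    by move: rd; rewrite lt_min => /andP[].
  apply: (@le_trans _ _ (g r + g (0 - r)%R)); last by rewrite leeDl.
  have key : ((f `|r| * `|r| `^ (1 - w))%:E <= (f `|r| * `|r| `^ (1 - alpha))%:E).
    rewrite lee_fin ler_wpM2l// ger_powR ?r0 ?(ltW r1)//.
    by rewrite /w; lra.
  apply: le_trans key _; have [rp|rn'] := ltP 0%R r.
    apply: (@le_trans _ _ (g r)); last by rewrite leeDl.
    by rewrite /g rp; move: rdl; rewrite (gtr0_norm rp) => ->.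
  apply: (@le_trans _ _ (g (0 - r)%R)); last by rewrite leeDr.
  have rneg : (r < 0)%R by rewrite lt_neqAle rn.
  rewrite /g sub0r oppr_gt0 rneg normrN; move: rdl; rewrite (ltr0_norm rneg) => ->.
  by [].
Qed.

(** On the disc of radius [k], [`|z.1| <= k] bounds 1 by [k^w] times the singular factor
    [sing w z.1], whose integral against the kernel is finite by [polar_bound]. *)
Lemma ball_mass (l : R) : (0 < l)%R -> \int[L]_r radial f (3 * alpha / 4) l r < +oo ->
  exists2 Q : R, (0 <= Q)%R & forall k, (0 < k <= l)%R ->
    \int[PL]_z (if (enorm z <= k)%R then f (enorm z) else 0%R)%:E <=
    (k `^ (3 * alpha / 4) * Q)%:E.
Proof.
move=> l0 hr; have [al0 al1] := andP a01; set w := (3 * alpha / 4)%R in hr *.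
have w01 : (0 < w < 1)%R by rewrite /w; lra.
have w0 : (0 < w)%R by case/andP: w01.
pose H (z : plane R) := if (enorm z <= l)%R then (f (enorm z))%:E * sing w z.1 else 0.
have hH : \int[PL]_z H z < +oo by exact: (polar_bound f_ge0 f_cont w01 (ltW l0) hr).
have mH : measurable_fun setT H.
  rewrite /H; apply: mf_if; [apply: mf_ler; [apply: mf_enorm|]; mfun| |by mfun].
  apply: mf_emul; first by apply: mf_EFin; exact: measurable_kernel.
  by apply: mf_sing; mfun.
have H0 z : 0 <= H z.
  by rewrite /H; case: ifP => // _; rewrite mule_ge0 ?sing_ge0// lee_fin f_ge0// enorm_ge0.
have I0 : 0 <= \int[PL]_z H z by apply: integral_ge0.
have [Q Q0 QE] : exists2 Q : R, (0 <= Q)%R & \int[PL]_z H z = Q%:E.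
  exists (fine (\int[PL]_z H z)); first exact: fine_ge0.
  by rewrite fineK// ge0_fin_numE.
exists Q => // k /andP[k0 kl].
apply: (@le_trans _ _ (\int[PL]_z ((k `^ w)%:E * H z))); last first.
  have kw0 : 0 <= (k `^ w)%:E :> \bar R by rewrite lee_fin powR_ge0.
  by rewrite (plane_mull kw0 H0 mH) QE -EFinM.
apply: plane_le.
- by move=> z; rewrite lee_fin; case: ifP => // _; rewrite f_ge0// enorm_ge0.
- apply: mf_EFin; apply: mf_if; [|exact: (measurable_kernel f_cont)|by mfun].
  by apply: mf_ler; [apply: mf_enorm|]; mfun.
- by apply: mf_emul => //; exact: measurable_cst.
- move=> z; case: ifPn => [zk|_]; last by rewrite mule_ge0// lee_fin powR_ge0.
  have z1 : (enorm z <= l)%R by apply: le_trans zk _.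
  have fz : (0 <= f (enorm z))%R by rewrite f_ge0// enorm_ge0.
  rewrite /H z1 muleCA /sing; have [z0|zn] := eqVneq z.1 0%R.
    rewrite gt0_muley ?lte_fin ?powR_gt0//; have [->|fn] := eqVneq (f (enorm z)) 0%R.
      by rewrite mul0e.
    by rewrite gt0_muley ?leey// lte_fin lt0r fn.
  rewrite -!EFinM lee_fin ler_peMr// powRN.
  have z0 : (0 < `|z.1|)%R by rewrite normr_gt0.
  rewrite ler_pdivlMr ?powR_gt0// mul1r; apply: ge0_ler_powR; rewrite ?nnegrE ?(ltW k0) ?(ltW w0)//.
  exact: le_trans (enorm_ge1 z) zk.
Qed.

Lemma locally_small_of_radial :
  \int[L]_r radial f (3 * alpha / 4) 1 r < +oo -> locally_small f.
Proof.
move=> hr e e0; have [Q Q0 hQ] := ball_mass ltr01 hr.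
have [al0 al1] := andP a01; set w := (3 * alpha / 4)%R in hQ.
have w0 : (0 < w)%R by rewrite /w; lra.
pose k : R := (Num.min 1 ((e / (Q + 1)) `^ w^-1))%R.
have eQ : (0 < e / (Q + 1))%R by rewrite divr_gt0// ltr_pwDr.
have k0 : (0 < k)%R by rewrite lt_min ltr01 powR_gt0.
have kw : (k `^ w * Q <= e)%R.
  apply: (@le_trans _ _ (e / (Q + 1) * Q)%R).
    rewrite ler_wpM2r//; apply: (@le_trans _ _ (((e / (Q + 1)) `^ w^-1) `^ w)%R).
      apply: ge0_ler_powR; rewrite ?nnegrE ?powR_ge0 ?(ltW k0) ?(ltW w0)//.
      by rewrite ge_min lexx orbT.
    by rewrite -powRrM mulVf ?gt_eqF// powRr1// ltW.
  rewrite mulrAC -mulrA ler_piMr ?(ltW e0)// ler_pdivrMr ?ltr_pwDr//.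
  by rewrite mul1r lerDl.
exists k => //; apply: le_trans (hQ k _) _; first by rewrite k0 ge_min lexx.
by rewrite lee_fin.
Qed.

End local_integrability.

(** * Positivity from the noise *)

Section second_moments.
Context d (T : measurableType d) (R : realType) (P : probability T R).
Local Open Scope ereal_scope.

Lemma expectation_lincomb (I : Type) (s : seq I) (c : I -> R) (Z : I -> T -> R) :
  (forall i, Z i \in Lfun P 1) ->
  'E_P[(fun w => \sum_(i <- s) c i * Z i w)%R] = (\sum_(i <- s) c i * fine 'E_P[Z i])%R%:E.
Proof.
move=> hZ; have le11 : (1 <= 1 :> \bar R) by [].
have hs (s' : seq I) : (fun w => \sum_(i <- s') c i * Z i w)%R \in Lfun P 1.
  rewrite (_ : (fun w => _) = (\sum_(i <- s') c i *: Z i)%R).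
    by apply: rpred_sum => i _; apply: rpredZ; exact: hZ.
  by apply/funext => w; rewrite fct_sumE.
elim: s => [|i s IH].
  rewrite big_nil (_ : (fun w => _) = cst 0%R); first exact: expectation_cst.
  by apply/funext => w; rewrite big_nil.
have -> : (fun w => \sum_(j <- i :: s) c j * Z j w)%R =
    ((c i \o* Z i) \+ (fun w => \sum_(j <- s) c j * Z j w))%R.
  by apply/funext => w; rewrite big_cons /= mulrC.
have hci : (c i \o* Z i)%R \in Lfun P 1.
  rewrite (_ : (c i \o* Z i)%R = (c i *: Z i)%R); first by apply: rpredZ; exact: hZ.
  by apply/funext => w /=; rewrite mulrC.
rewrite (expectationD hci (hs s)) IH (expectationZl _ (hZ i)) big_cons EFinD EFinM fineK//.
exact: expectation_fin_num.
Qed.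

Lemma expectation_bilinear (I J : Type) (s : seq I) (r : seq J) (c : I -> R) (e : J -> R)
    (Z : I -> T -> R) (W : J -> T -> R) :
  (forall i, Z i \in Lfun P 2%:E) -> (forall j, W j \in Lfun P 2%:E) ->
  'E_P[(fun w => (\sum_(i <- s) c i * Z i w) * (\sum_(j <- r) e j * W j w))%R] =
  (\sum_(i <- s) \sum_(j <- r) c i * e j * fine 'E_P[(fun w => Z i w * W j w)%R])%R%:E.
Proof.
move=> hZ hW.
pose Q (p : I * J) (w : T) : R := (Z p.1 w * W p.2 w)%R.
have hQ p : Q p \in Lfun P 1.
  exact: (Lfun2_mul_Lfun1 (hZ p.1) (hW p.2)).
have := expectation_lincomb [seq (i, j) | i <- s, j <- r] (fun p => c p.1 * e p.2)%R hQ.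
rewrite big_allpairs_dep /= => <-; congr expectation; apply/funext => w.
rewrite big_allpairs_dep /= big_distrlr /=; apply: eq_bigr => i _; apply: eq_bigr => j _.
by rewrite /Q /=; ring.
Qed.

Lemma second_moment_fin (Z W : T -> R) : Z \in Lfun P 2%:E -> W \in Lfun P 2%:E ->
  'E_P[(fun w => Z w * W w)%R] \is a fin_num.
Proof. by move=> hZ hW; apply: expectation_fin_num; exact: (Lfun2_mul_Lfun1 hZ hW). Qed.

End second_moments.

Section noise_positive.
Context d (Omega : measurableType d) (R : realType) (P : probability Omega R).
Context (f : R -> R) (F : (spacetime R -> R) -> {RV P >-> R}).
Hypothesis f_ge0 : forall r : R, 0 <= r -> 0 <= f r.
Hypothesis f_cont : forall r : R, 0 < r -> {for r, continuous f}.
Hypothesis F_noise : gaussian_noise f F.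
Local Notation L := (@lebesgue_measure R).

Lemma pform_scale2 (c : R) (u v : plane R -> R) : 0 <= c -> nnmeas u -> nnmeas v ->
  (pform f (fun x => c * u x)%R (fun x => c * v x)%R = (c ^+ 2)%:E * pform f u v)%E.
Proof.
move=> c0 hu hv; have hcv := nnmeasZ c0 hv.
rewrite (pformZl f_ge0 f_cont c0 hu hcv) (pform_sym f_ge0 f_cont hu hcv).
by rewrite (pformZl f_ge0 f_cont c0 hv hu) (pform_sym f_ge0 f_cont hv hu) muleA -EFinM -expr2.
Qed.

Lemma nn_cell_bump (n i j : R) : nnmeas (cell_bump n i j).
Proof.
split; last by move=> x; rewrite mulr_ge0 ?bump_ge0.
have mb : measurable_fun setT (@bump R).
  by apply: continuous_measurable_fun; exact: bump_continuous.
rewrite /cell_bump; apply: mf_mul.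
  by apply: (measurableT_comp mb); mfun.
by apply: (measurableT_comp mb); mfun.
Qed.

(** A common bump in time reduces the space-time covariance to the form of the plane. *)
Lemma cov_time_bump : exists2 k : R, 0 < k & forall u v, nnmeas u -> nnmeas v ->
  (cov f (fun z => bump z.1 * u z.2)%R (fun z => bump z.1 * v z.2)%R = k%:E * pform f u v)%E.
Proof.
have [k k0 kE] := @integral_bump_pow R 1; exists k => // u v hu hv.
have mb : measurable_fun setT (fun t : R => (bump t ^+ 2)%:E).
  apply: mf_EFin; apply: mf_exp; apply: continuous_measurable_fun; exact: bump_continuous.
have p0 := pform_ge0 f_ge0 hu hv.
rewrite covE -kE.
transitivity (\int[L]_(t in `[0%R, +oo[) (pform f u v * (bump t ^+ 2)%:E))%E.
  by apply: eq_integral => t _; rewrite (pform_scale2 (bump_ge0 t) hu hv) muleC.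
have -> : (\int[L]_t (bump t ^+ 2)%:E = \int[L]_(t in `[0%R, +oo[) (bump t ^+ 2)%:E)%E.
  rewrite [RHS]integral_mkcond; apply: eq_integral => t _.
  rewrite patchE mem_setE in_itv/= andbT; case: ifPn => // t0.
  by rewrite bump_out ?expr0n//; apply: contra t0 => /andP[/ltW].
rewrite muleC ge0_integralZl; first by [].
- exact: measurable_itv.
- exact: measurable_funTS.
- by move=> t _; rewrite lee_fin sqr_ge0.
- exact: p0.
Qed.

(** The combination, with coefficients [a i - b i], of the values of the noise at the
    products of a bump in time and the cell bumps, has a nonnegative second moment, which is a positive multiple of
    [K(U - V, U - V)]. *)
Lemma noise_positive_on_bumps : positive_on_bumps f.
Proof.
move=> I n e a b n0 a0 b0; have [_ F2 _ Fcov] := F_noise.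
have [k k0 kE] := cov_time_bump.
pose eta i := cell_bump n (e i).1 (e i).2; pose phi i (z : spacetime R) := bump z.1 * eta i z.2.
have nn i : nnmeas (eta i) by exact: nn_cell_bump.
have tp i : test_function (phi i) by exact: test_cell_bump.
have hF i : (F (phi i) : Omega -> R) \in Lfun P 2%:E by exact: F2.
have pfin i j : exists2 p : R, pform f (eta i) (eta j) = p%:E &
    fine ('E_P[fun w => (F (phi i) w * F (phi j) w)%R])%E = k * p.
  have p0 := pform_ge0 f_ge0 (nn i) (nn j).
  have := second_moment_fin (hF i) (hF j); rewrite (Fcov _ _ (tp i) (tp j)).
  rewrite (kE _ _ (nn i) (nn j)); case: (pform f (eta i) (eta j)) p0 => [p| |] //.
    by exists p.
  by rewrite gt0_muley ?lte_fin.
pose p i j : R := fine (pform f (eta i) (eta j)).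
have pE i j : pform f (eta i) (eta j) = (p i j)%:E by rewrite /p; have [q -> _] := pfin i j.
have qE i j : fine ('E_P[fun w => (F (phi i) w * F (phi j) w)%R])%E = k * p i j.
  by rewrite /p; have [q -> ->] := pfin i j.
have psym i j : p i j = p j i by rewrite /p (pform_sym f_ge0 f_cont (nn i) (nn j)).
have nna i : nnmeas (fun x => a i * eta i x) by exact: nnmeasZ.
have nnb i : nnmeas (fun x => b i * eta i x) by exact: nnmeasZ.
have expand (c c' : I -> R) : (forall i, 0 <= c i) -> (forall i, 0 <= c' i) ->
    pform f (fun x => \sum_i c i * eta i x)%R (fun x => \sum_i c' i * eta i x)%R =
    (\sum_i \sum_j c i * c' j * p i j)%:E.
  move=> c0 c'0.
  have nc i : nnmeas (fun x => c i * eta i x) by exact: nnmeasZ.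
  have nc' i : nnmeas (fun x => c' i * eta i x) by exact: nnmeasZ.
  rewrite (pform_sum f_ge0 f_cont _ _ nc nc') -sumEFin; apply: eq_bigr => i _.
  rewrite -sumEFin; apply: eq_bigr => j _.
  rewrite (pformZl f_ge0 f_cont (c0 i) (nn i) (nc' j)) (pform_sym f_ge0 f_cont (nn i) (nc' j)).
  rewrite (pformZl f_ge0 f_cont (c'0 j) (nn j) (nn i)) (pform_sym f_ge0 f_cont (nn j) (nn i)) pE.
  by rewrite -!EFinM mulrA.
have pos : 0 <= \sum_i \sum_j (a i - b i) * (a j - b j) * p i j.
  have := expectation_bilinear (index_enum I) (index_enum I) (fun i => a i - b i)
    (fun i => a i - b i) hF hF.
  have E0 : (0 <= 'E_P[fun w => ((\sum_i (a i - b i) * F (phi i) w) *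
      (\sum_i (a i - b i) * F (phi i) w))%R])%E.
    by apply: expectation_ge0 => w; rewrite -expr2 sqr_ge0.
  move=> Ee; rewrite Ee lee_fin in E0.
  have e2 : \sum_i \sum_j (a i - b i) * (a j - b j) * fine ('E_P[fun w => (F (phi i) w * F (phi j) w)%R])%E
     = k * \sum_i \sum_j (a i - b i) * (a j - b j) * p i j.
    rewrite mulr_sumr; apply: eq_bigr => i _; rewrite mulr_sumr; apply: eq_bigr => j _.
    by rewrite qE; ring.
  by rewrite e2 pmulr_rge0 in E0.
rewrite /= (expand a b)// (expand a a)// (expand b b)// -EFinM -EFinD lee_fin -subr_ge0.
apply: le_trans pos _; rewrite le_eqVlt; apply/orP; left; apply/eqP.
have sw : \sum_i \sum_j a j * b i * p i j = \sum_i \sum_j a i * b j * p i j.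
  rewrite exchange_big; apply: eq_bigr => i _; apply: eq_bigr => j _.
  by rewrite psym.
have -> : 2 * \sum_i \sum_j a i * b j * p i j =
    \sum_i \sum_j a i * b j * p i j + \sum_i \sum_j a j * b i * p i j by rewrite sw; ring.
rewrite -!big_split -sumrB; apply: eq_bigr => i _ /=.
rewrite -!big_split -sumrB; apply: eq_bigr => j _ /=.
by ring.
Qed.

End noise_positive.

(** * Second moments of combinations of the noise *)

Section signed_covariance.
Context (R : realType) (f : R -> R).
Hypothesis f_ge0 : forall r : R, (0 <= r)%R -> (0 <= f r)%R.
Hypothesis f_cont : forall r : R, (0 < r)%R -> {for r, continuous f}.
Local Notation L := (@lebesgue_measure R).
Local Notation PL := (plane_measure R).
Local Open Scope ereal_scope.
Hypothesis f_loc : forall l : R, (0 < l)%R -> exists2 Q : R, (0 <= Q)%R &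
  \int[PL]_z (if (enorm z <= l)%R then f (enorm z) else 0%R)%:E <= Q%:E.
Implicit Types u v a b p q : spacetime R -> R.

(** Stable under sums and multiples, and small enough for the covariance to be finite,
    so that differences of such functions have a bilinear covariance. *)
Definition moderate u := nnst u /\ exists N : nat,
  forall z, (u z <= N%:R)%R /\ (u z != 0%R -> (`|z.1| <= N%:R)%R /\ in_box N z.2).

Lemma moderate_widen u N M : nnst u -> (N <= M)%N ->
  (forall z, (u z <= N%:R)%R /\ (u z != 0%R -> (`|z.1| <= N%:R)%R /\ in_box N z.2)) ->
  forall z, (u z <= M%:R)%R /\ (u z != 0%R -> (`|z.1| <= M%:R)%R /\ in_box M z.2).
Proof.
move=> hu NM hN z; have NM' : (N%:R <= M%:R :> R)%R by rewrite ler_nat.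
have [h1 h2] := hN z; split; first exact: le_trans NM'.
move=> /h2[k1 /andP[/andP[k2 k3] /andP[k4 k5]]]; split; first exact: le_trans NM'.
have h (t : R) : (- N%:R <= t -> t < N%:R -> (- M%:R <= t) && (t < M%:R))%R.
  by move=> h3 h4; apply/andP; split; lra.
by rewrite /in_box (h _ k2 k3) (h _ k4 k5).
Qed.

Lemma moderateD u v : moderate u -> moderate v -> moderate (fun z => u z + v z)%R.
Proof.
move=> [hu [N hN]] [hv [M hM]]; split; first exact: nnstD.
exists (N + M)%N => z.
have [u1 u2] := moderate_widen hu (leq_addr M N) hN z.
have [v1 v2] := moderate_widen hv (leq_addl N M) hM z.
split; first by rewrite natrD lerD//; [have [] := hN z|have [] := hM z].
have [->|un _] := eqVneq (u z) 0%R; first by rewrite add0r.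
exact: u2.
Qed.

Lemma moderateZ c u : (0 <= c)%R -> moderate u -> moderate (fun z => c * u z)%R.
Proof.
move=> c0 [hu [N hN]]; split; first exact: nnstZ.
pose K := (Num.truncn c).+1; have cK : (c <= K%:R)%R by exact/ltW/truncnS_gt.
have KN : (N <= K * N)%N by rewrite leq_pmull.
exists (K * N)%N => z; have [u1 u2] := moderate_widen hu KN hN z; split.
  by rewrite natrM ler_pM//; [case: hu|have [] := hN z].
by rewrite mulf_eq0 negb_or => /andP[_]; exact: u2.
Qed.

(** The supports stay within a bounded distance, so only the mass of the kernel in a disc
    matters. *)
Lemma moderate_fin u v : moderate u -> moderate v ->
  [/\ forall t x, \int[PL]_y (u (t, x) * f (enorm (x - y)%R) * v (t, y))%:E < +oo,
      forall t, pform f (fun x => u (t, x)) (fun x => v (t, x)) < +oo &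
      cov f u v < +oo].
Proof.
move=> [hu [N0 hN0]] [hv [M0 hM0]].
pose N := (maxn N0 M0).+1.
have hN := moderate_widen hu (leqW (leq_maxl N0 M0)) hN0.
have hM := moderate_widen hv (leqW (leq_maxr N0 M0)) hM0.
have N0' : (0 < N%:R :> R)%R by rewrite ltr0n.
have [Q Q0 hQ] := f_loc (mulr_gt0 (ltr0n R 4) N0').
pose C : R := N%:R; have C0 : (0 <= C)%R by exact: ltW.
pose J (x : plane R) : R := (if in_box N x then 1 else 0)%R.
have mJ : measurable_fun setT J by rewrite /J /in_box; mfun.
pose tI (t : R) : R := (if (`|t| <= C)%R then 1 else 0)%R.
have mt : measurable_fun setT tI by rewrite /tI; mfun.
have tI0 t : (0 <= tI t)%R by rewrite /tI; case: ifP.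
have J0 x : (0 <= J x)%R by rewrite /J; case: ifP.
have mk (k : R -> R) : measurable_fun setT (fun z : plane R => k (enorm z)) ->
  forall x : plane R, measurable_fun setT (fun y : plane R => k (enorm (x - y)%R)).
  move=> mk x; apply: (measurableT_comp mk).
  by apply: mf_padd; [|apply: mf_popp]; mfun.
pose g (r : R) : R := if (r <= 4 * C)%R then f r else 0%R.
have g0 r : (0 <= r)%R -> (0 <= g r)%R by rewrite /g; case: ifP => // _; exact: f_ge0.
have mg : measurable_fun setT (fun z : plane R => g (enorm z)).
  rewrite /g; apply: mf_if; [|exact: (measurable_kernel f_cont)|by mfun].
  by apply: mf_ler; [apply: mf_enorm|]; mfun.
have y1 t x : \int[PL]_y (u (t, x) * f (enorm (x - y)%R) * v (t, y))%:E <=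
    (C * C * Q * (tI t * J x))%:E.
  have hux := nnst_slice t hu; have hvx := nnst_slice t hv.
  have [mux ux0] := hux; have [mvx vx0] := hvx.
  have mI : measurable_fun setT (fun z : plane R * plane R =>
      (u (t, z.1) * f (enorm (z.1 - z.2)%R) * v (t, z.2))%:E).
    exact: (measurable_pform_integrand f_cont mux mvx).
  have mIx : measurable_fun setT (fun y : plane R =>
      (u (t, x) * f (enorm (x - y)%R) * v (t, y))%:E).
    by apply: (measurableT_comp mI (_ : measurable_fun setT (fun y : plane R => (x, y)))); mfun.
  have Cc0 : 0 <= (C * C * (tI t * J x))%:E by rewrite lee_fin !mulr_ge0.
  have mgx := mf_EFin (mk g mg x).
  have gx0 y : 0 <= (g (enorm (x - y)%R))%:E by rewrite lee_fin g0// enorm_ge0.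
  apply: (@le_trans _ _ (\int[PL]_y ((C * C * (tI t * J x))%:E * (g (enorm (x - y)%R))%:E))).
    apply: plane_le.
    - by move=> y; rewrite lee_fin !mulr_ge0// f_ge0// enorm_ge0.
    - exact: mIx.
    - by apply: mf_emul; [exact: measurable_cst|].
    - move=> y; rewrite -EFinM lee_fin.
      have [uz|un] := eqVneq (u (t, x)) 0%R.
        by rewrite uz !mul0r !mulr_ge0// g0// enorm_ge0.
      have [vz|vn] := eqVneq (v (t, y)) 0%R.
        by rewrite vz mulr0 !mulr_ge0// g0// enorm_ge0.
      have [u1 /(_ un)[u2 u3]] := hN (t, x); have [v1 /(_ vn)[v2 v3]] := hM (t, y).
      have d4 : (enorm (x - y) <= 4 * C)%R.
        move: u3 v3 => /andP[/andP[a1 a2] /andP[a3 a4]] /andP[/andP[b1 b2] /andP[b3 b4]].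
        apply: le_trans (enorm_le_sum _) _.
        have h (s r : R) : (- N%:R <= s -> s < N%:R -> - N%:R <= r -> r < N%:R ->
            `|s - r| <= 2 * N%:R)%R.
          by move=> *; rewrite ler_norml; apply/andP; split; lra.
        have := lerD (h _ _ a1 a2 b1 b2) (h _ _ a3 a4 b3 b4) => /=.
        by rewrite /C => hh; apply: le_trans hh _; lra.
      rewrite /tI /J /g u2 u3 d4 !mulr1 mulrAC ler_wpM2r ?f_ge0 ?enorm_ge0//.
      by rewrite ler_pM.
  rewrite (plane_mull Cc0 gx0 mgx) (plane_reflect x (mf_EFin mg)); last first.
    by move=> z; rewrite lee_fin g0// enorm_ge0.
  apply: le_trans (lee_wpmul2l Cc0 hQ) _.
  by rewrite -EFinM lee_fin le_eqVlt; apply/orP; left; apply/eqP; ring.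
have iJ : \int[PL]_x (J x)%:E <= (C * C * 16)%:E.
  have c0 k : (0 <= C * k%:R)%R by rewrite mulr_ge0.
  apply: (@le_trans _ _ (\int[PL]_x ((if (`|x.1| <= 2 * C)%R then 1 else 0)%R * (if (`|x.2| <= 2 * C)%R then 1 else 0)%R)%:E)).
    apply: plane_le.
    - by move=> x; rewrite lee_fin.
    - exact: mf_EFin.
    - by apply: mf_EFin; apply: mf_mul; mfun.
    - move=> x; rewrite lee_fin /J; case: ifP; last by case: ifP => _; case: ifP => _; rewrite ?mulr0 ?mulr1.
      move=> /andP[/andP[a1 a2] /andP[a3 a4]].
      have h (s : R) : (- N%:R <= s -> s < N%:R -> `|s| <= 2 * C)%R.
        by move=> *; rewrite ler_norml /C; apply/andP; split; lra.
      by rewrite (h _ a1 a2) (h _ a3 a4) mulr1.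
  pose h (s : R) : R := (if (`|s| <= 2 * C)%R then 1 else 0)%R.
  have mh : measurable_fun setT h by rewrite /h; mfun.
  have h0 s : (0 <= h s)%R by rewrite /h; case: ifP.
  have C20 : (0 <= 2 * C)%R by rewrite mulr_ge0.
  have ih : \int[L]_s (h s)%:E = (2 * (2 * C))%:E := integral_box C20.
  have := plane_product_scale 0%R 0%R (@ltr01 R) mh mh h0 h0 ih ih.
  rewrite (_ : (1 ^- 2 * (2 * (2 * C) * (2 * (2 * C))))%R = (C * C * 16)%R); last first.
    by rewrite expr1n invr1; ring.
  move=> <-; rewrite le_eqVlt; apply/orP; left; apply/eqP.
  by apply: eq_integral => x _; rewrite !mul1r !addr0.
have CQ0 t : 0 <= (C * C * Q * tI t)%:E by rewrite lee_fin !mulr_ge0.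
have x1 t : pform f (fun x => u (t, x)) (fun x => v (t, x)) <=
    (C * C * Q * tI t * (C * C * 16))%:E.
  have hux := nnst_slice t hu; have hvx := nnst_slice t hv.
  have [mux ux0] := hux; have [mvx vx0] := hvx.
  have mI := measurable_pform_integrand f_cont mux mvx.
  have I0 : forall z : plane R * plane R,
      0 <= (u (t, z.1) * f (enorm (z.1 - z.2)%R) * v (t, z.2))%:E.
    by move=> z; rewrite lee_fin !mulr_ge0// f_ge0// enorm_ge0.
  have J0' x : 0 <= (J x)%:E by rewrite lee_fin.
  apply: (@le_trans _ _ (\int[PL]_x ((C * C * Q * tI t)%:E * (J x)%:E))).
    apply: plane_le.
    - by move=> x; apply: integral_ge0 => y _; exact: (I0 (x, y)).
    - exact: (measurable_plane_integral mI I0).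
    - by apply: mf_emul; [exact: measurable_cst|exact: mf_EFin].
    - by move=> x; apply: le_trans (y1 t x) _; rewrite -EFinM mulrA.
  rewrite (plane_mull (CQ0 t) J0' (mf_EFin mJ)).
  by apply: le_trans (lee_wpmul2l (CQ0 t) iJ) _; rewrite -EFinM.
have t1 : cov f u v <= (C * C * Q * (C * C * 16) * (2 * C))%:E.
  have mp : measurable_fun setT (fun t => pform f (fun x => u (t, x)) (fun x => v (t, x))).
    by case: hu => mu u0; case: hv => mv v0; exact: (measurable_pform f_ge0 f_cont mu mv u0 v0).
  have p0 t : 0 <= pform f (fun x => u (t, x)) (fun x => v (t, x)).
    exact: (pform_ge0 f_ge0 (nnst_slice t hu) (nnst_slice t hv)).
  have K0 : (0 <= C * C * Q * (C * C * 16))%R by rewrite !mulr_ge0.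
  have tE0 t : 0 <= (tI t)%:E by rewrite lee_fin.
  rewrite covE; apply: (@le_trans _ _ (\int[L]_t pform f (fun x => u (t, x)) (fun x => v (t, x)))).
    by apply: ge0_subset_integral => //; exact: measurable_itv.
  apply: (@le_trans _ _ (\int[L]_t ((C * C * Q * (C * C * 16))%:E * (tI t)%:E))).
    apply: leb_le => //.
    - by apply: mf_emul; [exact: measurable_cst|exact: mf_EFin].
    - by move=> t; apply: le_trans (x1 t) _; rewrite -EFinM mulrAC.
  rewrite (leb_mull K0 tE0 (mf_EFin mt)).
  have e4 : \int[L]_t (tI t)%:E = (2 * C)%:E := integral_box C0.
  by rewrite e4 -EFinM.
split=> [t x|t|]; [apply: le_lt_trans (y1 t x) _|apply: le_lt_trans (x1 t) _|
  apply: le_lt_trans t1 _]; exact: ltry.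
Qed.

End signed_covariance.

Section signed_bilinear.
Context (R : realType) (f : R -> R).
Hypothesis f_ge0 : forall r : R, (0 <= r)%R -> (0 <= f r)%R.
Hypothesis f_cont : forall r : R, (0 < r)%R -> {for r, continuous f}.
Local Notation L := (@lebesgue_measure R).
Local Notation PL := (plane_measure R).
Local Open Scope ereal_scope.
Hypothesis f_loc : forall l : R, (0 < l)%R -> exists2 Q : R, (0 <= Q)%R &
  \int[PL]_z (if (enorm z <= l)%R then f (enorm z) else 0%R)%:E <= Q%:E.
Implicit Types u v a b p q : spacetime R -> R.

Lemma integral_difference d (T : measurableType d) (mu : {measure set T -> \bar R})
    (D : set T) (G H : T -> \bar R) : measurable D ->
  measurable_fun D G -> measurable_fun D H -> (forall x, 0 <= G x) -> (forall x, 0 <= H x) ->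
  \int[mu]_(x in D) G x < +oo -> \int[mu]_(x in D) H x < +oo ->
  \int[mu]_(x in D) (G x - H x) = \int[mu]_(x in D) G x - \int[mu]_(x in D) H x.
Proof.
move=> mD mG mH G0 H0 iG iH.
have key K : measurable_fun D K -> (forall x, 0 <= K x) -> \int[mu]_(x in D) K x < +oo ->
    mu.-integrable D K.
  move=> mK K0 iK; apply/integrableP; split=> //.
  by rewrite (eq_integral K)// => x _; rewrite gee0_abs.
by apply: integralB => //; exact: key.
Qed.

Let fin_cov a p : moderate a -> moderate p -> cov f a p \is a fin_num.
Proof.
move=> ha hp; have [_ _ h] := moderate_fin f_ge0 f_cont f_loc ha hp.
rewrite ge0_fin_numE//; apply: cov_ge0 => //; [by case: ha|by case: hp].
Qed.

(** The integral is expanded in [y], in [x] and in [t] in turn; at each stage the four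
    terms are finite by [moderate_fin], so no indeterminate difference occurs. *)
Lemma cov_difference a b p q : moderate a -> moderate b -> moderate p -> moderate q ->
  cov f (fun z => a z - b z)%R (fun z => p z - q z)%R =
  (cov f a p + cov f b q) - (cov f a q + cov f b p).
Proof.
move=> ha hb hp hq; have [[na _] [nb _]] := (ha, hb); have [[np _] [nq _]] := (hp, hq).
have F u v (hu : moderate u) (hv : moderate v) := moderate_fin f_ge0 f_cont f_loc hu hv.
pose k u v t x y : \bar R := (u (t, x) * f (enorm (x - y)%R) * v (t, y))%:E.
pose K u v t x := \int[PL]_y k u v t x y.
have k0 u v t x y : nnst u -> nnst v -> 0 <= k u v t x y.
  by move=> [_ u0] [_ v0]; rewrite lee_fin !mulr_ge0// f_ge0// enorm_ge0.
have mI u v t : nnst u -> nnst v -> measurable_fun setT (fun z : plane R * plane R => k u v t z.1 z.2).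
  move=> hu hv; have [mux _] := nnst_slice t hu; have [mvx _] := nnst_slice t hv.
  exact: (measurable_pform_integrand f_cont mux mvx).
have mk u v t x : nnst u -> nnst v -> measurable_fun setT (fun y : plane R => k u v t x y).
  move=> hu hv; apply: (measurableT_comp (mI u v t hu hv)
    (_ : measurable_fun setT (fun y : plane R => (x, y)))); mfun.
have K0 u v t x : nnst u -> nnst v -> 0 <= K u v t x.
  by move=> hu hv; apply: integral_ge0 => y _; exact: k0.
have mK u v t : nnst u -> nnst v -> measurable_fun setT (fun x : plane R => K u v t x).
  by move=> hu hv; exact: (measurable_plane_integral (mI u v t hu hv) (fun z => k0 u v t z.1 z.2 hu hv)).
have p0 u v t : nnst u -> nnst v -> 0 <= pform f (fun x => u (t, x)) (fun x => v (t, x)).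
  by move=> hu hv; exact: (pform_ge0 f_ge0 (nnst_slice t hu) (nnst_slice t hv)).
have mp u v : nnst u -> nnst v -> measurable_fun (`[0%R, +oo[%classic : set R)
    (fun t => pform f (fun x => u (t, x)) (fun x => v (t, x))).
  by move=> [mu u0] [mv v0]; apply: measurable_funTS; exact: (measurable_pform f_ge0 f_cont mu mv u0 v0).
have mT : measurable [set: plane R] by exact: measurableT.
have Yl t x : \int[PL]_y ((a (t, x) - b (t, x)) * f (enorm (x - y)%R) * (p (t, y) - q (t, y)))%:E =
    (K a p t x + K b q t x) - (K a q t x + K b p t x).
  have sum2 u v u' v' : nnst u -> nnst v -> nnst u' -> nnst v' ->
      \int[PL]_y (k u v t x y + k u' v' t x y) = K u v t x + K u' v' t x.
    move=> hu hv hu' hv'.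
    exact: (plane_add (fun y => k0 u v t x y hu hv) (fun y => k0 u' v' t x y hu' hv') (mk _ _ _ _ hu hv) (mk _ _ _ _ hu' hv')).
  transitivity (\int[PL]_y ((k a p t x y + k b q t x y) - (k a q t x y + k b p t x y))).
    apply: eq_integral => y _; rewrite /k -!EFinD; congr EFin.
    by ring.
  have e1 := sum2 a p b q na np nb nq; have e2 := sum2 a q b p na nq nb np.
  refine (etrans _ (congr2 (fun r s : \bar R => r - s) e1 e2)).
  apply: (@integral_difference _ (measurableTypeR R * measurableTypeR R)%type PL).
  - exact: measurableT.
  - by apply: mf_eadd; exact: mk.
  - by apply: mf_eadd; exact: mk.
  - by move=> y; apply: adde_ge0; exact: k0.
  - by move=> y; apply: adde_ge0; exact: k0.
  - apply: (eq_ind_r (fun r : \bar R => r < +oo) _ e1).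
    by apply: lte_add_pinfty; [have [h _ _] := F _ _ ha hp|have [h _ _] := F _ _ hb hq]; exact: h.
  - apply: (eq_ind_r (fun r : \bar R => r < +oo) _ e2).
    by apply: lte_add_pinfty; [have [h _ _] := F _ _ ha hq|have [h _ _] := F _ _ hb hp]; exact: h.
pose Pf u v t := pform f (fun x => u (t, x)) (fun x => v (t, x)).
have Xl t : pform f (fun x => a (t, x) - b (t, x))%R (fun x => p (t, x) - q (t, x))%R =
    (Pf a p t + Pf b q t) - (Pf a q t + Pf b p t).
  have sum2 u v u' v' : nnst u -> nnst v -> nnst u' -> nnst v' ->
      \int[PL]_x (K u v t x + K u' v' t x) = Pf u v t + Pf u' v' t.
    move=> hu hv hu' hv'.
    exact: (plane_add (fun x => K0 u v t x hu hv) (fun x => K0 u' v' t x hu' hv') (mK _ _ _ hu hv) (mK _ _ _ hu' hv')).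
  transitivity (\int[PL]_x ((K a p t x + K b q t x) - (K a q t x + K b p t x))).
    by apply: eq_integral => x _; exact: Yl.
  have e1 := sum2 a p b q na np nb nq; have e2 := sum2 a q b p na nq nb np.
  refine (etrans _ (congr2 (fun r s : \bar R => r - s) e1 e2)).
  apply: (@integral_difference _ (measurableTypeR R * measurableTypeR R)%type PL).
  - exact: measurableT.
  - by apply: mf_eadd; exact: mK.
  - by apply: mf_eadd; exact: mK.
  - by move=> y; apply: adde_ge0; exact: K0.
  - by move=> y; apply: adde_ge0; exact: K0.
  - apply: (eq_ind_r (fun r : \bar R => r < +oo) _ e1).
    by apply: lte_add_pinfty; [have [_ h _] := F _ _ ha hp|have [_ h _] := F _ _ hb hq]; exact: h.
  - apply: (eq_ind_r (fun r : \bar R => r < +oo) _ e2).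
    by apply: lte_add_pinfty; [have [_ h _] := F _ _ ha hq|have [_ h _] := F _ _ hb hp]; exact: h.
have sum2 u v u' v' : nnst u -> nnst v -> nnst u' -> nnst v' ->
    \int[L]_(t in `[0%R, +oo[) (Pf u v t + Pf u' v' t) = cov f u v + cov f u' v'.
  move=> hu hv hu' hv'; apply: ge0_integralD.
  - exact: measurable_itv.
  - by move=> t _; exact: p0.
  - exact: mp.
  - by move=> t _; exact: p0.
  - exact: mp.
transitivity (\int[L]_(t in `[0%R, +oo[) ((Pf a p t + Pf b q t) - (Pf a q t + Pf b p t))).
  by apply: eq_integral => t _; exact: Xl.
have e1 := sum2 a p b q na np nb nq; have e2 := sum2 a q b p na nq nb np.
refine (etrans _ (congr2 (fun r s : \bar R => r - s) e1 e2)).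
apply: integral_difference.
- exact: measurable_itv.
- by apply: mf_eadd; exact: mp.
- by apply: mf_eadd; exact: mp.
- by move=> y; apply: adde_ge0; exact: p0.
- by move=> y; apply: adde_ge0; exact: p0.
- apply: (eq_ind_r (fun r : \bar R => r < +oo) _ e1).
  by apply: lte_add_pinfty; [have [_ _ h] := F _ _ ha hp|have [_ _ h] := F _ _ hb hq]; exact: h.
- apply: (eq_ind_r (fun r : \bar R => r < +oo) _ e2).
  by apply: lte_add_pinfty; [have [_ _ h] := F _ _ ha hq|have [_ _ h] := F _ _ hb hp]; exact: h.
Qed.

(* Unification would otherwise unfold the triple integral. *)
Local Opaque cov.

Definition signed_moderate u := exists a b,
  [/\ moderate a, moderate b & u = (fun z => a z - b z)%R].

Let be u v : R := fine (cov f u v).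

Let beE u v : moderate u -> moderate v -> cov f u v = (be u v)%:E.
Proof. by move=> hu hv; rewrite fineK//; exact: fin_cov. Qed.

Let beD u v p : moderate u -> moderate v -> moderate p ->
  be (fun z => u z + v z)%R p = (be u p + be v p)%R.
Proof.
move=> hu hv hp; have [[nu _] [nv _]] := (hu, hv); have [np _] := hp.
apply: EFin_inj; apply: etrans (esym (beE (moderateD hu hv) hp)) _.
apply: etrans (covD f_ge0 f_cont nu nv np) _.
exact: (congr2 (fun r s : \bar R => r + s) (beE hu hp) (beE hv hp)).
Qed.

Let beZ c u p : (0 <= c)%R -> moderate u -> moderate p ->
  be (fun z => c * u z)%R p = (c * be u p)%R.
Proof.
move=> c0 hu hp; have [[nu _] [np _]] := (hu, hp).
apply: EFin_inj; apply: etrans (esym (beE (moderateZ c0 hu) hp)) _.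
apply: etrans (covZ f_ge0 f_cont c0 nu np) _.
exact: (congr1 (fun r : \bar R => c%:E * r) (beE hu hp)).
Qed.

Let beC u v : moderate u -> moderate v -> be u v = be v u.
Proof. by move=> [nu _] [nv _]; rewrite /be (cov_sym f_ge0 f_cont nu nv). Qed.

Let cov_be a b p q : moderate a -> moderate b -> moderate p -> moderate q ->
  cov f (fun z => a z - b z)%R (fun z => p z - q z)%R =
  (be a p + be b q - (be a q + be b p))%R%:E.
Proof.
move=> ha hb hp hq; apply: etrans (cov_difference ha hb hp hq) _.
by rewrite (beE ha hp) (beE hb hq) (beE ha hq) (beE hb hp).
Qed.

Lemma signed_cov_sym u v : signed_moderate u -> signed_moderate v -> cov f u v = cov f v u.
Proof.
move=> [a [b [ha hb ->]]] [p [q [hp hq ->]]].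
rewrite (cov_be ha hb hp hq).
rewrite (cov_be hp hq ha hb).
apply: (congr1 EFin).
rewrite (beC ha hp) (beC hb hq) (beC ha hq) (beC hb hp).
by move: (be p a) (be q b) (be q a) (be p b) => x1 x2 x3 x4; ring.
Qed.

Lemma signed_cov_fin u v : signed_moderate u -> signed_moderate v -> cov f u v \is a fin_num.
Proof. by move=> [a [b [ha hb ->]]] [p [q [hp hq ->]]]; rewrite (cov_be ha hb hp hq). Qed.

Lemma signed_moderateD u v : signed_moderate u -> signed_moderate v ->
  signed_moderate (fun z => u z + v z)%R.
Proof.
move=> [a [b [ha hb ->]]] [p [q [hp hq ->]]].
exists (fun z => a z + p z)%R, (fun z => b z + q z)%R; split; [exact: moderateD|exact: moderateD|].
by apply/funext => z; ring.
Qed.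

Lemma signed_moderateZ c u : signed_moderate u -> signed_moderate (fun z => c * u z)%R.
Proof.
move=> [a [b [ha hb ->]]]; have [c0|c0] := leP 0%R c.
  exists (fun z => c * a z)%R, (fun z => c * b z)%R; split; [exact: moderateZ|exact: moderateZ|].
  by apply/funext => z; ring.
have nc : (0 <= - c)%R by rewrite oppr_ge0 ltW.
exists (fun z => (- c) * b z)%R, (fun z => (- c) * a z)%R.
split; [exact: moderateZ|exact: moderateZ|].
by apply/funext => z; ring.
Qed.

Lemma signed_covD u v w : signed_moderate u -> signed_moderate v -> signed_moderate w ->
  cov f (fun z => u z + v z)%R w = cov f u w + cov f v w.
Proof.
move=> [a [b [ha hb ->]]] [p [q [hp hq ->]]] [c [e [hc he ->]]].
have -> : (fun z => a z - b z + (p z - q z))%R = (fun z => (a z + p z) - (b z + q z))%R.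
  by apply/funext => z; ring.
have hap := moderateD ha hp; have hbq := moderateD hb hq.
rewrite (cov_be hap hbq hc he) (cov_be ha hb hc he) (cov_be hp hq hc he).
rewrite (beD ha hp hc) (beD hb hq he) (beD ha hp he) (beD hb hq hc) -EFinD; apply: (congr1 EFin).
by move: (be a c) (be p c) (be b e) (be q e) (be a e) (be p e) (be b c) (be q c) => *; ring.
Qed.

Lemma signed_covZ c u w : signed_moderate u -> signed_moderate w ->
  cov f (fun z => c * u z)%R w = c%:E * cov f u w.
Proof.
move=> [a [b [ha hb ->]]] [p [q [hp hq ->]]]; have [c0|c0] := leP 0%R c.
  have -> : (fun z => c * (a z - b z))%R = (fun z => c * a z - c * b z)%R.
    by apply/funext => z; ring.
  have hca := moderateZ c0 ha; have hcb := moderateZ c0 hb.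
  rewrite (cov_be hca hcb hp hq) (cov_be ha hb hp hq).
  rewrite (beZ c0 ha hp) (beZ c0 hb hq) (beZ c0 ha hq) (beZ c0 hb hp) -EFinM; apply: (congr1 EFin).
  by move: (be a p) (be b q) (be a q) (be b p) => *; ring.
have nc : (0 <= - c)%R by rewrite oppr_ge0 ltW.
have -> : (fun z => c * (a z - b z))%R = (fun z => (- c) * b z - (- c) * a z)%R.
  by apply/funext => z; ring.
have hca := moderateZ nc ha; have hcb := moderateZ nc hb.
rewrite (cov_be hcb hca hp hq) (cov_be ha hb hp hq).
rewrite (beZ nc ha hp) (beZ nc hb hq) (beZ nc ha hq) (beZ nc hb hp) -EFinM; apply: (congr1 EFin).
by move: (be a p) (be b q) (be a q) (be b p) => *; ring.
Qed.

End signed_bilinear.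

Section test_moderate.
Context (R : realType).
Implicit Types phi : spacetime R -> R.

Lemma test_function_measurable phi : test_function phi -> measurable_fun setT phi.
Proof. by move=> [/(_ 0%N) c _]; exact: continuous_spacetime_measurable. Qed.

Lemma test_function_bounded phi : test_function phi -> exists N : nat, forall z,
  `|phi z| <= N%:R /\ (phi z != 0 -> [/\ `|z.1| <= N%:R, `|z.2.1| < N%:R & `|z.2.2| < N%:R]).
Proof.
move=> [/(_ 0%N) /= c cpt].
have supp z : phi z != 0 -> closure [set z | phi z != 0] z by move=> h; exact: subset_closure.
have [B [_ hB]] := compact_bounded cpt.
have cI : compact (phi @` closure [set z | phi z != 0]).
  by apply: continuous_compact => //; exact: continuous_subspaceT.
have [D [_ hD]] := compact_bounded cI.
pose b := Num.max B 0 + 1; pose e := Num.max D 0 + 1.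
have bB : B < b by rewrite /b (@le_lt_trans _ _ (Num.max B 0)) ?le_max ?lexx// ltrDl.
have eD : D < e by rewrite /e (@le_lt_trans _ _ (Num.max D 0)) ?le_max ?lexx// ltrDl.
have b0 : 0 <= b by rewrite addr_ge0// le_max lexx orbT.
have e0 : 0 <= e by rewrite addr_ge0// le_max lexx orbT.
exists (Num.truncn (b + e)).+1 => z.
have hN : b + e < (Num.truncn (b + e)).+1%:R by exact: truncnS_gt.
have bN : b < (Num.truncn (b + e)).+1%:R by apply: le_lt_trans hN; rewrite lerDl.
have eN : e < (Num.truncn (b + e)).+1%:R by apply: le_lt_trans hN; rewrite lerDr.
have [->|zn] := eqVneq (phi z) 0; first by rewrite normr0 ler0n.
split.
  apply: le_trans (ltW eN); apply: (hD e eD) => /=.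
  by exists z => //; exact: supp.
move=> _; have := hB b bB z (supp z zn); rewrite /= prod_normE !ge_max.
move=> /andP[h1 /andP[h2 h3]].
by split; [exact: le_trans h1 (ltW bN)|exact: le_lt_trans h2 bN|exact: le_lt_trans h3 bN].
Qed.

Lemma moderate_part (phi : spacetime R -> R) (N : nat) : measurable_fun setT phi ->
  (forall z, `|phi z| <= N%:R /\
    (phi z != 0 -> [/\ `|z.1| <= N%:R, `|z.2.1| < N%:R & `|z.2.2| < N%:R])) ->
  moderate (fun z => Num.max (phi z) 0).
Proof.
move=> mphi hN; split; first by split; [mfun|move=> z; rewrite le_max lexx orbT].
exists N => z; have [h1 h2] := hN z; split.
  by rewrite ge_max ler0n andbT; exact: le_trans (ler_norm _) h1.
move=> hz; have pz : phi z != 0 by apply: contraNneq hz => ->; rewrite maxxx.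
have [k1 k2 k3] := h2 pz; split=> //.
move: k2 k3; rewrite !ltr_norml /in_box => /andP[/ltW -> ->] /andP[/ltW -> ->].
by [].
Qed.

Lemma test_function_signed_moderate phi : test_function phi -> signed_moderate phi.
Proof.
move=> tp; have mp := test_function_measurable tp.
have [N hN] := test_function_bounded tp.
exists (fun z => Num.max (phi z) 0), (fun z => Num.max (- phi z) 0); split.
- exact: moderate_part mp hN.
- apply: (@moderate_part (fun z => - phi z) N); first by mfun.
  by move=> z; rewrite normrN oppr_eq0.
- apply/funext => z; have [p0|p0] := leP 0 (phi z).
    by rewrite max_r ?subr0// oppr_le0.
  by rewrite max_l ?sub0r ?opprK// oppr_ge0 ltW.
Qed.

End test_moderate.

Section combinations.
Context d (Omega : measurableType d) (R : realType) (P : probability Omega R).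
Context (f : R -> R) (F : (spacetime R -> R) -> {RV P >-> R}).
Hypothesis f_ge0 : forall r : R, (0 <= r)%R -> (0 <= f r)%R.
Hypothesis f_cont : forall r : R, (0 < r)%R -> {for r, continuous f}.
Local Notation PL := (plane_measure R).
Local Open Scope ereal_scope.
Hypothesis f_loc : forall l : R, (0 < l)%R -> exists2 Q : R, (0 <= Q)%R &
  \int[PL]_z (if (enorm z <= l)%R then f (enorm z) else 0%R)%:E <= Q%:E.
Hypothesis F_noise : gaussian_noise f F.

Lemma moderate_pos u : @signed_moderate R u -> moderate (fun z => Num.max (u z) 0%R).
Proof.
move=> [a [b [[[ma a0] [N hN]] [[mb b0] _] ->]]]; split.
  by split; [mfun|move=> z; rewrite le_max lexx orbT].
exists N => z; have [h1 h2] := hN z; split.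
  by rewrite ge_max ler0n andbT; apply: le_trans h1; rewrite gerBl.
move=> hz; apply: h2; apply: contraNneq hz => ->; rewrite sub0r max_r//.
by rewrite oppr_le0.
Qed.

(** With [p] and [q] the positive and negative parts of [u], the left-hand side is
    [K(p, p) + K(q, q) - 2 K(p, q)], and the right-hand side has the opposite sign
    for the cross term, which is nonnegative because the kernel is. *)
Lemma signed_cov_le_dom_norm2 u : signed_moderate u -> cov f u u <= dom_norm2 f u.
Proof.
move=> hu; pose p z := Num.max (u z) 0%R; pose q z := Num.max (- u z)%R 0%R.
have hp : moderate p by exact: moderate_pos.
have hq : moderate q.
  have := moderate_pos (signed_moderateZ (-1) hu).
  by rewrite (_ : (fun z => _) = q)//; apply/funext => z; rewrite mulN1r.
have [np _] := hp; have [nq _] := hq.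
have e1 : u = (fun z => p z - q z)%R.
  apply/funext => z; rewrite /p /q; have [p0|p0] := leP 0%R (u z).
    by rewrite max_r ?subr0// oppr_le0.
  by rewrite max_l ?sub0r ?opprK// oppr_ge0 ltW.
have e2 : (fun z => `|u z|)%R = (fun z => p z + q z)%R.
  apply/funext => z; rewrite /p /q; have [p0|p0] := leP 0%R (u z).
    by rewrite max_r ?addr0 ?ger0_norm// oppr_le0.
  by rewrite max_l ?add0r ?ltr0_norm// oppr_ge0 ltW.
have npq := nnstD np nq.
have c0 a b : nnst a -> nnst b -> 0 <= cov f a b by exact: cov_ge0.
have h1 : cov f u u = (cov f p p + cov f q q) - (cov f p q + cov f q p).
  rewrite {1 2}e1; exact: (cov_difference f_ge0 f_cont f_loc hp hq hp hq).
have h2 : dom_norm2 f u = (cov f p p + cov f q q) + (cov f p q + cov f q p).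
  rewrite /dom_norm2 e2 (covD f_ge0 f_cont np nq npq).
  rewrite (cov_sym f_ge0 f_cont np npq) (cov_sym f_ge0 f_cont nq npq).
  rewrite (covD f_ge0 f_cont np nq np) (covD f_ge0 f_cont np nq nq).
  move: (cov f p p) (cov f q p) (cov f p q) (cov f q q) => x y z w.
  by rewrite (addeC z w) addeACA (addeC y z).
rewrite h1 h2; apply: leeD2l.
have k0 := adde_ge0 (c0 _ _ np nq) (c0 _ _ nq np).
by apply: (le_trans _ k0); rewrite oppe_le0.
Qed.

Lemma signed_moderate_sum (I : Type) (s : seq I) (c : I -> R) (phi : I -> spacetime R -> R) :
  (forall i, signed_moderate (phi i)) ->
  signed_moderate (fun z => \sum_(i <- s) c i * phi i z)%R.
Proof.
move=> hphi; elim: s => [|i s IH].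
  have z0 : @moderate R (fun=> 0%R).
    split; first by split.
    by exists 0%N => z; split => //; rewrite eqxx.
  exists (fun=> 0%R), (fun=> 0%R); split=> //.
  by apply/funext => z; rewrite big_nil subr0.
have := signed_moderateD (signed_moderateZ (c i) (hphi i)) IH.
by rewrite (_ : (fun z => _ + _)%R = (fun z => \sum_(j <- i :: s) c j * phi j z)%R)//;
  apply/funext => z; rewrite big_cons.
Qed.

Lemma signed_cov_suml (I : Type) (s : seq I) (c : I -> R) (phi : I -> spacetime R -> R) w :
  (forall i, signed_moderate (phi i)) -> signed_moderate w ->
  cov f (fun z => \sum_(i <- s) c i * phi i z)%R w =
  (\sum_(i <- s) c i * fine (cov f (phi i) w))%R%:E.
Proof.
move=> hphi hw; elim: s => [|i s IH].
  have := signed_covZ f_ge0 f_cont f_loc 0%R hw hw.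
  rewrite mul0e big_nil (_ : (fun z => 0 * w z)%R = (fun z => \sum_(i <- [::]) c i * phi i z)%R)//.
  by apply/funext => z; rewrite mul0r big_nil.
have hs := signed_moderate_sum s c hphi; have hi := signed_moderateZ (c i) (hphi i).
have e : (fun z => \sum_(j <- i :: s) c j * phi j z)%R =
    (fun z => c i * phi i z + \sum_(j <- s) c j * phi j z)%R.
  by apply/funext => z; rewrite big_cons.
rewrite e; apply: etrans (signed_covD f_ge0 f_cont f_loc hi hs hw) _.
apply: etrans (congr2 (fun r s : \bar R => r + s)
  (signed_covZ f_ge0 f_cont f_loc (c i) (hphi i) hw) IH) _.
rewrite big_cons EFinD EFinM fineK//.
exact: (signed_cov_fin f_ge0 f_cont f_loc (hphi i) hw).
Qed.

(** The second moment is the covariance of the combination with itself. *)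
Lemma combination_second_moment (I : finType) (c : I -> R) (phi : I -> spacetime R -> R) :
  (forall i, test_function (phi i)) ->
  'E_P[(fun w => (\sum_i c i * F (phi i) w) ^+ 2)%R] <=
  dom_norm2 f (fun z => \sum_i c i * phi i z)%R.
Proof.
move=> tp; have [_ F2 _ Fcov] := F_noise.
have hphi i : signed_moderate (phi i) by exact: test_function_signed_moderate.
have hs := signed_moderate_sum (index_enum I) c hphi.
apply: le_trans (signed_cov_le_dom_norm2 hs).
have hF i : (F (phi i) : Omega -> R) \in Lfun P 2%:E by exact: F2.
have e1 := expectation_bilinear (index_enum I) (index_enum I) c c hF hF.
have -> : (fun w => (\sum_i c i * F (phi i) w) ^+ 2)%R =
    (fun w => (\sum_i c i * F (phi i) w) * (\sum_i c i * F (phi i) w))%R.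
  by apply/funext => w; rewrite expr2.
rewrite e1 (signed_cov_suml _ _ hphi hs) lee_fin le_eqVlt; apply/orP; left; apply/eqP.
apply: eq_bigr => i _; rewrite (signed_cov_sym f_ge0 f_cont f_loc (hphi i) hs).
rewrite (signed_cov_suml _ _ hphi (hphi i)) /= mulr_sumr; apply: eq_bigr => j _.
have e := etrans (Fcov _ _ (tp i) (tp j)) (signed_cov_sym f_ge0 f_cont f_loc (hphi i) (hphi j)).
exact: (etrans (congr1 (fun r => c i * c j * fine r)%R e) (esym (mulrA _ _ _))).
Qed.

End combinations.

(** * Gaussian tails *)

Section normal_tail.
Context (R : realType).
Local Notation L := (@lebesgue_measure R).
Implicit Types m s l x : R.

Lemma normal_peak_sqrt2 s : s != 0 ->
  normal_peak s = Num.sqrt 2 * normal_peak (Num.sqrt 2 * s).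
Proof.
move=> s0; rewrite /normal_peak.
have -> : (Num.sqrt 2 * s) ^+ 2 * pi *+ 2 = 2 * (s ^+ 2 * pi *+ 2) :> R.
  by rewrite exprMn sqr_sqrtr//; ring.
by rewrite sqrtrM// invfM mulrA divff ?mul1r.
Qed.

(** Half of the exponent is bounded by its value at distance [l] from the mean; the
    other half is, up to a factor [sqrt 2 <= 2], the density with [sqrt 2] times the
    deviation. *)
Lemma normal_pdf_spread m s l x : s != 0 -> 0 <= l -> l <= `|x - m| ->
  normal_pdf m s x <= 2 * expR (- (l ^+ 2 / (4 * s ^+ 2))) * normal_pdf m (Num.sqrt 2 * s) x.
Proof.
move=> s0 l0 lx; have q0 : Num.sqrt 2 != 0 :> R by rewrite gt_eqF// sqrtr_gt0.
have sq0 : Num.sqrt 2 * s != 0 by rewrite mulf_neq0.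
have s2 : 0 < s ^+ 2 by rewrite exprn_even_gt0.
rewrite !normal_pdfE// (normal_peak_sqrt2 s0) /normal_fun exprMn sqr_sqrtr//.
have pk := normal_peak_ge0 (Num.sqrt 2 * s).
have q2 : Num.sqrt 2 <= 2 :> R.
  rewrite -[leRHS]ger0_norm// -sqrtr_sqr ler_wsqrtr//; lra.
set d2 := (x - m) ^+ 2; have ld : l ^+ 2 <= d2.
  by rewrite /d2 -[leRHS]real_normK ?num_real// lerXn2r// nnegrE.
have e1 : - d2 / (s ^+ 2 *+ 2) = - (d2 / (4 * s ^+ 2)) + - d2 / (2 * s ^+ 2 *+ 2).
  by field; rewrite ?s0 ?andbT.
rewrite e1 expRD.
have hE : expR (- (d2 / (4 * s ^+ 2))) <= expR (- (l ^+ 2 / (4 * s ^+ 2))).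
  by rewrite ler_expR lerN2 ler_pM2r// invr_gt0 mulr_gt0.
have rearrange (q p A C : R) : q * p * (A * C) = q * A * (p * C) by ring.
rewrite rearrange ler_wpM2r ?mulr_ge0 ?expR_ge0//.
by rewrite ler_pM ?sqrtr_ge0 ?expR_ge0.
Qed.

(** Integrate [normal_pdf_spread]; the wider density has mass 1. *)
Lemma normal_tail m s l : s != 0 -> 0 <= l ->
  (normal_prob m s [set x | (l <= `|x - m|)%R] <= (2 * expR (- (l ^+ 2 / (4 * s ^+ 2))))%:E)%E.
Proof.
move=> s0 l0; set k := 2 * expR _.
have k0 : 0 <= k by rewrite mulr_ge0 ?expR_ge0.
have mV : measurable [set x : R | l <= `|x - m|].
  rewrite -[X in measurable X]setTI.
  have mb : measurable_fun setT (fun x : R => l <= `|x - m|) by mfun.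
  by have := mb measurableT [set true]; apply.
have mpdf s' : measurable_fun setT (fun x => (normal_pdf m s' x)%:E).
  by apply: mf_EFin; exact: measurable_normal_pdf.
have p0 s' x : (0 <= (normal_pdf m s' x)%:E)%E by rewrite lee_fin normal_pdf_ge0.
rewrite /normal_prob; apply: (@le_trans _ _
    (\int[L]_(x in [set x : R | (l <= `|x - m|)%R]) (k%:E * (normal_pdf m (Num.sqrt 2 * s)%R x)%:E))%E).
  apply: ge0_le_integral => //.
  - exact: (measurable_funTS (mpdf s)).
  - apply: measurable_funTS; apply: mf_emul; first exact: measurable_cst.
    exact: (mpdf (Num.sqrt 2 * s)).
  - by move=> x lx; rewrite -EFinM lee_fin; exact: normal_pdf_spread.
apply: (@le_trans _ _ (\int[L]_x (k%:E * (normal_pdf m (Num.sqrt 2 * s)%R x)%:E))%E).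
  apply: ge0_subset_integral => //.
  - by apply: mf_emul; [exact: measurable_cst|exact: (mpdf (Num.sqrt 2 * s))].
  - by move=> x _; rewrite mule_ge0.
rewrite (leb_mull k0 (p0 _) (mpdf _)) (integral_normal_pdf m (Num.sqrt 2 * s)).
by rewrite mule1.
Qed.

Lemma normal_concentration m s r : s != 0 -> 0 <= r ->
  (normal_prob m s [set x | (`|x| < r)%R] <= (2 * r * normal_peak s)%:E)%E.
Proof.
move=> s0 r0; have pk := normal_peak_ge0 s.
have mV : measurable [set x : R | `|x| < r].
  rewrite -[X in measurable X]setTI.
  have mb : measurable_fun setT (fun x : R => `|x| < r) by mfun.
  by have := mb measurableT [set true]; apply.
have mpdf : measurable_fun setT (fun x => (normal_pdf m s x)%:E).
  by apply: mf_EFin; exact: measurable_normal_pdf.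
rewrite /normal_prob; apply: (@le_trans _ _
    (\int[L]_(x in [set x : R | (`|x| < r)%R]) (normal_peak s)%:E)%E).
  apply: ge0_le_integral => //.
  - by move=> x _; rewrite lee_fin normal_pdf_ge0.
  - exact: (measurable_funTS mpdf).
  - by move=> x _; rewrite lee_fin normal_pdf_ub.
rewrite integral_cst// EFinM muleC; apply: lee_wpmul2r; first by rewrite lee_fin.
rewrite (_ : [set x : R | `|x| < r] = `]- r, r[%classic); last first.
  by apply/seteqP; split=> x /=; rewrite in_itv/= ltr_norml.
apply: (@le_trans _ _ (L `]- r, r[%classic)); first exact: lexx.
have -> : L `]- r, r[%classic = (if (- r < r)%R then r%:E - (- r)%:E else 0)%E.
  by rewrite lebesgue_measure_itv/= lte_fin.
by case: ifP => _; rewrite -?EFinD lee_fin; lra.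
Qed.

End normal_tail.

Lemma measurable_ge_norm d (T : measurableType d) (R : realType) (Z : T -> R) (l : R) :
  measurable_fun setT Z -> measurable [set w | l <= `|Z w|].
Proof.
move=> mZ; rewrite -[X in measurable X]setTI.
have mb : measurable_fun setT (fun w => l <= `|Z w|) by mfun.
by have := mb measurableT [set true]; apply.
Qed.

Section gaussian_tail.
Context d (Omega : measurableType d) (R : realType) (P : probability Omega R).
Implicit Types Z : Omega -> R.

Lemma second_moment_chebyshev Z l : measurable_fun setT Z -> 0 <= l ->
  ((l ^+ 2)%:E * P [set w | (l <= `|Z w|)%R] <= 'E_P[fun w => (Z w ^+ 2)%R])%E.
Proof.
move=> mZ l0; have mA := measurable_ge_norm l mZ.
have mZ2 : measurable_fun setT (fun w => (Z w ^+ 2)%:E) by apply: mf_EFin; mfun.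
rewrite unlock -integral_cst//.
apply: (@le_trans _ _ (\int[P]_(w in [set w | (l <= `|Z w|)%R]) (Z w ^+ 2)%:E)%E).
  apply: ge0_le_integral => //.
  - by move=> w _; rewrite lee_fin sqr_ge0.
  - exact: (measurable_funTS mZ2).
  - move=> w /= lw; rewrite lee_fin -[leRHS]real_normK ?num_real//.
    by rewrite lerXn2r// nnegrE.
apply: ge0_subset_integral => //.
by move=> w _; rewrite lee_fin sqr_ge0.
Qed.

Let half_mass (A : set Omega) (v c : R) : measurable A -> 0 <= c ->
  (c%:E * P A <= v%:E)%E -> (2^-1%:E <= P A)%E -> c <= 2 * v.
Proof.
move=> mA c0 h hA.
have : ((c * 2^-1)%:E <= v%:E)%E.
  by apply: le_trans h; rewrite EFinM; apply: lee_wpmul2l.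
by rewrite lee_fin; lra.
Qed.

Let compl_mass (A B : set Omega) : measurable A -> measurable B -> (forall w, A w \/ B w) ->
  (P B <= 2^-1%:E)%E -> (2^-1%:E <= P A)%E.
Proof.
move=> mA mB AB hB.
have h1 : (1 <= P A + P B)%E.
  rewrite -(probability_setT P); apply: le_trans (measureU2 _ mA mB).
  by apply: le_measure; rewrite ?inE//; [exact: measurableU|move=> w _; exact: AB].
have : (1 <= P A + 2^-1%:E)%E by apply: le_trans h1 _; exact: leeD2l.
have [_ fA] : (0 <= P A)%E /\ (P A \is a fin_num)%E by rewrite fin_num_measure.
rewrite -(fineK fA) -EFinD !lee_fin; lra.
Qed.

(** Chebyshev's inequality bounds [l ^ 2] by [2 * v] as soon as [`|Z| >= l] has
    probability at least 1/2.  This holds for [l = `|s| / 2], because the density is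
    bounded by its peak, and for [l = `|m| / 2] when [`|m| > 8 * `|s|], because [Z] is then
    concentrated near [m]. *)
Lemma gaussian_moment_bounds Z (m s v : R) : measurable_fun setT Z -> s != 0 ->
  (forall V, measurable V -> P (Z @^-1` V) = normal_prob m s V) ->
  ('E_P[fun w => (Z w ^+ 2)%R] <= v%:E)%E -> s ^+ 2 <= 8 * v /\ m ^+ 2 <= 8 * 64 * v.
Proof.
move=> mZ s0 hZ hv; have s2 : 0 < s ^+ 2 by rewrite exprn_even_gt0.
have mge (l : R) : measurable ([set x : R | l <= `|x|] : set R).
  by apply: (measurable_ge_norm (Z := fun x : R => x)); mfun.
have cheb l : 0 <= l -> ((l ^+ 2)%:E * P [set w | (l <= `|Z w|)%R] <= v%:E)%E.
  by move=> l0; apply: le_trans (second_moment_chebyshev mZ l0) hv.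
have sE : s ^+ 2 = `|s| ^+ 2 by rewrite real_normK ?num_real.
have s0' : 0 < `|s| by rewrite normr_gt0.
have b1 : s ^+ 2 <= 8 * v.
  have hs0 : 0 <= `|s| / 2 by rewrite divr_ge0.
  have c1 := cheb _ hs0.
  suff : (`|s| / 2) ^+ 2 <= 2 * v by rewrite sE exprMn; lra.
  apply: half_mass (measurable_ge_norm _ mZ) _ c1 _; first exact: sqr_ge0.
  have mlt : measurable [set w | `|Z w| < `|s| / 2].
    rewrite -[X in measurable X]setTI.
    have mb : measurable_fun setT (fun w => `|Z w| < `|s| / 2) by mfun.
    by have := mb measurableT [set true]; apply.
  apply: compl_mass mlt _ _; first exact: measurable_ge_norm.
    by move=> w /=; have [h|h] := leP (`|s| / 2) `|Z w|; [left|right].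
  have mVlt : measurable [set x : R | `|x| < `|s| / 2].
    rewrite -[X in measurable X]setTI.
    have mb : measurable_fun setT (fun x : R => `|x| < `|s| / 2) by mfun.
    by have := mb measurableT [set true]; apply.
  have := hZ _ mVlt; rewrite /preimage /= => ->.
  apply: le_trans (normal_concentration m s0 hs0) _; rewrite lee_fin.
  have -> : 2 * (`|s| / 2) = `|s| by lra.
  rewrite /normal_peak.
  have pk : 2 * `|s| <= Num.sqrt (s ^+ 2 * pi *+ 2).
    rewrite -[leLHS]ger0_norm ?mulr_ge0// -sqrtr_sqr ler_wsqrtr// exprMn -sE.
    have := @pi_ge2 R; nra.
  rewrite ler_pdivrMr; last by apply: lt_le_trans pk; rewrite mulr_gt0.
  by move: pk; lra.
split=> //; have [ms|ms] := leP `|m| (8 * `|s|).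
  have : m ^+ 2 <= (8 * `|s|) ^+ 2.
    by rewrite -[leLHS]real_normK ?num_real// lerXn2r// nnegrE mulr_ge0.
  by rewrite exprMn -sE; lra.
have hm0 : 0 <= `|m| / 2 by rewrite divr_ge0.
have c1 := cheb _ hm0.
suff : (`|m| / 2) ^+ 2 <= 2 * v.
  by rewrite exprMn real_normK ?num_real//; lra.
apply: half_mass (measurable_ge_norm _ mZ) _ c1 _; first exact: sqr_ge0.
have mZm : measurable_fun setT (fun w => Z w - m) by mfun.
apply: (@compl_mass _ [set w | 4 * `|s| <= `|Z w - m|]).
- exact: measurable_ge_norm.
- exact: measurable_ge_norm.
- move=> w /=; have [h|h] := leP (4 * `|s|) `|Z w - m|; [by right|left].
  have := ler_distD (Z w) m 0; rewrite !subr0 (distrC m) => hd.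
  by move: h hd ms; lra.
have mV : measurable [set x : R | 4 * `|s| <= `|x - m|].
  by apply: (measurable_ge_norm (Z := fun x : R => x - m)); mfun.
have := hZ _ mV; rewrite /preimage /= => ->.
have l0 : 0 <= 4 * `|s| by rewrite mulr_ge0.
apply: le_trans (normal_tail m s0 l0) _; rewrite lee_fin.
have -> : (4 * `|s|) ^+ 2 / (4 * s ^+ 2) = 4.
  by rewrite exprMn -sE; field; rewrite s0.
rewrite expRN ler_pdivrMr ?expR_gt0//.
have := expR_ge1Dx (4 : R); lra.
Qed.

(** If [l] is at most twice the mean, the exponent is bounded, since the second
    moment controls the mean, and the factor 2 makes the claim trivial.  Otherwise
    [`|Z| >= l] forces a deviation of at least [l / 2] from the mean. *)
Lemma gaussian_tail : exists2 K : R, 0 < K & forall Z (v l : R),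
  measurable_fun setT Z -> gaussian_rv P Z -> 0 < v -> 0 < l ->
  ('E_P[fun w => (Z w ^+ 2)%R] <= v%:E)%E ->
  (P [set w | (l <= `|Z w|)%R] <= (2 * expR (- (l ^+ 2 / (K * v))))%:E)%E.
Proof.
have K0 : 0 < 8 * (8 * 64) :> R by rewrite !mulr_gt0 ?ltr0n.
exists (8 * (8 * 64)) => //; move: K0; move KE : (8 * (8 * 64)) => K K0.
move=> Z v l mZ [m [s hZ]] v0 l0 hv.
have small : l ^+ 2 <= 4 * (8 * 64 * v) ->
    (P [set w | (l <= `|Z w|)%R] <= (2 * expR (- (l ^+ 2 / (K * v))))%:E)%E.
  move=> lv; apply: le_trans (probability_le1 P (measurable_ge_norm l mZ)) _.
  rewrite lee_fin; have := expR_ge1Dx (- (l ^+ 2 / (K * v))).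
  have : l ^+ 2 / (K * v) <= 2^-1.
    by rewrite ler_pdivrMr ?mulr_gt0//; apply: (le_trans lv); rewrite -KE; lra.
  move: (l ^+ 2 / (K * v)) (expR _) => x y.
  by lra.
have mge (r : R) (h : R -> R) : measurable_fun setT h -> measurable [set x : R | r <= `|h x|].
  by move=> mh; exact: (measurable_ge_norm (Z := h)).
(* The degenerate law is a Dirac mass at the mean. *)
have [s0|s0] := eqVneq s 0.
  have hd V : measurable V -> P (Z @^-1` V) = \d_ m V by move=> mV; rewrite hZ// s0 eqxx.
  have m2 : m ^+ 2 <= v.
    have := second_moment_chebyshev mZ (normr_ge0 m).
    have := hd _ (mge `|m| id (@measurable_id _ _ setT)); rewrite /preimage /= => ->.
    rewrite diracE mem_set//= mule1 real_normK ?num_real// => h.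
    by rewrite -lee_fin; exact: le_trans h hv.
  have [lm|ml] := leP l `|m|.
    apply: small; apply: (@le_trans _ _ v); last by lra.
    apply: le_trans m2; rewrite -[leRHS]real_normK ?num_real//.
    by rewrite lerXn2r// nnegrE// ltW.
  have := hd _ (mge l id (@measurable_id _ _ setT)); rewrite /preimage /= => ->.
  rewrite diracE memNset/=; first by rewrite lee_fin mulr_ge0 ?expR_ge0.
  by apply/negP; rewrite -ltNge.
have {}hZ V : measurable V -> P (Z @^-1` V) = normal_prob m s V.
  by move=> mV; rewrite hZ// (negbTE s0).
have [b1 b2] := gaussian_moment_bounds mZ s0 hZ hv.
have s2 : 0 < s ^+ 2 by rewrite exprn_even_gt0.
have [lm|ml] := leP l (2 * `|m|).
  apply: small; apply: (@le_trans _ _ ((2 * `|m|) ^+ 2)).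
    by rewrite lerXn2r ?nnegrE ?mulr_ge0 ?(ltW l0).
  by rewrite exprMn real_normK ?num_real//; lra.
have h0 : 0 <= l / 2 by rewrite divr_ge0// ltW.
apply: (@le_trans _ _ (P [set w | (l / 2 <= `|Z w - m|)%R])).
  apply: le_measure; rewrite ?inE.
  - exact: measurable_ge_norm.
  - by apply: measurable_ge_norm; mfun.
  - move=> w /= lw; have := ler_distD m (Z w) 0; rewrite !subr0 => hd.
    by move: lw hd ml; lra.
have := hZ _ (mge (l / 2) (fun x => x - m) (mf_add (@measurable_id _ _ setT) (@measurable_cst _ _ _ _ setT (- m)))).
rewrite /preimage /= => ->.
apply: le_trans (normal_tail m s0 h0) _; rewrite lee_fin ler_pM2l// ler_expR lerN2.
have h4 : 0 < 4 * s ^+ 2 by apply: mulr_gt0.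
have hK : 0 < K * v by apply: mulr_gt0.
rewrite ler_pdivrMr// mulrAC ler_pdivlMr//.
have -> : (l / 2) ^+ 2 * (K * v) = l ^+ 2 * (K / 4 * v) by field.
apply: ler_wpM2l; first exact: sqr_ge0.
by rewrite -KE; lra.
Qed.

End gaussian_tail.

Lemma eventually_small (R : realType) (x : nat -> \bar R) (e : R) : 0 < e ->
  x n @[n --> \oo] --> 0%E -> exists n0, forall n, (n0 <= n)%N -> (x n <= e%:E)%E.
Proof.
move=> e0 cx.
have : nbhs (0%E : \bar R) [set y | (y < e%:E)%E].
  by apply: open_nbhs_nbhs; split; [exact: open_ereal_lt_ereal|rewrite /= lte_fin].
move=> /cx [n0 _ hn]; exists n0 => n n0n; apply: ltW; exact: (hn n n0n).
Qed.

(** * Stochastic integrals as limits of Gaussian combinations *)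

Section approximation.
Context d (Omega : measurableType d) (R : realType) (P : probability Omega R).
Context (f : R -> R) (F : (spacetime R -> R) -> {RV P >-> R}).
Hypothesis f_ge0 : forall r : R, (0 <= r)%R -> (0 <= f r)%R.
Hypothesis f_cont : forall r : R, (0 < r)%R -> {for r, continuous f}.
Hypothesis f_small : locally_small f.
Hypothesis F_noise : gaussian_noise f F.
Local Open Scope ereal_scope.
Implicit Types (g h : spacetime R -> R) (Y Z : Omega -> R).

Let f_pos : positive_on_bumps f := noise_positive_on_bumps f_ge0 f_cont F_noise.

Definition sqnorm Y : \bar R := 'E_P[(fun w => Y w ^+ 2)%R].

Lemma sqnormE Y : sqnorm Y = \int[P]_w (Y w ^+ 2)%:E.
Proof. by rewrite /sqnorm unlock. Qed.

Lemma sqnorm_quasi_triangle Y Z : measurable_fun setT Y -> measurable_fun setT Z ->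
  sqnorm (fun w => Y w + Z w)%R <= 2%:E * sqnorm Y + 2%:E * sqnorm Z.
Proof.
move=> mY mZ; rewrite !sqnormE.
have m2 (W : Omega -> R) : measurable_fun setT W ->
    measurable_fun setT (fun w => (W w ^+ 2)%:E).
  by move=> mW; apply: mf_EFin; mfun.
have p2 (W : Omega -> R) w : setT w -> 0 <= (W w ^+ 2)%:E by rewrite lee_fin sqr_ge0.
have t0 : (0 <= 2 :> R)%R by [].
have sc (W : Omega -> R) : measurable_fun setT W ->
    \int[P]_w (2%:E * (W w ^+ 2)%:E) = 2%:E * \int[P]_w (W w ^+ 2)%:E.
  move=> mW; apply: ge0_integralZl_EFin => //; last exact: m2.
  by move=> w _; rewrite lee_fin sqr_ge0.
have q2 (W : Omega -> R) w : setT w -> 0 <= 2%:E * (W w ^+ 2)%:E.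
  by rewrite -EFinM lee_fin mulr_ge0// sqr_ge0.
have n2 (W : Omega -> R) : measurable_fun setT W ->
    measurable_fun setT (fun w => 2%:E * (W w ^+ 2)%:E).
  by move=> mW; apply: mf_emul; [exact: measurable_cst|exact: m2].
rewrite -(sc _ mY) -(sc _ mZ).
have eD := ge0_integralD P measurableT (q2 Y) (n2 _ mY) (q2 Z) (n2 _ mZ).
rewrite -eD.
apply: ge0_le_integral => //.
- by move=> w _; rewrite lee_fin sqr_ge0.
- by apply: m2; mfun.
- by apply: mf_eadd; exact: n2.
- move=> w _; rewrite -!EFinM -EFinD lee_fin.
  by have := sqr_ge0 (Y w - Z w)%R; nra.
Qed.

Lemma sqnormZ c Y : measurable_fun setT Y -> sqnorm (fun w => c * Y w)%R = (c ^+ 2)%:E * sqnorm Y.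
Proof.
move=> mY; rewrite !sqnormE.
have <- : \int[P]_w ((c ^+ 2)%:E * (Y w ^+ 2)%:E) = (c ^+ 2)%:E * \int[P]_w (Y w ^+ 2)%:E.
  apply: ge0_integralZl_EFin => //; last exact: sqr_ge0.
    by move=> w _; rewrite lee_fin sqr_ge0.
  by apply: mf_EFin; mfun.
by apply: eq_integral => w _; rewrite exprMn EFinM.
Qed.

(** A finite combination of the noise that approximates the integrand [g] in the
    dominating norm and, with the same coefficients, the variable [Y] in L^2. *)
Definition close_combination g Y (e : R) := exists (I : finType) (c : I -> R)
    (phi : I -> spacetime R -> R),
  [/\ forall i, test_function (phi i),
      dom_norm2 f (fun z => \sum_i c i * phi i z - g z)%R <= e%:E &
      sqnorm (fun w => \sum_i c i * F (phi i) w - Y w)%R <= e%:E].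

(** [Y] is a version of the integral of [g].  Unlike a limit along one sequence, this
    formulation is stable under sums, multiples and limits, and serves both extensions of
    the noise, to indicator functions and to Walsh integrands. *)
Definition represents g Y := [/\ measurable_fun setT g, measurable_fun setT Y &
  forall e : R, (0 < e)%R -> close_combination g Y e].

Lemma measurable_combination (I : finType) (c : I -> R) (phi : I -> spacetime R -> R) :
  (forall i, test_function (phi i)) -> measurable_fun setT (fun z => \sum_i c i * phi i z)%R.
Proof.
move=> tp; apply: measurable_sum => i; apply: mf_mul; first by mfun.
exact: test_function_measurable.
Qed.

Lemma measurable_noise_combination (I : finType) (c : I -> R) (phi : I -> spacetime R -> R) :
  measurable_fun setT (fun w => \sum_i c i * F (phi i) w)%R.
Proof. by apply: measurable_sum => i; apply: mf_mul; mfun. Qed.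

Let quad (x y : \bar R) (e : R) : x <= (e / 4)%:E -> y <= (e / 4)%:E ->
  2%:E * x + 2%:E * y <= e%:E.
Proof.
move=> hx hy; have t0 : 0 <= 2%:E :> \bar R by rewrite lee_fin.
apply: le_trans (leeD (lee_wpmul2l t0 hx) (lee_wpmul2l t0 hy)) _.
by rewrite -!EFinM -EFinD lee_fin; lra.
Qed.

(** A diagonal argument, which rests on the quasi-triangle inequalities of both norms. *)
Lemma represents_limit g Y : measurable_fun setT g -> measurable_fun setT Y ->
  (forall e : R, (0 < e)%R -> exists h Z, [/\ represents h Z,
     dom_norm2 f (fun z => h z - g z)%R <= e%:E & sqnorm (fun w => Z w - Y w)%R <= e%:E]) ->
  represents g Y.
Proof.
move=> mg mY lim; split=> // e e0; have e40 : (0 < e / 4)%R by rewrite divr_gt0.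
have [h [Z [[mh mZ rh] hg ZY]]] := lim _ e40.
have [I [c [phi [tp c1 c2]]]] := rh _ e40.
have mc := measurable_combination c tp; have mn := measurable_noise_combination c phi.
exists I, c, phi; split=> //.
- have e1 : (fun z => \sum_i c i * phi i z - g z)%R =
      (fun z => (\sum_i c i * phi i z - h z) + (h z - g z))%R.
    by apply/funext => z; rewrite addrA subrK.
  rewrite e1; apply: le_trans (quad c1 hg).
  apply: (dom_norm2D f_ge0 f_cont f_small f_pos); mfun.
- have e1 : (fun w => \sum_i c i * F (phi i) w - Y w)%R =
      (fun w => (\sum_i c i * F (phi i) w - Z w) + (Z w - Y w))%R.
    by apply/funext => z; rewrite addrA subrK.
  rewrite e1; apply: le_trans (quad c2 ZY).
  by apply: sqnorm_quasi_triangle; mfun.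
Qed.

Lemma representsD g h Y Z : represents g Y -> represents h Z ->
  represents (fun z => g z + h z)%R (fun w => Y w + Z w)%R.
Proof.
move=> [mg mY rg] [mh mZ rh]; split; [by mfun|by mfun|move=> e e0].
have e40 : (0 < e / 4)%R by rewrite divr_gt0.
have [I [c [phi [tp c1 c2]]]] := rg _ e40; have [J [b [psi [tq b1 b2]]]] := rh _ e40.
have mc := measurable_combination c tp; have mn := measurable_noise_combination c phi.
have mb := measurable_combination b tq; have mp := measurable_noise_combination b psi.
exists (I + J)%type, (fun k => match k with inl i => c i | inr j => b j end),
  (fun k => match k with inl i => phi i | inr j => psi j end).
split; first by case.
- have e1 : (fun z => \sum_(k : I + J) (match k with inl i => c i | inr j => b j end) *
       (match k with inl i => phi i | inr j => psi j end) z - (g z + h z))%R =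
      (fun z => (\sum_i c i * phi i z - g z) + (\sum_j b j * psi j z - h z))%R.
    by apply/funext => z; rewrite big_sumType /=; ring.
  rewrite e1; apply: le_trans (quad c1 b1).
  apply: (dom_norm2D f_ge0 f_cont f_small f_pos); mfun.
- have e1 : (fun w => \sum_(k : I + J) (match k with inl i => c i | inr j => b j end) *
       F (match k with inl i => phi i | inr j => psi j end) w - (Y w + Z w))%R =
      (fun w => (\sum_i c i * F (phi i) w - Y w) + (\sum_j b j * F (psi j) w - Z w))%R.
    by apply/funext => z; rewrite big_sumType /=; ring.
  rewrite e1; apply: le_trans (quad c2 b2).
  by apply: sqnorm_quasi_triangle; mfun.
Qed.

Lemma representsZ (a : R) g Y : represents g Y ->
  represents (fun z => a * g z)%R (fun w => a * Y w)%R.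
Proof.
move=> [mg mY rg]; split; [by mfun|by mfun|move=> e e0].
have a10 : (0 < a ^+ 2 + 1)%R by rewrite ltr_pwDr// sqr_ge0.
have e40 : (0 < e / (a ^+ 2 + 1))%R by rewrite divr_gt0.
have [I [c [phi [tp c1 c2]]]] := rg _ e40.
have mc := measurable_combination c tp; have mn := measurable_noise_combination c phi.
have fin (x : \bar R) : x <= (e / (a ^+ 2 + 1))%:E -> (a ^+ 2)%:E * x <= e%:E.
  move=> hx; have a0 : 0 <= (a ^+ 2)%:E by rewrite lee_fin sqr_ge0.
  apply: le_trans (lee_wpmul2l a0 hx) _; rewrite -EFinM lee_fin mulrCA.
  by rewrite ger_pMr// ler_pdivrMr// mul1r lerDl.
exists I, (fun i => a * c i)%R, phi; split=> //.
- have e1 : (fun z => \sum_i a * c i * phi i z - a * g z)%R =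
      (fun z => a * (\sum_i c i * phi i z - g z))%R.
    by apply/funext => z; rewrite mulrBr mulr_sumr; congr (_ - _)%R;
      apply: eq_bigr => i _; rewrite mulrA.
  rewrite e1 (dom_norm2Z f_ge0 f_cont); [exact: fin|by mfun].
- have e1 : (fun w => \sum_i a * c i * F (phi i) w - a * Y w)%R =
      (fun w => a * (\sum_i c i * F (phi i) w - Y w))%R.
    by apply/funext => z; rewrite mulrBr mulr_sumr; congr (_ - _)%R;
      apply: eq_bigr => i _; rewrite mulrA.
  rewrite e1 sqnormZ; [exact: fin|by mfun].
Qed.

Lemma represents0 : represents (fun=> 0%R) (fun=> 0%R).
Proof.
have z0 : @nnst R (fun=> 0%R) by split.
split=> // e e0; exists 'I_0, (fun=> 0%R), (fun _ _ => 0%R); split; first by case.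
- have e1 : (fun z : spacetime R => \sum_(i < 0) (0 : R) * (0 : R) - 0)%R = (fun z => (0 : R) * (0 : R))%R.
    by apply/funext => z; rewrite big_ord0 subr0 mulr0.
  rewrite e1 (dom_norm2Z f_ge0 f_cont)//.
  by rewrite expr0n mul0e lee_fin ltW.
- have e1 : (fun w : Omega => \sum_(i < 0) (0 : R) * F (fun=> 0) w - 0)%R = (fun z => (0 : R) * (0 : R))%R.
    by apply/funext => z; rewrite big_ord0 subr0 mulr0.
  by rewrite e1 sqnormZ// expr0n mul0e lee_fin ltW.
Qed.

Lemma represents_noise_extension g Y : measurable_fun setT g -> measurable_fun setT Y ->
  noise_extension f F g Y -> represents g Y.
Proof.
move=> mg mY [phi [tp cg cY]]; split=> // e e0.
have [n1 h1] := eventually_small e0 cg; have [n2 h2] := eventually_small e0 cY.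
exists 'I_1, (fun=> 1%R), (fun=> phi (maxn n1 n2)); split=> //.
- rewrite (_ : (fun z => _) = (fun z => phi (maxn n1 n2) z - g z)%R).
    by apply: h1; exact: leq_maxl.
  by apply/funext => z; rewrite big_ord1 mul1r.
- rewrite (_ : (fun w => _) = (fun w => F (phi (maxn n1 n2)) w - Y w)%R).
    by apply: h2; exact: leq_maxr.
  by apply/funext => z; rewrite big_ord1 mul1r.
Qed.

Section walsh.
Context (M : R -> set (plane R) -> {RV P >-> R}).
Hypothesis M_noise : martingale_measure_of f F M.

Let measurable_slab (t : R) (A : set (plane R)) : measurable A ->
  measurable_fun setT (\1_(`]0%R, t] `*` A) : spacetime R -> R).
Proof.
by move=> mA; apply: measurable_indic; apply: measurableX.
Qed.

Lemma represents_elementary (e : elementary R) :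
  represents (fun z => el_coef e * \1_(`]el_left e, el_right e] `*` el_base e) z)%R
    (fun w => el_coef e * (M (el_right e) (el_base e) w - M (el_left e) (el_base e) w))%R.
Proof.
case: e => c l r A l0 lr mA bA /=.
have rep t : (0 <= t)%R -> represents (\1_(`]0%R, t] `*` A)) (M t A).
  move=> t0; apply: represents_noise_extension; [exact: measurable_slab|by []|].
  exact: M_noise.
have := representsZ c (representsD (rep r (le_trans l0 lr)) (representsZ (-1) (rep l l0))).
have -> : (fun w => c * (M r A w + -1 * M l A w))%R = (fun w => c * (M r A w - M l A w))%R.
  by apply/funext => w; rewrite mulN1r.
have -> : (fun z => c * (\1_(`]0%R, r] `*` A) z + -1 * \1_(`]0%R, l] `*` A) z))%R =
    (fun z => c * \1_(`]l, r] `*` A) z)%R; last by [].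
apply/funext => z; congr (_ * _)%R; rewrite !indicE !in_setX !mem_setE !in_itv /=.
case: (z.2 \in A); rewrite ?andbT ?andbF ?mulr0 ?addr0//.
case: (ltP 0%R z.1) => z0 /=; last first.
  by rewrite mulr0 addr0 ltNge (le_trans z0 l0).
have [zl|lz] := leP z.1 l; first by rewrite (le_trans zl lr) mulr1 subrr.
by rewrite mulr0 addr0.
Qed.

Lemma represents_simple (h : seq (elementary R)) :
  represents (simple_fun h) (simple_integral M h).
Proof.
elim: h => [|e h IH].
  have := represents0.
  have -> : simple_fun [::] = (fun=> 0%R) :> (spacetime R -> R).
    by apply/funext => z; rewrite /simple_fun big_nil.
  have -> : simple_integral M [::] = (fun=> 0%R); last by [].
  by apply/funext => w; rewrite /simple_integral big_nil.
have := representsD (represents_elementary e) IH.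
have -> : simple_fun (e :: h) = (fun z =>
    el_coef e * \1_(`]el_left e, el_right e] `*` el_base e) z + simple_fun h z)%R.
  by apply/funext => z; rewrite /simple_fun big_cons.
have -> : simple_integral M (e :: h) = (fun w =>
    el_coef e * (M (el_right e) (el_base e) w - M (el_left e) (el_base e) w)
    + simple_integral M h w)%R; last by [].
by apply/funext => w; rewrite /simple_integral big_cons.
Qed.

Lemma represents_walsh g Y : measurable_fun setT g -> measurable_fun setT Y ->
  walsh_integral f M g Y -> represents g Y.
Proof.
move=> mg mY [h [cg cY]]; apply: represents_limit => // e e0.
have [n1 h1] := eventually_small e0 cg; have [n2 h2] := eventually_small e0 cY.
exists (simple_fun (h (maxn n1 n2))), (simple_integral M (h (maxn n1 n2))); split.
- exact: represents_simple.
- by apply: h1; exact: leq_maxl.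
- by apply: h2; exact: leq_maxr.
Qed.

End walsh.

Hypothesis f_loc : forall l : R, (0 < l)%R -> exists2 Q : R, (0 <= Q)%R &
  \int[plane_measure R]_z (if (enorm z <= l)%R then f (enorm z) else 0%R)%:E <= Q%:E.

Let gaussian_combination (I : finType) (c : I -> R) (phi : I -> spacetime R -> R) :
  (forall i, test_function (phi i)) -> gaussian_rv P (fun w => \sum_i c i * F (phi i) w)%R.
Proof.
move=> tp; have [G _ _ _] := F_noise.
have := G #|I| (fun k => c (enum_val k)) (fun k => phi (enum_val k)) (fun k => tp _).
rewrite (_ : (fun w => _) = (fun w => \sum_i c i * F (phi i) w)%R)//.
apply/funext => w; rewrite -(big_enum_val (fun i => c i * F (phi i) w)%R).
by apply: eq_bigl => i; rewrite inE.
Qed.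

(** Approximate [Y] by a combination [S] so closely that [P (`|S - Y| >= l / 2) <= e] by
    Chebyshev's inequality, while the second moment of [S] stays below [4 * V];
    then apply [gaussian_tail] to [S], and let [e] tend to 0. *)
Lemma represents_tail : exists2 K : R, (0 < K)%R & forall g Y (V l : R),
  represents g Y -> (0 < V)%R -> (0 < l)%R -> dom_norm2 f g <= V%:E ->
  P [set w | (l <= `|Y w|)%R] <= (2 * expR (- (l ^+ 2 / (K * V))))%:E.
Proof.
have [K K0 hK] := gaussian_tail P; exists (16 * K)%R; first by rewrite mulr_gt0.
move=> g Y V l [mg mY rg] V0 l0 gV; apply/lee_addgt0Pr => e e0.
have l2 : (0 < l / 2)%R by rewrite divr_gt0.
have l22 : (0 < (l / 2) ^+ 2)%R by rewrite exprn_gt0.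
pose r : R := Num.min V (e * (l / 2) ^+ 2)%R.
have r0 : (0 < r)%R by rewrite lt_min V0 mulr_gt0.
have [rV re] : (r <= V)%R /\ (r <= e * (l / 2) ^+ 2)%R by rewrite !ge_min !lexx orbT.
have [I [c [phi [tp c1 c2]]]] := rg _ r0.
have mc := measurable_combination c tp; have mn := measurable_noise_combination c phi.
pose S w : R := (\sum_i c i * F (phi i) w)%R.
have V40 : (0 < 4 * V)%R by rewrite mulr_gt0.
have S2 : 'E_P[(fun w => S w ^+ 2)%R] <= (4 * V)%:E.
  apply: le_trans (combination_second_moment f_ge0 f_cont f_loc F_noise c tp) _.
  have e1 : (fun z => \sum_i c i * phi i z)%R =
      (fun z => (\sum_i c i * phi i z - g z) + g z)%R.
    by apply/funext => z; rewrite subrK.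
  rewrite e1; apply: (@le_trans _ _ (2%:E * V%:E + 2%:E * V%:E)); last first.
    by rewrite -!EFinM -EFinD lee_fin; lra.
  have t0 : 0 <= 2%:E :> \bar R by rewrite lee_fin.
  have c1' : dom_norm2 f (fun z => \sum_i c i * phi i z - g z)%R <= V%:E.
    by apply: le_trans c1 _; rewrite lee_fin.
  apply: le_trans (leeD (lee_wpmul2l t0 c1') (lee_wpmul2l t0 gV)).
  apply: (dom_norm2D f_ge0 f_cont f_small f_pos); mfun.
have mS : measurable_fun setT S by [].
have b1 := hK S (4 * V)%R (l / 2)%R mS (gaussian_combination c tp) V40 l2 S2.
have mSY : measurable_fun setT (fun w => S w - Y w)%R by mfun.
have b2 : P [set w | (l / 2 <= `|S w - Y w|)%R] <= e%:E.
  have h := le_trans (second_moment_chebyshev P mSY (ltW l2)) (le_trans c2 _).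
  have := h (e * (l / 2) ^+ 2)%:E; rewrite lee_fin => /(_ re).
  have fA : P [set w | (l / 2 <= `|S w - Y w|)%R] \is a fin_num.
    by apply: fin_num_measure; exact: measurable_ge_norm.
  by rewrite -(fineK fA) -EFinM !lee_fin mulrC ler_pM2r.
apply: (@le_trans _ _ (P [set w | (l / 2 <= `|S w|)%R] + P [set w | (l / 2 <= `|S w - Y w|)%R])).
  apply: le_trans (measureU2 _ (measurable_ge_norm _ mS) (measurable_ge_norm _ mSY)).
  apply: le_measure; rewrite ?inE.
  - exact: measurable_ge_norm.
  - by apply: measurableU; exact: measurable_ge_norm.
  - move=> w /= lw; have := ler_distD (S w) (Y w) 0%R; rewrite !subr0 (distrC (Y w)) => hd.
    have [h|h] := leP (l / 2)%R `|S w|%R; [by left|right].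
    by move: lw hd h; lra.
apply: leeD b2; apply: le_trans b1 _; rewrite lee_fin.
have -> : ((l / 2) ^+ 2 / (K * (4 * V)) = l ^+ 2 / (16 * K * V))%R; last by [].
by field; rewrite !gt_eqF.
Qed.

End approximation.

(** * Increments of the solution *)

Section increments.
Context d (Omega : measurableType d) (R : realType) (P : probability Omega R).
Context (m : R) (f : R -> R) (alpha : R) (F : (spacetime R -> R) -> {RV P >-> R}).
Context (M : R -> set (plane R) -> {RV P >-> R}) (X : R -> plane R -> {RV P >-> R}).
Hypothesis m01 : 0 <= m < 1.
Hypothesis f_ge0 : forall r : R, 0 <= r -> 0 <= f r.
Hypothesis f_cont : forall r : R, 0 < r -> {for r, continuous f}.
Hypothesis F_noise : gaussian_noise f F.
Hypothesis M_noise : martingale_measure_of f F M.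
Hypothesis a01 : 0 < alpha < 1.
Hypothesis f_int : exists2 delta : R, 0 < delta &
     (\int[lebesgue_measure]_(r in `]0%R, delta[)
        (f r * r `^ (1 - alpha))%:E < +oo)%E.
Let kernel (z a : spacetime R) : R := \1_(`]0, z.1] `*` [set: plane R]) a * green (z.1 - a.1) (z.2 - a.2) m.
Hypothesis X_walsh : forall t x, 0 < t -> walsh_integral f M (kernel (t, x)) (X t x).

Definition in_slab (T : R) (z : spacetime R) :=
  [/\ 0 < z.1 <= T, `|z.2.1| <= T & `|z.2.2| <= T].

Let small : locally_small f.
Proof. exact: (locally_small_of_radial f_ge0 f_cont a01 (radial_finite f_ge0 f_cont a01 ler01 f_int)). Qed.

Let f_pos : positive_on_bumps f := noise_positive_on_bumps f_ge0 f_cont F_noise.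

Let f_loc : forall l : R, 0 < l -> exists2 Q : R, 0 <= Q &
  (\int[plane_measure R]_z (if (enorm z <= l)%R then f (enorm z) else 0%R)%:E <= Q%:E)%E.
Proof.
move=> l l0; have [Q Q0 hQ] := ball_mass f_ge0 f_cont a01 l0
  (radial_finite f_ge0 f_cont a01 (ltW l0) f_int).
exists (l `^ (3 * alpha / 4) * Q); first by rewrite mulr_ge0 ?powR_ge0.
by apply: hQ; rewrite l0 lexx.
Qed.

Let kernelE z a : 0 < z.1 -> kernel z a = (2 * pi)^-1 * wave m 2^-1 z a.
Proof. by case: z => t x t0; exact: (green_kernel m01). Qed.

Let measurable_kernel_at z : 0 < z.1 -> measurable_fun setT (kernel z).
Proof.
move=> z0; rewrite (_ : kernel z = (fun a => (2 * pi)^-1 * wave m 2^-1 z a)).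
  by apply: mf_mul; [mfun|exact: measurable_wave].
by apply/funext => a; rewrite kernelE.
Qed.

(** By [wave_diff] with [k = alpha / 4] the increment is bounded pointwise by
    [dist^(alpha/4)] times kernels whose norm is bounded by [wave_cov_bound]; the
    norm is squared, which doubles the exponent. *)
Lemma kernel_increment (T : R) : 0 < T -> exists2 C : R, 0 < C & forall z z',
  in_slab T z -> in_slab T z' ->
  (dom_norm2 f (fun a => kernel z a - kernel z' a)%R <= (C * dist_st z z' `^ (alpha / 2))%:E)%E.
Proof.
move=> T0; have [al0 al1] := andP a01.
have T40 : 0 <= 4 * T by rewrite mulr_ge0// ltW.
have [B B0 hB] := wave_cov_bound m a01 f_ge0 f_cont T0 (radial_finite f_ge0 f_cont a01 T40 f_int).
pose k := alpha / 4; pose w := wave m (2^-1 + k).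
have k0 : 0 < k by rewrite divr_gt0.
exists ((14 * T) `^ (alpha / 2) * (4 * B + 1)).
  by rewrite mulr_gt0 ?powR_gt0 ?ltr_wpDl ?mulr_ge0// mulr_gt0.
move=> z z' [/andP[z0 zT] z1 z2] [/andP[z0' zT'] z1' z2'].
pose c := (14 * T * dist_st z z') `^ k.
have c0 : 0 <= c by exact: powR_ge0.
have h0 : 0 <= dist_st z z' by rewrite addr_ge0 ?enorm_ge0.
have nw y : nnst (w y) by split; [exact: measurable_wave|move=> a; exact: wave_ge0].
have pw : (2 * pi)^-1 <= 1 :> R.
  by rewrite invf_le1 ?mulr_gt0 ?pi_gt0//; have := @pi_ge2 R; lra.
have p0 : 0 <= (2 * pi)^-1 :> R by rewrite invr_ge0 mulr_ge0 ?pi_ge0.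
have nww := nnstD (nw z) (nw z').
have kd a : `|kernel z a - kernel z' a| <= c * (w z a + w z' a).
  rewrite !kernelE// -mulrBr normrM (ger0_norm p0) -[leRHS]mul1r ler_pM//.
  have k01 : 0 <= k <= 1 by rewrite /k; lra.
  have hz : 0 < z.1 <= T by rewrite z0.
  have hz' : 0 < z'.1 <= T by rewrite z0'.
  exact: (wave_diff m01 a k01 T0 hz hz').
have mk : measurable_fun setT (fun a => kernel z a - kernel z' a).
  by apply: mf_add; [|apply: mf_opp]; exact: measurable_kernel_at.
apply: le_trans (dom_norm2_le f_ge0 f_cont mk (nnstZ c0 nww) kd) _.
rewrite (covZ2 f_ge0 f_cont c0 nww).
have t0 : (0 <= 2%:E :> \bar R)%E by rewrite lee_fin.
have hz : (0 < z.1 <= T) by rewrite z0.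
have hz' : (0 < z'.1 <= T) by rewrite z0'.
have q := le_trans (cov_quasi_triangle f_ge0 f_cont small f_pos (nw z) (nw z'))
  (leeD (lee_wpmul2l t0 (hB z hz)) (lee_wpmul2l t0 (hB z' hz'))).
have c2 : (0 <= (c ^+ 2)%:E)%E by rewrite lee_fin sqr_ge0.
apply: le_trans (lee_wpmul2l c2 q) _.
have e4 : (2%:E * B%:E + 2%:E * B%:E = (4 * B)%:E :> \bar R)%E.
  by rewrite -!EFinM -EFinD; congr EFin; lra.
rewrite e4 -EFinM lee_fin.
have -> : c ^+ 2 = (14 * T) `^ (alpha / 2) * dist_st z z' `^ (alpha / 2).
  rewrite /c -powR_mulrn ?powR_ge0// -powRrM.
  rewrite (_ : k * 2 = alpha / 2); last by rewrite /k; field.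
  by rewrite powRM// mulr_ge0// ltW.
have pT := powR_ge0 (14 * T) (alpha / 2); have pd := powR_ge0 (dist_st z z') (alpha / 2).
rewrite mulrAC -[leRHS]mulrA -[leLHS]mulrA; apply: ler_wpM2l => //.
by apply: ler_wpM2r => //; lra.
Qed.

Lemma increment_tail (T : R) : 0 < T -> exists2 C : R, 0 < C & forall z z' (l : R),
  in_slab T z -> in_slab T z' -> 0 < dist_st z z' -> 0 < l ->
  (P [set w | (l <= `|X z.1 z.2 w - X z'.1 z'.2 w|)%R] <=
    (2 * expR (- (l ^+ 2 / (C * dist_st z z' `^ (alpha / 2)))))%:E)%E.
Proof.
move=> T0; have [B B0 hB] := kernel_increment T0.
have [K K0 hK] := represents_tail f_ge0 f_cont small F_noise f_loc.
exists (K * B); first by rewrite mulr_gt0.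
move=> z z' l hz hz' h0 l0; have [/andP[z0 _] _ _] := hz; have [/andP[z0' _] _ _] := hz'.
have rep (y : spacetime R) : 0 < y.1 -> represents f F (kernel y) (X y.1 y.2).
  move=> y0; apply: (represents_walsh f_ge0 f_cont small F_noise M_noise).
  - exact: measurable_kernel_at.
  - by [].
  - by have := X_walsh y.2 y0; rewrite -surjective_pairing.
have r1 := representsD f_ge0 f_cont small F_noise (rep z z0)
  (representsZ f_ge0 f_cont (-1) (rep z' z0')).
have V0 : 0 < B * dist_st z z' `^ (alpha / 2) by rewrite mulr_gt0// powR_gt0.
have := hK _ _ _ _ r1 V0 l0.
have -> : (fun a => kernel z a + -1 * kernel z' a) = (fun a => kernel z a - kernel z' a).
  by apply/funext => a; rewrite mulN1r.
move=> /(_ (hB z z' hz hz')); rewrite mulrA.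
by under eq_set do rewrite mulN1r.
Qed.

End increments.

(** * Borel-Cantelli and tail rates *)

Section tail_rates.
Context (R : realType).

Lemma expRN_le_inv_pow (k : nat) (y : R) : (0 < k)%N -> 0 < y ->
  expR (- y) <= (k%:R / y) ^+ k.
Proof.
move=> k0 y0; have kR : 0 < k%:R :> R by rewrite ltr0n.
have yk : 0 < y / k%:R by rewrite divr_gt0.
have e : y = k%:R * (y / k%:R) by rewrite mulrC divfK// gt_eqF.
rewrite {1}e expRN expRM_natl -exprVn lerXn2r ?nnegrE ?invr_ge0 ?expR_ge0 ?divr_ge0 ?(ltW y0) ?(ltW kR)//.
rewrite -[leRHS]invrK invf_div lef_pV2 ?posrE ?expR_gt0//.
by apply: le_trans (expR_ge1Dx _); rewrite lerDr.
Qed.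

Lemma exists_large_power (rho b : R) : 1 < rho -> exists2 k : nat, (0 < k)%N & b <= rho ^+ k.
Proof.
move=> r1; have d0 : 0 < rho - 1 by rewrite subr_gt0.
have bern n : 1 + n%:R * (rho - 1) <= rho ^+ n.
  elim: n => [|n IH]; first by rewrite mul0r addr0 expr0.
  rewrite exprS; apply: le_trans (ler_wpM2l (ltW (lt_trans ltr01 r1)) IH).
  rewrite -natr1; have : 0 <= n%:R * (rho - 1) ^+ 2 by rewrite mulr_ge0 ?sqr_ge0.
  by nra.
exists (Num.truncn (b / (rho - 1))).+1 => //; apply: le_trans (bern _).
have /ltW : b / (rho - 1) < (Num.truncn (b / (rho - 1))).+1%:R by exact: truncnS_gt.
by rewrite ler_pdivrMr//; lra.
Qed.

End tail_rates.

Section borel_cantelli.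
Context d (Omega : measurableType d) (R : realType) (P : probability Omega R).

Lemma geometric_borel_cantelli (E : nat -> set Omega) (A : R) : 0 <= A ->
  (forall n, measurable (E n)) -> (forall n, (P (E n) <= (A * 2 ^- n)%:E)%E) ->
  P (lim_sup_set E) = 0%E.
Proof.
move=> A0 mE hE; apply: lim_sup_set_cvg0 => //.
have A20 : 0 <= 2 * A by rewrite mulr_ge0.
apply: (@le_lt_trans _ _ (\sum_(n <oo) (2 * A / (2 ^ n.+1)%:R)%:E)%E).
  apply: lee_nneseries => [n *|n *]; first exact: measure_ge0.
  apply: le_trans (hE n) _; rewrite lee_fin natrX exprS invfM mulrA.
  by rewrite (mulrC 2 A) mulfK.
by apply: le_lt_trans (epsilon_trick0 _ A20) _; exact: ltry.
Qed.

Lemma measurable_lim_sup_set (E : nat -> set Omega) : (forall n, measurable (E n)) ->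
  measurable (lim_sup_set E).
Proof. by move=> mE; apply: bigcap_measurable => // n _; apply: bigcup_measurable. Qed.

Lemma not_lim_sup_set (E : nat -> set Omega) w : ~ lim_sup_set E w ->
  exists n0, forall n, (n0 <= n)%N -> ~ E n w.
Proof.
move=> h; apply: contrapT => hn; apply: h => n _; apply: contrapT => hb; apply: hn.
by exists n => j nj Ej; apply: hb; exists j.
Qed.

Lemma finite_union_bound (I : finType) (A : I -> set Omega) (c : R) :
  (forall i, measurable (A i)) -> (forall i, (P (A i) <= c%:E)%E) ->
  measurable [set w | exists i, A i w] /\
  (P [set w | exists i, A i w] <= (#|I|%:R * c)%:E)%E.
Proof.
move=> mA hA; have e : [set w | exists i, A i w] = \big[setU/set0]_(i : I) A i.
  apply/seteqP; split=> w /=.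
    by move=> [i Ai]; rewrite -bigcup_seq; exists i => //=; rewrite mem_index_enum.
  by rewrite -bigcup_seq => -[i _ Ai]; exists i.
have mU (s : seq I) : measurable (\big[setU/set0]_(i <- s) A i).
  by apply: bigsetU_measurable => i _.
rewrite e; split; first exact: mU.
have : forall s : seq I, (P (\big[setU/set0]_(i <- s) A i) <= ((size s)%:R * c)%:E)%E.
  elim=> [|i s IH]; first by rewrite big_nil measure0 mul0r.
  rewrite big_cons; apply: le_trans (measureU2 _ (mA i) (mU s)) _.
  by rewrite /= -natr1 mulrDl mul1r addrC EFinD; exact: leeD.
move=> /(_ (index_enum I)); rewrite cardE.
by rewrite (_ : size (enum I) = size (index_enum I))// enumT /index_enum.
Qed.

End borel_cantelli.

Section pair_tail.
Context d (Omega : measurableType d) (R : realType) (P : probability Omega R).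
Context (X : R -> plane R -> Omega -> R) (a b : R).
Hypothesis b0 : 0 < b.
Hypothesis ba : b < a / 2.
Hypothesis X_tail : forall T : R, 0 < T -> exists2 C : R, 0 < C & forall z z' (l : R),
  in_slab T z -> in_slab T z' -> 0 < dist_st z z' -> 0 < l ->
  (P [set w | (l <= `|X z.1 z.2 w - X z'.1 z'.2 w|)%R] <=
    (2 * expR (- (l ^+ 2 / (C * dist_st z z' `^ a))))%:E)%E.

Lemma dist_st_ge0 (z z' : spacetime R) : 0 <= dist_st z z'.
Proof. by rewrite addr_ge0 ?enorm_ge0. Qed.

Lemma dist_st_eq0 (z z' : spacetime R) : dist_st z z' = 0 -> z = z'.
Proof.
move=> /eqP; rewrite paddr_eq0 ?enorm_ge0// normr_eq0 subr_eq0 => /andP[/eqP h1 /eqP h2].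
have := enorm_ge1 (z.2 - z'.2); have := enorm_ge2 (z.2 - z'.2); rewrite h2 /=.
rewrite !normr_le0 !subr_eq0 => /eqP h3 /eqP h4.
by case: z z' h1 h3 h4 {h2} => t [x y] [t' [x' y']] /= -> -> ->.
Qed.

(** The exponent in the Gaussian tail is at least [c * rho ^+ n], with
    [rho = 2^(a-2b) > 1]; its exponential decays faster than any geometric
    sequence.  The rate [2^(-7n)] is chosen to beat the order of [2^(6n)] pairs of points of
    the grid of level [n], and the radius [9 * 2^-n] to contain the projections of
    two points at distance [2^-n] and of one point at two consecutive levels. *)
Lemma pair_tail_rate (T : R) : 0 < T -> exists2 A : R, 0 <= A & forall (n : nat) z z',
  in_slab T z -> in_slab T z' -> dist_st z z' <= 9 * 2 ^- n ->
  (P [set w | ((2 `^ (- b)) ^+ n <= `|X z.1 z.2 w - X z'.1 z'.2 w|)%R] <=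
    (A * 2 ^- (7 * n))%:E)%E.
Proof.
move=> T0; have [C C0 hC] := X_tail T0.
pose r : R := 2 `^ (- b); pose rho : R := r ^+ 2 * 2 `^ a.
have r0 : 0 < r by exact: powR_gt0.
have rho1 : 1 < rho.
  rewrite /rho /r -powR_mulrn ?powR_ge0// -powRrM -powRD ?pnatr_eq0 ?implybT//.
  have x0 : 0 < - b * 2 + a by rewrite mulNr addrC subr_gt0 -ltr_pdivlMr.
  by rewrite -[ltRHS]invrK -powRN invf_gt1 ?powR2_lt1// powR_gt0.
have rho0 : 0 < rho by exact: lt_trans ltr01 rho1.
have [k k0 hk] := exists_large_power (2 ^+ 7) rho1.
pose c : R := (C * 9 `^ a)^-1.
have c0 : 0 < c by rewrite invr_gt0 mulr_gt0// powR_gt0.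
exists (2 * (k%:R / c) ^+ k); first by rewrite mulr_ge0// exprn_ge0// divr_ge0// ltW.
move=> n z z' hz hz' hd; have [d0|d0] := eqVneq (dist_st z z') 0.
  have -> : [set w | (r ^+ n <= `|X z.1 z.2 w - X z'.1 z'.2 w|)%R] = set0.
    apply/seteqP; split=> w //=; rewrite (dist_st_eq0 d0) subrr normr0.
    by rewrite leNgt exprn_gt0.
  rewrite measure0 lee_fin mulr_ge0 ?invr_ge0 ?exprn_ge0//.
  by rewrite mulr_ge0// exprn_ge0// divr_ge0// ltW.
have dp : 0 < dist_st z z' by rewrite lt0r d0 dist_st_ge0.
apply: le_trans (hC z z' (r ^+ n) hz hz' dp (exprn_gt0 _ r0)) _.
rewrite lee_fin -[leRHS]mulrA ler_pM2l//.
have a0 : 0 < a by move: (lt_trans b0 ba); rewrite pmulr_lgt0.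
have y0 : 0 < c * rho ^+ n by rewrite mulr_gt0// exprn_gt0.
apply: (@le_trans _ _ (expR (- (c * rho ^+ n)))).
  rewrite ler_expR lerN2.
  have e9 : (9 * 2 ^- n) `^ a = 9 `^ a * ((2 `^ a) ^+ n)^-1.
    rewrite powRM ?invr_ge0 ?exprn_ge0//; congr (_ * _).
    rewrite -(powR_invn n (ler0n R 2)) -powRrM -(powR_mulrn n (powR_ge0 2 a)) -powRrM -powRN.
    by congr (_ `^ _); ring.
  have dle : C * dist_st z z' `^ a <= C * (9 `^ a * ((2 `^ a) ^+ n)^-1).
    rewrite ler_pM2l// -e9; apply: ge0_ler_powR; rewrite ?nnegrE ?dist_st_ge0 ?mulr_ge0 ?invr_ge0 ?exprn_ge0 ?(ltW a0)//.
  have D0 : 0 < C * dist_st z z' `^ a by rewrite mulr_gt0// powR_gt0.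
  rewrite ler_pdivlMr//; apply: le_trans (ler_wpM2l (ltW y0) dle) _.
  rewrite /rho /c exprMn -!exprM mulnC.
  rewrite le_eqVlt; apply/orP; left; apply/eqP; field.
  by rewrite !gt_eqF ?powR_gt0 ?exprn_gt0 ?powR_gt0.
apply: le_trans (expRN_le_inv_pow k0 y0) _.
rewrite invfM mulrA exprMn ler_wpM2l ?exprn_ge0 ?divr_ge0 ?(ltW c0)//.
have e : (rho ^+ n) ^+ k = (rho ^+ k) ^+ n by rewrite -!exprM mulnC.
rewrite exprVn lef_pV2 ?posrE ?exprn_gt0// e (exprM 2 7 n).
by rewrite lerXn2r// nnegrE exprn_ge0// ltW.
Qed.

End pair_tail.

(** * Dyadic grids and path regularity *)

Section geometric_cauchy.
Context (R : realType).

Lemma geometric_cauchy (u : nat -> R) (n0 : nat) (A r : R) : 0 <= A -> 0 < r < 1 ->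
  (forall n m, (n0 <= n)%N -> (n <= m)%N -> `|u n - u m| <= A * r ^+ n) ->
  cvgn u /\ forall n, (n0 <= n)%N -> `|u n - limn u| <= A * r ^+ n.
Proof.
move=> A0 /andP[r0 r1] hu.
have rc : r ^+ n @[n --> \oo] --> (0 : R) by apply: cvg_expr; rewrite ger0_norm ?(ltW r0).
have Arc : A * r ^+ n @[n --> \oo] --> (0 : R).
  by rewrite -[X in _ --> X](mulr0 A); apply: cvgMr.
have cu : cvgn u.
  apply: cauchy_cvg; apply: cauchy_exP => e e0.
  have /cvgrPdist_lt /(_ e e0) [n1 _ hn1] := Arc.
  exists (u (maxn n0 n1)); exists (maxn n0 n1) => // m /= hm.
  apply: le_lt_trans (hu _ _ (leq_maxl _ _) hm) _.
  have := hn1 (maxn n0 n1) (leq_maxr _ _); rewrite /= sub0r normrN ger0_norm//.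
  by rewrite mulr_ge0// exprn_ge0// ltW.
split=> // n hn.
have c2 : `|u n - u m| @[m --> \oo] --> `|u n - limn u|.
  by apply: cvg_norm; apply: cvgB => //; exact: cvg_cst.
rewrite -(cvg_lim (@norm_hausdorff _ _) c2); apply: limr_le; first exact: cvgP c2.
by exists n => // m /= nm; exact: hu.
Qed.

End geometric_cauchy.

Section dyadic_grid.
Context (R : realType).
Implicit Types (p q z : spacetime R).

(** Rounding the time coordinate upwards keeps the projection at positive times. *)
Definition proj (n : nat) z : spacetime R :=
  (dyadic n z.1 + 2 ^- n, (dyadic n z.2.1, dyadic n z.2.2)).

(** Indices count from the lowest corner of the box, so that finitely many natural
    numbers enumerate the grid. *)
Definition grid_point (N n : nat) (k : nat * nat * nat) : spacetime R :=
  (k.1.1%:R / 2 ^+ n - N.+1%:R,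
    (k.1.2%:R / 2 ^+ n - N.+1%:R, k.2%:R / 2 ^+ n - N.+1%:R)).

Definition grid (N n : nat) p := in_slab N.+1%:R p /\ exists k, p = grid_point N n k.

Let pn0 n : 0 < 2 ^- n :> R. Proof. by rewrite invr_gt0 exprn_gt0. Qed.
Let pn1 n : 2 ^- n <= 1 :> R.
Proof. by rewrite invf_le1 ?exprn_gt0// exprn_ege1// ler1n. Qed.

Lemma dyadic_nat (N n m : nat) (x : R) : (n <= m)%N -> - N%:R <= x ->
  exists k : nat, dyadic n x = k%:R / 2 ^+ m - N.+1%:R.
Proof.
move=> nm Nx; pose i := (Num.floor (x * 2 ^+ n) + (N.+1 * 2 ^ n)%N%:Z)%R.
have i0 : (0 <= i)%R.
  have : (- (N.+1 * 2 ^ n)%N%:Z)%:~R <= x * 2 ^+ n.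
    rewrite intrN -pmulrn natrM natrX -mulNr ler_wpM2r ?exprn_ge0//.
    by apply: le_trans Nx; rewrite lerN2 ler_nat.
  by rewrite -floor_ge_int /i -subr_ge0 opprK.
exists (absz i * 2 ^ (m - n))%N.
have e : (absz i)%:R = (Num.floor (x * 2 ^+ n))%:~R + N.+1%:R * 2 ^+ n :> R.
  by rewrite pmulrn gez0_abs// /i intrD -[in X in _ + X]pmulrn natrM natrX.
have h2 k : 2 ^+ k != 0 :> R by rewrite expf_neq0.
rewrite natrM natrX e /dyadic -[in X in _ / X](subnKC nm) exprD invfM.
rewrite mulrACA divff// mulr1 mulrDl mulfK//.
by rewrite addrK.
Qed.

Lemma dyadic_bounds n (x : R) : x - 2 ^- n < dyadic n x <= x.
Proof. by rewrite dyadic_le andbT ltrBlDr dyadic_gt. Qed.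

(** Grids are nested, so that projections at two levels lie in a common grid. *)
Lemma proj_grid (N n m : nat) z : (n <= m)%N -> in_slab N%:R z -> grid N m (proj n z).
Proof.
move=> nm [/andP[z0 zN] z1 z2].
have h (x : R) : `|x| <= N%:R -> `|dyadic n x| <= N.+1%:R.
  rewrite !ler_norml => /andP[h1 h2]; have /andP[d1 d2] := dyadic_bounds n x.
  have := pn1 n; rewrite -natr1 => h3; apply/andP; split; lra.
have /andP[d1 d2] := dyadic_bounds n z.1; split.
  split=> /=; [|exact: h|exact: h].
  have := pn1 n; rewrite -natr1 => h3; apply/andP; split; lra.
have bound (x : R) : `|x| <= N%:R -> - N%:R <= x by rewrite ler_norml => /andP[].
have z0' : - N%:R <= z.1 by apply: le_trans (ltW z0); rewrite oppr_le0.
have [k1 e1] := dyadic_nat nm z0'.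
have [k2 e2] := dyadic_nat nm (bound _ z1).
have [k3 e3] := dyadic_nat nm (bound _ z2).
exists ((k1 + 2 ^ (m - n))%N, k2, k3); rewrite /proj /grid_point e1 e2 e3 /=.
congr (_, _); rewrite natrD natrX mulrDl addrAC; congr (_ + _ - _).
have h2 k : 2 ^+ k != 0 :> R by rewrite expf_neq0.
by rewrite -[in X in _ / X](subnKC nm) exprD invfM mulrCA divff// mulr1.
Qed.

Lemma dist_st_triangle p q z : dist_st p z <= dist_st p q + dist_st q z.
Proof.
rewrite /dist_st addrACA lerD//; first exact: ler_distD.
have -> : p.2 - z.2 = (p.2 - q.2) + (q.2 - z.2) by rewrite addrA subrK.
exact: enorm_triangle.
Qed.

Lemma dist_stC p q : dist_st p q = dist_st q p.
Proof. by rewrite /dist_st distrC -enormN opprB. Qed.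

Lemma proj_dist n z : dist_st z (proj n z) <= 3 * 2 ^- n.
Proof.
have h (x : R) : `|x - dyadic n x| <= 2 ^- n.
  have /andP[d1 d2] := dyadic_bounds n x; rewrite ger0_norm ?subr_ge0//.
  by rewrite lerBlDr -lerBlDl ltW.
have /andP[d1 d2] := dyadic_bounds n z.1.
have e1 : `|z.1 - (proj n z).1| <= 2 ^- n.
  by rewrite ler_norml /=; apply/andP; split; lra.
have e2 : enorm (z.2 - (proj n z).2) <= 2 * 2 ^- n.
  apply: le_trans (enorm_le_sum _) _; rewrite mulr_natl mulr2n.
  by apply: lerD; exact: h.
by rewrite /dist_st; apply: le_trans (lerD e1 e2) _; lra.
Qed.

Lemma grid_finite (N n : nat) p : grid N n p ->
  exists k : 'I_(2 * N.+1 * 2 ^ n).+1 * 'I_(2 * N.+1 * 2 ^ n).+1 * 'I_(2 * N.+1 * 2 ^ n).+1,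
    p = grid_point N n (k.1.1 : nat, k.1.2 : nat, k.2 : nat).
Proof.
move=> [[/andP[p0 pN] p1 p2] [[[i j] k] e]].
have h (x : R) (l : nat) : x = l%:R / 2 ^+ n - N.+1%:R -> x <= N.+1%:R ->
    (l < (2 * N.+1 * 2 ^ n).+1)%N.
  move=> ->; rewrite lerBlDr ler_pdivrMr ?exprn_gt0// ltnS -(ler_nat R) => hl.
  by apply: le_trans hl _; rewrite !natrM natrX; lra.
have le (x : R) : `|x| <= N.+1%:R -> x <= N.+1%:R :> R by move/(le_trans (ler_norm _)).
have hi := h p.1 i (congr1 (fun p => p.1) e) pN.
have hj := h p.2.1 j (congr1 (fun p => p.2.1) e) (le _ p1).
have hk := h p.2.2 k (congr1 (fun p => p.2.2) e) (le _ p2).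
by exists (Ordinal hi, Ordinal hj, Ordinal hk).
Qed.

End dyadic_grid.

Section path_regularity.
Context (R : realType) (b : R) (x : spacetime R -> R).
Hypothesis b0 : 0 < b.
Let r : R := 2 `^ (- b).
Let A : R := r / (1 - r).

Definition regular_on_grids := forall N : nat, exists n0 : nat, forall n, (n0 <= n)%N ->
  forall p q, grid N n p -> grid N n q -> dist_st p q <= 9 * 2 ^- n ->
  `|x p - x q| < (2 `^ (- b)) ^+ n.

Hypothesis x_regular : regular_on_grids.

Definition grid_limit (z : spacetime R) : R := limn (fun n => x (proj n z)).

Let r0 : 0 < r. Proof. exact: powR_gt0. Qed.
Let r1 : r < 1. Proof. exact: powR2_lt1. Qed.
Let A0 : 0 <= A. Proof. by rewrite divr_ge0 ?(ltW r0)// subr_ge0 ltW. Qed.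
Let h2n n : 0 < 2 ^- n :> R. Proof. by rewrite invr_gt0 exprn_gt0. Qed.

Let rn n : r ^+ n = (2 ^- n) `^ b.
Proof.
rewrite /r -(powR_mulrn n (powR_ge0 _ _)) -powRrM -(powR_invn n (ler0n R 2)) -powRrM.
by congr (_ `^ _); ring.
Qed.

(** Telescoping over consecutive levels gives a geometric sum, with [A = r / (1 - r)].
    The induction carries the difference [r ^+ n - r ^+ m], which telescopes exactly. *)
Let chain (N n0 : nat) z : in_slab N%:R z ->
  (forall n, (n0 <= n)%N -> forall p q, grid N n p -> grid N n q ->
     dist_st p q <= 9 * 2 ^- n -> `|x p - x q| < r ^+ n) ->
  forall n m, (n0 <= n)%N -> (n <= m)%N -> `|x (proj n z) - x (proj m z)| <= A * r ^+ n.
Proof.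
move=> hz hx n m hn nm.
suff : `|x (proj n z) - x (proj m z)| <= A * (r ^+ n - r ^+ m).
  move=> h; apply: le_trans h _; rewrite ler_wpM2l// gerBl exprn_ge0// ltW//.
rewrite -(subnKC nm); elim: (m - n)%N => [|k IH].
  by rewrite addn0 !subrr normr0 mulr0.
apply: le_trans (ler_distD (x (proj (n + k) z)) _ _) _.
have step : `|x (proj (n + k) z) - x (proj (n + k.+1) z)| <= r ^+ (n + k.+1).
  apply: ltW; apply: hx.
  - by rewrite (leq_trans hn)// leq_addr.
  - by apply: proj_grid hz; rewrite addnS.
  - exact: proj_grid hz.
  - apply: le_trans (dist_st_triangle _ z _) _.
    have h1 := proj_dist (n + k) z; have h2' := proj_dist (n + k.+1) z.
    rewrite dist_stC in h1; apply: le_trans (lerD h1 h2') _.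
    have e : 2 ^- (n + k) = 2 * 2 ^- (n + k.+1) :> R.
      by rewrite addnS exprS invfM mulrA divff// mul1r.
    by rewrite e; lra.
apply: le_trans (lerD IH step) _; rewrite addnS exprS.
have d0 : 1 - r != 0 by rewrite subr_eq0 eq_sym lt_eqF.
rewrite le_eqVlt; apply/orP; left; apply/eqP; rewrite /A; field.
by rewrite d0.
Qed.

Lemma grid_limit_cvg (N : nat) z : in_slab N%:R z ->
  cvgn (fun n => x (proj n z)).
Proof.
move=> hz; have [n0 hn0] := x_regular N.
have r01 : 0 < r < 1 by rewrite r0.
by have [] := geometric_cauchy A0 r01 (chain hz hn0).
Qed.

Lemma dyadic_scale (h : R) (n0 : nat) : 0 < h -> h <= 2 ^- n0 ->
  exists2 n : nat, (n0 <= n)%N & h <= 2 ^- n /\ 2 ^- n < 2 * h.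
Proof.
move=> h0 hn0; have ex : exists n : nat, 2 ^- n.+1 < h.
  have two1 : (1 : R) < 2 by rewrite ltr1n.
  have [k _ hk] := exists_large_power (h^-1 + 1) two1.
  exists k; rewrite -[ltRHS]invrK ltf_pV2 ?posrE ?invr_gt0 ?exprn_gt0//.
  have : h^-1 < 2 ^+ k by apply: lt_le_trans hk; rewrite ltrDl.
  by move/lt_le_trans; apply; rewrite exprS ler_peMl ?exprn_ge0// ler1n.
have hm : forall k, 2 ^- k.+1 = 2^-1 * 2 ^- k :> R by move=> k; rewrite exprS invfM.
case: (ex_minnP ex) => n hn nmin; exists n.
  rewrite -ltnS ltnNge; apply/negP => le.
  have : 2 ^- n0 <= 2 ^- n.+1 :> R.
    by rewrite lef_pV2 ?posrE ?exprn_gt0// ler_eXn2l// ltr1n.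
  by move/(le_trans hn0); rewrite leNgt hn.
split; last by move: hn; rewrite hm; lra.
case: n hn nmin => [|n] hn nmin.
  by rewrite expr0 invr1 (le_trans hn0)// invf_le1 ?exprn_gt0// exprn_ege1// ler1n.
by rewrite leNgt; apply/negP => /nmin; rewrite ltnn.
Qed.

(** For points at small distance, compare at the level [n] with [2^-n] of the order of
    the distance: both limits are within [A * r ^+ n] of the projections, whose values
    differ by at most [r ^+ n].  For points farther apart, a bound on the path
    suffices, and it comes from the finitely many grid points of level [n0]. *)
Lemma grid_limit_hoelder (B : set (spacetime R)) : bounded_set B ->
  B `<=` [set z | 0 < z.1] -> hoelder_on B b grid_limit.
Proof.
move=> [D [_ hD]] Bpos; pose D1 := Num.max D 0 + 1.
have DD1 : D < D1 by rewrite /D1 (@le_lt_trans _ _ (Num.max D 0)) ?le_max ?lexx// ltrDl.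
pose N := (Num.truncn D1).+1.
have DN : D1 <= N%:R by exact/ltW/truncnS_gt.
have BN z : B z -> in_slab N%:R z.
  move=> Bz; have := hD D1 DD1 z Bz; rewrite /= prod_normE !ge_max.
  move=> /andP[h1 /andP[h2 h3]]; split.
  - by rewrite (Bpos z Bz)/=; apply: le_trans DN; apply: le_trans (ler_norm _) h1.
  - exact: le_trans h2 DN.
  - exact: le_trans h3 DN.
have [n0 hn0] := x_regular N.
have r01 : 0 < r < 1 by rewrite r0.
have near z n : B z -> (n0 <= n)%N -> `|x (proj n z) - grid_limit z| <= A * r ^+ n.
  by move=> Bz hn; have [_] := geometric_cauchy A0 r01 (chain (BN z Bz) hn0); apply.
have compare z z' n : B z -> B z' -> (n0 <= n)%N ->
    `|grid_limit z - grid_limit z'| <= 2 * (A * r ^+ n) + `|x (proj n z) - x (proj n z')|.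
  move=> Bz Bz' hn; have k1 := near z n Bz hn; have k2 := near z' n Bz' hn.
  apply: le_trans (ler_distD (x (proj n z)) _ _) _; rewrite distrC.
  have k3 := ler_distD (x (proj n z')) (x (proj n z)) (grid_limit z').
  by move: k1 k2 k3; lra.
pose S : R := \sum_(k : 'I_(2 * N.+1 * 2 ^ n0).+1 * 'I_(2 * N.+1 * 2 ^ n0).+1 *
    'I_(2 * N.+1 * 2 ^ n0).+1) `|x (grid_point R N n0 (k.1.1 : nat, k.1.2 : nat, k.2 : nat))|.
have S0 : 0 <= S by apply: sumr_ge0 => k _; exact: normr_ge0.
have Sx z : B z -> `|x (proj n0 z)| <= S.
  move=> Bz; have [k ->] := grid_finite (proj_grid (leqnn n0) (BN z Bz)).
  by rewrite /S (bigD1 k)//= lerDl sumr_ge0.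
pose C1 := (2 * A + 1) * 2 `^ b; pose C2 := (2 * A + 2 * S) / r ^+ n0.
have C10 : 0 <= C1 by rewrite mulr_ge0 ?powR_ge0// addr_ge0// mulr_ge0.
have C20 : 0 <= C2 by rewrite divr_ge0 ?exprn_ge0 ?(ltW r0)// addr_ge0// mulr_ge0.
exists (C1 + C2) => z z' Bz Bz'; rewrite -/(dist_st z z').
have pd := powR_ge0 (dist_st z z') b.
have [d0|d0] := eqVneq (dist_st z z') 0.
  by rewrite (dist_st_eq0 d0) subrr normr0 mulr_ge0 ?powR_ge0// addr_ge0.
have dp : 0 < dist_st z z' by rewrite lt0r d0 dist_st_ge0.
have [hs|hl] := leP (dist_st z z') (2 ^- n0).
  have [n hn [hn1 hn2]] := dyadic_scale dp hs.
  have d9 : dist_st (proj n z) (proj n z') <= 9 * 2 ^- n.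
    apply: le_trans (dist_st_triangle _ z _) _; rewrite (dist_stC (proj n z) z).
    have k1 := dist_st_triangle z z' (proj n z').
    have k2 := proj_dist n z; have k3 := proj_dist n z'.
    by move: (h2n n) k1 k2 k3 hn1; lra.
  have k4 := hn0 n hn _ _ (proj_grid (leqnn n) (BN z Bz)) (proj_grid (leqnn n) (BN z' Bz')) d9.
  apply: (@le_trans _ _ ((2 * A + 1) * r ^+ n)).
    by have := compare z z' n Bz Bz' hn; move: k4; lra.
  apply: (@le_trans _ _ (C1 * dist_st z z' `^ b)); last by rewrite ler_wpM2r// lerDl.
  rewrite /C1 -mulrA; apply: ler_wpM2l; first by rewrite addr_ge0// mulr_ge0.
  rewrite rn -powRM ?dist_st_ge0//.
  by apply: ge0_ler_powR; rewrite ?nnegrE ?(ltW b0) ?(ltW (h2n n)) ?mulr_ge0 ?dist_st_ge0// ltW.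
apply: (@le_trans _ _ (C2 * dist_st z z' `^ b)); last by rewrite ler_wpM2r// lerDr.
apply: (@le_trans _ _ (2 * A + 2 * S)).
  apply: le_trans (compare z z' n0 Bz Bz' (leqnn n0)) _.
  have k1 := ler_normB (x (proj n0 z)) (x (proj n0 z')).
  have k2 := Sx z Bz; have k3 := Sx z' Bz'.
  have k4 : A * r ^+ n0 <= A by rewrite ler_piMr// exprn_ile1// ltW.
  by move: k1 k2 k3 k4; lra.
rewrite /C2 mulrAC ler_pdivlMr ?exprn_gt0//; apply: ler_wpM2l.
  by rewrite addr_ge0// mulr_ge0.
rewrite rn.
by apply: ge0_ler_powR; rewrite ?nnegrE ?(ltW b0) ?(ltW (h2n _)) ?dist_st_ge0// ltW.
Qed.

End path_regularity.

(** * The Hoelder modification *)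

Section continuous_modification.
Context d (Omega : measurableType d) (R : realType) (P : probability Omega R).
Context (X : R -> plane R -> {RV P >-> R}) (a b : R).
Hypothesis b0 : 0 < b.
Hypothesis ba : b < a / 2.
Hypothesis X_tail : forall T : R, 0 < T -> exists2 C : R, 0 < C & forall z z' (l : R),
  in_slab T z -> in_slab T z' -> 0 < dist_st z z' -> 0 < l ->
  (P [set w | (l <= `|X z.1 z.2 w - X z'.1 z'.2 w|)%R] <=
    (2 * expR (- (l ^+ 2 / (C * dist_st z z' `^ a))))%:E)%E.
Let r : R := 2 `^ (- b).
Let path (w : Omega) (z : spacetime R) : R := X z.1 z.2 w.

Let jump (n : nat) (p q : spacetime R) : set Omega :=
  [set w | r ^+ n <= `|path w p - path w q|].

Let measurable_jump n p q : measurable (jump n p q).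
Proof. by apply: measurable_ge_norm; rewrite /path; mfun. Qed.

Let bad (N n : nat) : set Omega :=
  [set w | exists p q, [/\ grid N n p, grid N n q, dist_st p q <= 9 * 2 ^- n & jump n p q w]].

(** A union bound over all pairs of grid points, of which there are at most
    [(4 * N.+1) ^+ 6 * 2 ^+ (6 * n)]. *)
Let bad_bound (N : nat) : exists2 A : R, 0 <= A &
  forall n, measurable (bad N n) /\ (P (bad N n) <= (A * 2 ^- n)%:E)%E.
Proof.
have N0 : 0 < N.+1%:R :> R by rewrite ltr0n.
have [A A0 hA] := @pair_tail_rate _ Omega R P (fun t x => X t x) a b b0 ba X_tail _ N0.
exists ((4 * N.+1%:R) ^+ 6 * A); first by rewrite mulr_ge0// exprn_ge0// mulr_ge0.
move=> n; pose K := 'I_(2 * N.+1 * 2 ^ n).+1.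
pose pt (k : K * K * K) := grid_point R N n (k.1.1 : nat, k.1.2 : nat, k.2 : nat).
pose near (k : (K * K * K) * (K * K * K)) : Prop :=
  [/\ in_slab N.+1%:R (pt k.1), in_slab N.+1%:R (pt k.2) & dist_st (pt k.1) (pt k.2) <= 9 * 2 ^- n].
pose G k : set Omega := if `[< near k >] then jump n (pt k.1) (pt k.2) else set0.
have mG k : measurable (G k) by rewrite /G; case: ifP.
have hG k : (P (G k) <= (A * 2 ^- (7 * n))%:E)%E.
  rewrite /G; case: asboolP => [[h1 h2 h3]|_]; first exact: hA h1 h2 h3.
  by rewrite measure0 lee_fin mulr_ge0// invr_ge0 exprn_ge0.
have e : bad N n = [set w | exists k, G k w].
  apply/seteqP; split=> w /=.
    move=> [p [q [gp gq dpq jpq]]]; have [k ek] := grid_finite gp; have [l el] := grid_finite gq.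
    exists (k, l); rewrite /G; case: asboolP => [_|]; first by rewrite /pt -ek -el.
    by case; case: gp => sp _; case: gq => sq _; rewrite /near /pt /= -ek -el.
  move=> [k]; rewrite /G; case: asboolP => // -[h1 h2 h3] hj.
  by exists (pt k.1), (pt k.2); split=> //; split=> //; [exists (k.1.1.1 : nat, k.1.1.2 : nat, k.1.2 : nat)|
    exists (k.2.1.1 : nat, k.2.1.2 : nat, k.2.2 : nat)].
have [mU hU] := finite_union_bound mG hG; rewrite e; split=> //.
apply: le_trans hU _; rewrite lee_fin.
have cK : (#|{: (K * K * K) * (K * K * K)}|)%:R <= (4 * N.+1%:R) ^+ 6 * 2 ^+ (6 * n) :> R.
  rewrite !card_prod !card_ord !natrM.
  set c : R := _.+1%:R.
  have c1 : c <= 4 * N.+1%:R * 2 ^+ n.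
    rewrite /c -natr1 !natrM natrX.
    have : 1 <= N.+1%:R * 2 ^+ n :> R.
      by rewrite -[leLHS]mulr1 ler_pM// ?ler1n// exprn_ege1// ler1n.
    by move: (N.+1%:R * 2 ^+ n) (mulrA 2 (N.+1%:R : R) (2 ^+ n)) (mulrA 4 (N.+1%:R : R) (2 ^+ n))
      => y <- <-; lra.
  have c0 : 0 <= c by exact: ler0n.
  rewrite (mulnC 6) exprM -exprMn.
  have -> : c * c * c * (c * c * c) = c ^+ 6 by ring.
  by rewrite lerXn2r// nnegrE (le_trans c0).
apply: le_trans (ler_wpM2r _ cK) _.
  by rewrite mulr_ge0// invr_ge0 exprn_ge0.
have h2 k : 2 ^+ k != 0 :> R by rewrite expf_neq0.
rewrite (_ : 7 * n = 6 * n + n)%N; last by rewrite -[in RHS](mul1n n) mulnA -mulnDl.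
rewrite exprD invfM; rewrite le_eqVlt; apply/orP; left; apply/eqP.
by field; rewrite !h2.
Qed.

Let null : set Omega := \bigcup_N lim_sup_set (bad N).

Let measurable_null : measurable null.
Proof.
apply: bigcup_measurable => N _; apply: measurable_lim_sup_set => n.
by have [A _ hA] := bad_bound N; have [] := hA n.
Qed.

Let P_null : P null = 0%E.
Proof.
apply/negligibleP; first exact: measurable_null.
apply: negligible_bigcup => N.
have [A A0 hA] := bad_bound N.
apply/negligibleP; first by apply: measurable_lim_sup_set => n; have [] := hA n.
by apply: (geometric_borel_cantelli A0) => n; have [] := hA n.
Qed.

Let regular (w : Omega) : ~ null w -> regular_on_grids b (path w).
Proof.
move=> nw N; have : ~ lim_sup_set (bad N) w by move=> h; apply: nw; exists N.
move=> /not_lim_sup_set[n0 hn0]; exists n0 => n hn p q gp gq dpq.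
by rewrite ltNge; apply/negP => h; apply: (hn0 n hn); exists p, q.
Qed.

Let Y0 (t : R) (x : plane R) (w : Omega) : R :=
  if (0 < t) && (w \notin null) then grid_limit (path w) (t, x) else 0.

Let slab_of (z : spacetime R) : 0 < z.1 -> exists N : nat, in_slab N%:R z.
Proof.
move=> z0; exists (Num.truncn (`|z.1| + `|z.2.1| + `|z.2.2|)).+1.
have := truncnS_gt (`|z.1| + `|z.2.1| + `|z.2.2|) => /ltW.
set B := _.+1%:R => hB; have h1 := normr_ge0 z.2.1; have h2 := normr_ge0 z.2.2.
have h3 := ler_norm z.1.
by split; [rewrite z0 /=|..]; lra.
Qed.

Let path_cvg w (z : spacetime R) : 0 < z.1 -> ~ null w ->
  path w (proj n z) @[n --> \oo] --> grid_limit (path w) z.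
Proof. by move=> z0 nw; have [N hN] := slab_of z0; apply: (grid_limit_cvg b0 (regular nw) hN). Qed.

Let measurable_Y0 t x : measurable_fun setT (Y0 t x).
Proof.
have [t0|t0] := ltP 0 t; last first.
  by rewrite (_ : Y0 t x = cst 0)//; apply/funext => w; rewrite /Y0 ltNge t0.
apply: (measurable_fun_cvg (h := fun n w => \1_(~` null) w * path w (proj n (t, x)))) => //.
- move=> n; apply: mf_mul; last by rewrite /path; mfun.
  by apply: measurable_indic; exact: measurableC.
- move=> w _; rewrite /Y0 t0 /=; have [wn|wn] := boolP (w \in null).
    rewrite (_ : (fun n => _) = cst 0); first exact: cvg_cst.
    by apply/funext => n; rewrite indicE in_setC wn mul0r.
  rewrite (_ : (fun n => _) = (fun n => path w (proj n (t, x)))).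
    by apply: path_cvg => //; move: wn; rewrite notin_setE.
  by apply/funext => n; rewrite indicE in_setC wn mul1r.
Qed.

Let Y (t : R) (x : plane R) : {RV P >-> R} :=
  HB.pack (Y0 t x) (isMeasurableFun.Build _ _ _ _ (Y0 t x) (measurable_Y0 t x)).

(** Almost surely [X] at the projections of [(t, x)] converges to [X t x], again by the
    tail bound and Borel-Cantelli, while by construction it converges to [Y t x]. *)
Let modification t x : 0 < t -> {ae P, forall w, Y t x w = X t x w}.
Proof.
move=> t0; have [N hN] := slab_of (t0 : 0 < (t, x).1).
have N0 : 0 < N.+1%:R :> R by rewrite ltr0n.
have [A A0 hA] := @pair_tail_rate _ Omega R P (fun t x => X t x) a b b0 ba X_tail _ N0.
have slN : in_slab N.+1%:R (t, x).
  have NN : N%:R <= N.+1%:R :> R by rewrite ler_nat.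
  by case: hN => /andP[k1 k2] k3 k4; split; [rewrite k1|..]; rewrite ?(le_trans _ NN).
pose D n := jump n (proj n (t, x)) (t, x).
have mD n : measurable (D n) by exact: measurable_jump.
have PD : P (lim_sup_set D) = 0%E.
  apply: (geometric_borel_cantelli A0) => // n.
  apply: le_trans (hA n (proj n (t, x)) (t, x) _ slN _) _.
  - by have [] := proj_grid (leqnn n) hN.
  - rewrite dist_stC; apply: le_trans (proj_dist n (t, x)) _.
    by rewrite ler_wpM2r ?invr_ge0 ?exprn_ge0// ler_nat.
  - rewrite lee_fin ler_wpM2l// lef_pV2 ?posrE ?exprn_gt0//.
    by rewrite ler_eXn2l ?ltr1n// leq_pmull.
have mLD := measurable_lim_sup_set mD.
exists (null `|` lim_sup_set D); split.
- exact: measurableU.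
- by apply: null_set_setU.
- move=> w /= hw; apply: contrapT => nw; apply: hw.
  have n1 : ~ null w by move=> h; apply: nw; left.
  have /not_lim_sup_set[n0 hn0] : ~ lim_sup_set D w by move=> h; apply: nw; right.
  rewrite /Y0 t0 /= memNset//.
  have rc : r ^+ n @[n --> \oo] --> (0 : R).
    by apply: cvg_expr; rewrite ger0_norm ?powR_ge0// powR2_lt1.
  have c2 : path w (proj n (t, x)) @[n --> \oo] --> X t x w.
    apply/cvgrPdist_lt => e e0; have /cvgrPdist_lt /(_ e e0) [n1' _ hn1] := rc.
    exists (maxn n0 n1') => // n /= hn.
    have k1 := hn0 n (leq_trans (leq_maxl _ _) hn).
    have k2 := hn1 n (leq_trans (leq_maxr _ _) hn).
    move: k2; rewrite /= sub0r normrN ger0_norm ?exprn_ge0 ?powR_ge0// => k2.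
    apply: lt_trans k2; rewrite ltNge distrC; exact/negP.
  by apply: (cvg_unique (@norm_hausdorff _ _) (path_cvg (t0 : 0 < (t, x).1) n1) c2).
Qed.

Lemma continuous_modification :
  exists Y : R -> plane R -> {RV P >-> R},
    (forall t x, 0 < t -> {ae P, forall w, Y t x w = X t x w}) /\
    {ae P, forall w, forall B : set (spacetime R),
       bounded_set B -> B `<=` [set z | 0 < z.1] ->
       hoelder_on B b (fun z => Y z.1 z.2 w)}.
Proof.
exists Y; split; first exact: modification.
exists null; split=> // w /= hw; apply: contrapT => nw; apply: hw => B bB Bpos.
have [C hC] := grid_limit_hoelder b0 (regular nw) bB Bpos.
exists C => z z' Bz Bz'; have := hC z z' Bz Bz'.
have e y : B y -> Y0 y.1 y.2 w = grid_limit (path w) y.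
  by move=> By; rewrite /Y0 (Bpos y By) /= memNset// -surjective_pairing.
by rewrite /= (e z Bz) (e z' Bz').
Qed.

End continuous_modification.

(** [increment_tail] gives the tail bound with [a = alpha / 2], and
    [continuous_modification] needs [b < a / 2]. *)
Theorem theorem3p3 (R : realType) (d : measure_display)
    (Omega : measurableType d) (P : probability Omega R)
    (m : R) (f : R -> R) (alpha : R)
    (F : (spacetime R -> R) -> {RV P >-> R})
    (M : R -> set (plane R) -> {RV P >-> R})
    (X : R -> plane R -> {RV P >-> R}) :
  0 <= m < 1 ->
  (forall r, 0 <= r -> 0 <= f r) ->
  (forall r, 0 < r -> {for r, continuous f}) ->
  gaussian_noise f F ->
  martingale_measure_of f F M ->
  0 < alpha < 1 ->
  (exists2 delta : R, 0 < delta &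
     (\int[lebesgue_measure]_(r in `]0%R, delta[)
        (f r * r `^ (1 - alpha))%:E < +oo)%E) ->
  (forall t x, 0 < t ->
     walsh_integral f M
       (fun z => \1_(`]0, t] `*` [set: plane R]) z
                 * green (t - z.1) (x - z.2) m)
       (X t x)) ->
  forall b : R, 0 < b < alpha / 4 ->
  exists Y : R -> plane R -> {RV P >-> R},
    (forall t x, 0 < t -> {ae P, forall w, Y t x w = X t x w}) /\
    {ae P, forall w, forall B : set (spacetime R),
       bounded_set B -> B `<=` [set z | 0 < z.1] ->
       hoelder_on B b (fun z => Y z.1 z.2 w)}.
Proof.
move=> m01 f_ge0 f_cont F_noise M_noise a01 f_int X_walsh b /andP[b0 b1].
apply: (continuous_modification (a := alpha / 2) b0); first by lra.
exact: (increment_tail m01 f_ge0 f_cont F_noise M_noise a01 f_int X_walsh).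
Qed.
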